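(* For any partition $\lambda$ with conjugate partition $\lambda'$, one has the equality of formal series in $\mathbb{N}[[q]]$ $$K_{\lambda,\emptyset}^{\mathfrak{so}}(q)=K_{\lambda',\emptyset}^{\mathfrak{sp}}(q).$$
   Context: Let $\mathfrak g$ be $\mathfrak{so}_{2n+1}$, $\mathfrak{sp}_{2n}$ or $\mathfrak{so}_{2n}$. Partitions with at most $n$ nonzero parts are padded by zeros and viewed as vectors of $\mathbb{Z}^n$ with standard basis $\varepsilon_1,\dots,\varepsilon_n$. Positive roots $R^+$: $\varepsilon_i\pm\varepsilon_j$ ($1\le i<j\le n$) together with all $\varepsilon_i$ for $\mathfrak{so}_{2n+1}$; together with all $2\varepsilon_i$ for $\mathfrak{sp}_{2n}$; and no others for $\mathfrak{so}_{2n}$. $\rho$ is the half sum of positive roots, $W^{\mathfrak g}$ the Weyl group (signed permutations of coordinates; with an even number of sign changes for $\mathfrak{so}_{2n}$), $\ell$ its length function, $w\circ\beta=w(\beta+\rho)-\rho$. Define $\mathcal{P}_q$ by $\prod_{\alpha\in R^+}\frac{1}{1-qe^\alpha}=\sum_\beta\mathcal{P}_q(\beta)e^\beta$; the Lusztig $q$-analogue is $K_{\lambda,\mu}^{\mathfrak g}(q)=\sum_{w\in W^{\mathfrak g}}(-1)^{\ell(w)}\mathcal{P}_q(w\circ\lambda-\mu)$, with coefficient of $q^k$ denoted $K_{\lambda,\mu}^{\mathfrak g,k}$. For fixed $\lambda,\mu,k$ these coefficients are independent of $n$ for $n$ sufficiently large, and one sets $K_{\lambda,\mu}^{\mathfrak{so},k}=\lim_{n\to\infty}K_{\lambda,\mu}^{\mathfrak{so}_{2n+1},k}=\lim_{n\to\infty}K_{\lambda,\mu}^{\mathfrak{so}_{2n},k}$,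 $K_{\lambda,\mu}^{\mathfrak{sp},k}=\lim_{n\to\infty}K_{\lambda,\mu}^{\mathfrak{sp}_{2n},k}$, and $K_{\lambda,\mu}^{\mathfrak{so}}(q)=\sum_{k\ge0}K_{\lambda,\mu}^{\mathfrak{so},k}q^k$, $K_{\lambda,\mu}^{\mathfrak{sp}}(q)=\sum_{k\ge0}K_{\lambda,\mu}^{\mathfrak{sp},k}q^k$. Here $\emptyset$ is the empty partition (the weight $0$). *)

(* Defs.v *)
From mathcomp Require Import all_boot all_order all_fingroup all_algebra.
From Stdlib Require Import ClassicalEpsilon.

Set Implicit Arguments.
Unset Strict Implicit.
Unset Printing Implicit Defensive.

Import Order.TTheory GRing.Theory Num.Theory.
Local Open Scope ring_scope.

Definition is_part (la : seq nat) : bool := sorted geq la && (0%N \notin la).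

Definition conj_part (la : seq nat) : seq nat :=
  mkseq (fun j => count (fun p => (j < p)%N) la) (head 0%N la).

Inductive lie_type := SOodd | SP | SOeven.

(* Rational coordinates, since rho has half-integral ones for so_(2n+1). *)
Definition weight (n : nat) := 'rV[rat]_n.

(* Truncates when la has more than n parts; only large n matter below. *)
Definition part_weight (n : nat) (la : seq nat) : weight n :=
  \row_(i < n) (nth 0%N la i)%:R.

Definition eps (n : nat) (i : 'I_n) : weight n := delta_mx 0 i.

Definition pos_roots (g : lie_type) (n : nat) : seq (weight n) :=
  [seq eps p.1 - eps p.2 | p : 'I_n * 'I_n <- enum {: 'I_n * 'I_n} & (p.1 < p.2)%N] ++
  [seq eps p.1 + eps p.2 | p : 'I_n * 'I_n <- enum {: 'I_n * 'I_n} & (p.1 < p.2)%N] ++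
  match g with
  | SOodd => [seq eps i | i <- enum 'I_n]
  | SP => [seq 2 *: eps i | i <- enum 'I_n]
  | SOeven => [::]
  end.

Definition rho (g : lie_type) (n : nat) : weight n :=
  2^-1 *: \sum_(a <- pos_roots g n) a.

Definition sgn_perm (n : nat) := ({perm 'I_n} * {set 'I_n})%type.

Definition in_weyl (g : lie_type) (n : nat) (w : sgn_perm n) : bool :=
  match g with SOeven => ~~ odd #|w.2| | _ => true end.

Definition weyl_act (n : nat) (w : sgn_perm n) (v : weight n) : weight n :=
  \row_i ((-1) ^+ (i \in w.2) * v 0 (w.1 i)).

Definition simple_roots (g : lie_type) (n : nat) : seq (weight n) :=
  [seq a <- pos_roots g n |
     ~~ has (fun b => has (fun c => a == b + c) (pos_roots g n))
            (pos_roots g n)].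

Definition dot (n : nat) (u v : weight n) : rat := \sum_i u 0 i * v 0 i.

Definition reflection (n : nat) (a v : weight n) : weight n :=
  v - (2 * dot v a / dot a a) *: a.

Definition is_word (g : lie_type) (n : nat) (w : sgn_perm n)
    (s : seq (weight n)) : Prop :=
  {subset s <= simple_roots g n} /\
  forall v, weyl_act w v = foldr (@reflection n) v s.

Definition is_length (g : lie_type) (n : nat) (w : sgn_perm n) (m : nat) : Prop :=
  (exists2 s, is_word g w s & size s = m) /\
  (forall s, is_word g w s -> (m <= size s)%N).

(* Meaningful for w in the Weyl group, which the simple reflections generate. *)
Definition weyl_length (g : lie_type) (n : nat) (w : sgn_perm n) : nat :=
  epsilon (inhabits 0%N) (is_length g w).

Definition dot_act (g : lie_type) (n : nat) (w : sgn_perm n) (b : weight n) :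
    weight n :=
  weyl_act w (b + rho g n) - rho g n.

(* f k b is the coefficient of q^k e^b of a formal series. *)
Definition qe_series (n : nat) := nat -> weight n -> int.

Definition qe_one (n : nat) : qe_series n :=
  fun k b => ((k == 0%N) && (b == 0))%:R.

(* f / (1 - q e^a), i.e. the product of f by \sum_j q^j e^(j a). *)
Definition qe_div (n : nat) (a : weight n) (f : qe_series n) : qe_series n :=
  fun k b => \sum_(j < k.+1) f (k - j)%N (b - a *+ j).

(* Multiplying qe_div a f by 1 - q e^a gives back f. *)
Lemma qe_divK (n : nat) (a : weight n) (f : qe_series n) (k : nat)
    (b : weight n) :
  qe_div a f k b - (if k is k'.+1 then qe_div a f k' (b - a) else 0) = f k b.
Proof.
rewrite /qe_div; case: k => [|k]; first by rewrite big_ord1 mulr0n !subr0.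
rewrite big_ord_recl /= mulr0n subr0 subn0 -[RHS]addr0 -addrA; congr (_ + _).
apply/eqP; rewrite subr_eq0; apply/eqP/eq_bigr => j _.
by rewrite /bump /= add1n subSS mulrS opprD addrA.
Qed.

(* Coefficient of q^k in P_q(b). *)
Definition kostant_q (g : lie_type) (n : nat) : qe_series n :=
  foldr (@qe_div n) (@qe_one n) (pos_roots g n).

(* Coefficient of q^k in K_(la,mu)(q) for the algebra of type g and rank n. *)
Definition lusztig_coef (g : lie_type) (n : nat) (la mu : seq nat) (k : nat) :
    int :=
  \sum_(w : sgn_perm n | in_weyl g w)
     (-1) ^+ weyl_length g w *
     kostant_q g k (dot_act g w (part_weight n la) - part_weight n mu).

Definition stable_lim (u : nat -> int) (c : int) : Prop :=
  exists N : nat, forall n : nat, (N <= n)%N -> u n = c.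

Lemma stable_lim_unique (u : nat -> int) (c d : int) :
  stable_lim u c -> stable_lim u d -> c = d.
Proof.
move=> [N uc] [M ud].
by rewrite -(uc (maxn N M)) ?leq_maxl // (ud (maxn N M)) ?leq_maxr.
Qed.

(* A formal series in N[[q]] is given by its coefficient sequence. *)
Definition is_Kso (la mu : seq nat) (S : nat -> nat) : Prop :=
  forall k, stable_lim (fun n => lusztig_coef SOodd n la mu k) (S k)%:Z /\
            stable_lim (fun n => lusztig_coef SOeven n la mu k) (S k)%:Z.

Definition is_Ksp (la mu : seq nat) (S : nat -> nat) : Prop :=
  forall k, stable_lim (fun n => lusztig_coef SP n la mu k) (S k)%:Z.

(* Main.v *)
(* In the coordinates l = lambda + delta, where delta = (n-1, ..., 0), the
   coefficient of q^k in the Lusztig analogue obeys Morris' recurrence along the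
   first coordinate of l.  Sign-reversing involutions bring it, for n large
   compared with k and lambda, to the recurrence satisfied by
     sum over s in S_n of sgn(s) [q^k x^(l o s - delta)] F,
   where F is the product of the 1 / (1 - q^a x_i x_j) over a >= 1 and i <= j,
   the pairs i = j being allowed only for a odd (type C), respectively a even
   (types B and D).  So this sum is the stable value.

   The coefficient of x^b in F is the multiplicity, in the permutation character
   of S_m (m = |lambda|) on words of content b, of a signed permutation character
   on perfect matchings with coloured pairs: reversing a pair costs a sign when
   its colour has the wrong parity.  The alternating sum of the word characters
   is the irreducible character of lambda, hence the stable value is a natural
   number.  Twisting by the sign character conjugates lambda, and it exchanges
   the two matching characters because the sign of a permutation commuting with
   a fixed-point-free involution is the parity of the number of pairs it
   reverses. *)
Require Import Defs.
From HB Require Import structures.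
From mathcomp Require Import all_boot all_order all_fingroup all_algebra.
From mathcomp Require Import all_solvable all_field all_character.
From mathcomp Require Import zify ring lra.
From Stdlib Require Import ClassicalEpsilon.

Set Implicit Arguments.
Unset Strict Implicit.
Unset Printing Implicit Defensive.

Import Order.TTheory GRing.Theory Num.Theory.
Local Open Scope ring_scope.

(** * Signed sums and coefficients of products of geometric series *)

(** The recurrence leaves the partitions at once: its terms are indexed by vectors with one
    coordinate less and entries in no particular order. The comparison is therefore made for all
    nonnegative vectors; those with two equal entries give 0 on both sides. For n distinct entries
    the sum is at least 0 + ... + (n-1), and its excess over this bound, at most |lambda| at the
    start, never grows. That n is large must survive the descent too; it is recorded by one large
    entry, measured against a budget proportional to the remaining degree k. A step that shifts
    something spends degree, and any other step only deletes an entry equal to the top entry of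
    delta.

    The two recurrences do not lower the rank in the same way: expanding the sum over S_n deletes a
    coordinate, and Pieri's rule restores one. Both sides still end with equally many coordinates,
    because the symmetric sum first drops a zero coordinate at no cost.

    Irreducibility comes from a norm: the Jacobi-Trudi combination of word characters has norm 1
    because Kostka numbers are unitriangular for dominance. Conjugation comes from the single 0-1
    matrix with margins lambda and lambda'. *)

Lemma sum_involution (T : finType) (P : pred T) (f : T -> int) (h : T -> T) :
  (forall x, P x -> [/\ P (h x), h (h x) = x & f (h x) = - f x]) ->
  \sum_(x | P x) f x = 0.
Proof.
move=> hP; set S := \sum_(x | _) _.
(* Fixed points of [h] are harmless: the value of [f] at one of them is its own opposite. *)
suff : S = - S by lia.
rewrite {1}/S (reindex_onto h h) => [|x Px]; last by case: (hP x Px).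
rewrite /S -sumrN; apply: eq_big => [x|x].
  apply/andP/idP => [[Phx /eqP <-]|Px]; first by case: (hP _ Phx).
  by case: (hP x Px) => -> -> _.
case/andP=> Phx /eqP hx; have [Px _ _] := hP _ Phx.
by rewrite hx in Px; case: (hP x Px) => _ _ ->.
Qed.

(** The index set of a Laplace expansion along row [i0]; for [ord0] the sign of [lift_perm] yields
    the factors [(-1) ^+ j] of the recurrences. *)
Lemma sum_lift_perm (R : nmodType) n (i0 : 'I_n.+1) (f : 'S_n.+1 -> R) :
  \sum_s f s = \sum_(j < n.+1) \sum_(s : 'S_n) f (lift_perm i0 j s).
Proof.
rewrite (partition_big (fun s : 'S_n.+1 => s i0) xpredT) //=.
apply: eq_bigr => j _; rewrite (reindex (lift_perm i0 j)) /=; last first.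
  pose ulsf i (s : 'S_n.+1) k := odflt k (unlift (s i) (s (lift i k))).
  have ulsfK i (s : 'S_n.+1) k: lift (s i) (ulsf i s k) = s (lift i k).
    rewrite /ulsf; have:= neq_lift i k.
    by rewrite -(can_eq (permK s)) => /unlift_some[] ? ? ->.
  have inj_ulsf: injective (ulsf i0 _).
    move=> s; apply: can_inj (ulsf (s i0) s^-1%g) _ => k'.
    by rewrite {1}/ulsf ulsfK !permK liftK.
  exists (fun s => perm (inj_ulsf s)) => [s _ | s].
    by apply/permP=> k'; rewrite permE /ulsf lift_perm_lift lift_perm_id liftK.
  move/(s _ =P _) => si0; apply/permP=> k.
  case: (unliftP i0 k) => [k'|] ->; rewrite ?lift_perm_id //.
  by rewrite lift_perm_lift -si0 permE ulsfK.
by apply: eq_bigl => s; rewrite lift_perm_id eqxx.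
Qed.

Section Count.
Variables (V : zmodType) (B : nat).

(* For k < B, cnt L k b counts the multiplicities m : L -> N whose total
   degree is k and whose vectors add up to b. *)
Fixpoint cnt (L : seq (nat * V)) (k : nat) (b : V) : int :=
  if L is av :: L' then
    \sum_(j < B | (av.1 * j <= k)%N) cnt L' (k - av.1 * j) (b - av.2 *+ j)
  else ((k == 0%N) && (b == 0))%:R.

Lemma cnt_swap x y L k b : cnt (x :: y :: L) k b = cnt (y :: x :: L) k b.
Proof.
case: x y => [a v] [c w] /=.
have E (a' c' : nat) (v' w' : V) :
  \sum_(j < B | (a' * j <= k)%N)
    \sum_(i < B | (c' * i <= k - a' * j)%N) cnt L (k - a' * j - c' * i) (b - v' *+ j - w' *+ i)
  = \sum_(j < B) \sum_(i < B | (a' * j + c' * i <= k)%N)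
       cnt L (k - (a' * j + c' * i)) (b - (v' *+ j + w' *+ i)).
  rewrite big_mkcond; apply: eq_bigr => j _; case: leqP => h.
    apply: eq_big => [i|i _]; first by rewrite -(leq_add2l (a' * j)) subnKC.
    by rewrite subnDA opprD addrA.
  rewrite big_pred0 // => i; apply/negbTE; rewrite -ltnNge.
  by apply: leq_trans h _; rewrite leq_addr.
rewrite !E (exchange_big_dep xpredT) //=; apply: eq_bigr => i _.
by apply: eq_big => [j|j _]; [rewrite addnC | rewrite addnC [X in b - X]addrC].
Qed.

Lemma cnt_cons_eq x L1 L2 :
  (forall k b, cnt L1 k b = cnt L2 k b) ->
  forall k b, cnt (x :: L1) k b = cnt (x :: L2) k b.
Proof. by move=> E k b; apply: eq_bigr => j _; apply: E. Qed.

Lemma cnt_rem x L : x \in L -> forall k b, cnt L k b = cnt (x :: rem x L) k b.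
Proof.
elim: L => // y L IH; rewrite inE /=; case: eqVneq => [->|ne] //= xL k b.
by rewrite -[RHS]/(cnt (x :: y :: _) k b) cnt_swap; apply: cnt_cons_eq (IH xL) k b.
Qed.

Lemma cnt_perm L1 L2 k b : perm_eq L1 L2 -> cnt L1 k b = cnt L2 k b.
Proof.
move=> E; elim: L1 L2 E k b => [|x L IH] L2.
  by move/perm_size/esym/size0nil => ->.
move=> E k b; have x2 : x \in L2 by rewrite -(perm_mem E) mem_head.
rewrite (cnt_rem x2); apply: cnt_cons_eq k b => k b; apply: IH.
by rewrite -(perm_cons x); apply: perm_trans E (perm_to_rem x2).
Qed.

Lemma cnt_big_degree x L k b : (0 < B)%N -> (k < x.1)%N -> cnt (x :: L) k b = cnt L k b.
Proof.
move=> B0 h; rewrite /= (bigD1 (Ordinal B0)) ?muln0 //= subn0 mulr0n subr0.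
rewrite big1 ?addr0 // => j /andP[le]; rewrite -val_eqE /= -lt0n => j0.
by move: le; rewrite leqNgt (leq_trans h) // leq_pmulr.
Qed.

(** Merges the nested sums over a block of factors into one sum over functions on the whole of [I],
    zero outside [s]: involutions and permutations can act directly on such functions. *)
Lemma cnt_block_weighted (I : finType) (a : I -> nat) (v : I -> V) (s : seq I) L k b :
  uniq s -> (k < B)%N ->
  cnt ([seq (a i, v i) | i <- s] ++ L) k b =
  \sum_(m : {ffun I -> 'I_B} |
          [forall i, (i \in s) || (m i == 0 :> nat)] && (\sum_i a i * m i <= k)%N)
     cnt L (k - \sum_i a i * m i) (b - \sum_i v i *+ m i).
Proof.
move=> us kB; have B0 : (0 < B)%N by apply: leq_ltn_trans kB.
pose z : 'I_B := Ordinal B0.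
elim: s us k b kB => [|i s IH] /= => [_ k b kB|/andP[nis us] k b kB].
  rewrite (big_pred1 [ffun=> z]) => [|m]; last first.
    apply/andP/eqP => [[/forallP m0 _]|->].
      by apply/ffunP => i; apply: val_inj; rewrite ffunE; apply/eqP/(m0 i).
    split; first by apply/forallP => i; rewrite ffunE.
    by rewrite big1 // => i _; rewrite ffunE /= muln0.
  by rewrite !big1 ?subn0 ?subr0 // => i _; rewrite ffunE /= ?muln0.
under eq_bigr => j le.
  rewrite IH ?(leq_ltn_trans (leq_subr _ _)) //. over.
(* [up j] inserts the multiplicity of the new index [i] into a function vanishing at [i], and [up z]
   removes it again. *)
pose up (j : 'I_B) (m : {ffun I -> 'I_B}) := [ffun i' => if i' == i then j else m i'].
rewrite [RHS](partition_big (fun m : {ffun I -> 'I_B} => m i) xpredT) //=.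
rewrite big_mkcond /=; apply: eq_bigr => j _.
rewrite [RHS](reindex_onto (up j) (up z)) /=; last first.
  move=> m /andP[_ /eqP mi]; apply/ffunP => i'; rewrite !ffunE.
  by case: eqP => // ->.
have Sup (m : {ffun I -> 'I_B}) : m i = z -> (\sum_i' a i' * up j m i' = a i * j + \sum_i' a i' * m i')%N.
  move=> mi; rewrite (bigD1 i) //= [in RHS](bigD1 i) //= mi ffunE eqxx /= muln0.
  by congr (_ + _)%N; apply: eq_bigr => i' ne; rewrite ffunE (negbTE ne).
have Vup (m : {ffun I -> 'I_B}) : m i = z ->
    \sum_i' v i' *+ up j m i' = v i *+ j + \sum_i' v i' *+ m i'.
  move=> mi; rewrite (bigD1 i) //= [in RHS](bigD1 i) //= mi ffunE eqxx /= mulr0n add0r.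
  by congr (_ + _); apply: eq_bigr => i' ne; rewrite ffunE (negbTE ne).
have upz (m : {ffun I -> 'I_B}) : (up z (up j m) == m) = (m i == z).
  apply/eqP/eqP => [<-|mi]; first by rewrite ffunE eqxx.
  by apply/ffunP => i'; rewrite !ffunE; case: eqP => // ->.
under [RHS]eq_bigl => m do rewrite upz.
have C (m : {ffun I -> 'I_B}) :
  ([forall i', (i' \in i :: s) || (up j m i' == 0 :> nat)] && (\sum_i' a i' * up j m i' <= k)%N
     && (up j m i == j) && (m i == z))
  = (a i * j <= k)%N && ([forall i', (i' \in s) || (m i' == 0 :> nat)] && (\sum_i' a i' * m i' <= k - a i * j)%N).
  rewrite ffunE !eqxx andbT; case: (eqVneq (m i) z) => [mi|ne]; last first.
    rewrite andbF; symmetry; apply/negbTE/negP => /and3P[_ /forallP/(_ i)].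
    by rewrite (negbTE nis) /= => /eqP mi0 _; case/eqP: ne; apply: val_inj.
  rewrite andbT Sup // andbCA; congr (_ && _).
    apply/forallP/forallP => H i'; move: (H i'); rewrite ffunE inE;
      case: (eqVneq i' i) => [->|] //; by rewrite ?mi eqxx ?orbT.
  by apply/idP/andP => [|[]]; lia.
case: leqP => h; last first.
  by rewrite big_pred0 // => m; rewrite C leqNgt h.
apply: eq_big => [m|m].
  by move: (C m); rewrite h /= => ->.
case/andP=> /forallP/(_ i); rewrite (negbTE nis) /= => /eqP mi0 _.
have mi : m i = z by apply: val_inj.
by rewrite Sup // Vup // subnDA opprD addrA.
Qed.


Lemma cnt_block (I : finType) (v : I -> V) (s : seq I) L k b :
  uniq s -> (k < B)%N ->
  cnt ([seq (1%N, v i) | i <- s] ++ L) k b =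
  \sum_(m : {ffun I -> 'I_B} |
          [forall i, (i \in s) || (m i == 0 :> nat)] && (\sum_i m i <= k)%N)
     cnt L (k - \sum_i m i) (b - \sum_i v i *+ m i).
Proof.
move=> us kB; rewrite (cnt_block_weighted (fun=> 1%N)) //.
have E (m : {ffun I -> 'I_B}) : (\sum_i 1 * m i = \sum_i m i)%N.
  by apply: eq_bigr => i _; rewrite mul1n.
by apply: eq_big => [m|m _]; rewrite E.
Qed.

End Count.

Lemma cnt_map_inj (V W : zmodType) (f : {additive V -> W}) B (L : seq (nat * V)) k b :
  injective f ->
  cnt B [seq (x.1, f x.2) | x <- L] k (f b) = cnt B L k b.
Proof.
move=> fi; elim: L k b => [|x L IH] k b /=.
  by rewrite -(inj_eq fi) raddf0.
by apply: eq_bigr => j _; rewrite -raddfMn -raddfB IH.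
Qed.

(** * The sign of a Weyl group element *)

Section WeylSign.
Variable n : nat.
Implicit Types (w : sgn_perm n) (v : weight n).

Definition sgn_comp w w0 : sgn_perm n :=
  ((w.1 * w0.1)%g, [set i | (i \in w.2) (+) (w.1 i \in w0.2)]).

(** The parity of the determinant of the signed permutation matrix. Every reflection is odd, so this
    is the parity of the length in all three types. *)
Definition sgn_odd w : bool := w.1 (+) odd #|w.2|.

Lemma weyl_act_comp w w0 v :
  weyl_act w (weyl_act w0 v) = weyl_act (sgn_comp w w0) v.
Proof.
apply/rowP => i; rewrite !mxE inE permM mulrA -signr_addb.
by [].
Qed.

Lemma odd_card_addb (A C : {set 'I_n}) :
  odd #|[set i | (i \in A) (+) (i \in C)]| = odd #|A| (+) odd #|C|.
Proof.
have E : [set i | (i \in A) (+) (i \in C)] = (A :\: C) :|: (C :\: A).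
  by apply/setP => i; rewrite !inE; case: (i \in A); case: (i \in C).
rewrite E cardsU.
have -> : (A :\: C) :&: (C :\: A) = set0.
  by apply/setP => i; rewrite !inE; case: (i \in A); case: (i \in C).
rewrite cards0 subn0 oddD -(cardsID C A) -(cardsID A C) !oddD (setIC C A).
by case: (odd _); case: (odd _); case: (odd _).
Qed.

Lemma card_preim_perm (s : 'S_n) (A : {set 'I_n}) : #|[set i | s i \in A]| = #|A|.
Proof.
have -> : [set i | s i \in A] = [set (s^-1)%g i | i in A].
  apply/setP => i; rewrite inE; apply/idP/imsetP => [h|[j jA ->]].
    by exists (s i); rewrite ?permK.
  by rewrite permKV.
by rewrite card_imset //; apply: perm_inj.
Qed.

Lemma sgn_odd_comp w w0 : sgn_odd (sgn_comp w w0) = sgn_odd w (+) sgn_odd w0.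
Proof.
case: w w0 => [s E] [s0 E0]; rewrite /sgn_odd /= odd_permM.
have -> : [set i | (i \in E) (+) (s i \in E0)] =
          [set i | (i \in E) (+) (i \in [set i | s i \in E0])].
  by apply/setP => i; rewrite !inE.
rewrite odd_card_addb card_preim_perm.
by case: (odd_perm s); case: (odd_perm s0); case: (odd #|E|); case: (odd _).
Qed.

Lemma weyl_act_inj w w' : (forall v, weyl_act w v = weyl_act w' v) -> w = w'.
Proof.
(* The vector (1, ..., n) has distinct positive entries, so its image reveals both the permutation
   and the signs. *)
case: w w' => [s E] [s' E'] /(_ (\row_i (i.+1)%:R)) H.
have {}H i : (-1) ^+ (i \in E) * (s i).+1%:R = (-1) ^+ (i \in E') * (s' i).+1%:R :> rat.
  by move/rowP/(_ i): H; rewrite !mxE.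
have P k : 0 < k.+1%:R :> rat by rewrite ltr0n.
have {}H i : (i \in E) = (i \in E') /\ s i = s' i.
  have N (x y : 'I_n) : x.+1%:R = y.+1%:R :> rat -> x = y.
    by move/eqP; rewrite eqr_nat => /eqP[] /val_inj.
  move: (H i) (P (s i)) (P (s' i)); case: (i \in E); case: (i \in E') => /=;
    rewrite ?expr1 ?expr0 ?mul1r ?mulN1r => h1 h2 h3; try (exfalso; lra); split=> //; apply: N; lra.
by congr (_, _); [apply/permP => i|apply/setP => i]; case: (H i).
Qed.

Lemma dotB_eps v (i j : 'I_n) : dot v (eps i - eps j) = v 0 i - v 0 j.
Proof.
rewrite /dot (eq_bigr (fun k => v 0 k * (k == i)%:R - v 0 k * (k == j)%:R)) => [|k _].
  rewrite sumrB (bigD1 i) //= [in X in _ - X](bigD1 j) //= !eqxx !mulr1.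
  rewrite !big1 ?addr0 // => k; by move/negbTE => ->; rewrite mulr0.
by rewrite !mxE !eqxx /= mulrBr.
Qed.

Lemma dotD_eps v (i j : 'I_n) : dot v (eps i + eps j) = v 0 i + v 0 j.
Proof.
rewrite /dot (eq_bigr (fun k => v 0 k * (k == i)%:R + v 0 k * (k == j)%:R)) => [|k _].
  rewrite big_split /= (bigD1 i) //= [in X in _ + X](bigD1 j) //= !eqxx !mulr1.
  rewrite !big1 ?addr0 // => k; by move/negbTE => ->; rewrite mulr0.
by rewrite !mxE !eqxx /= mulrDr.
Qed.

Lemma dotZ_eps v c (i : 'I_n) : dot v (c *: eps i) = c * v 0 i.
Proof.
rewrite /dot (bigD1 i) //= !mxE !eqxx /= mulr1 mulrC.
by rewrite big1 ?addr0 // => k /negbTE ki; rewrite !mxE ki andbF !mulr0.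
Qed.

Lemma reflectionB (i j : 'I_n) v : i != j ->
  reflection (eps i - eps j) v = weyl_act (tperm i j, set0) v.
Proof.
move=> ij; rewrite /reflection !dotB_eps; apply/rowP => k; rewrite !mxE inE !eqxx /= mul1r.
rewrite (eq_sym j i) (negbTE ij).
case: tpermP => [->|->|/eqP/negbTE-> /eqP/negbTE->]; rewrite ?eqxx /= ?subr0 ?mulr0 ?subr0 //.
  by rewrite (negbTE ij) /=; field.
by rewrite eq_sym (negbTE ij) /=; field.
Qed.

Lemma reflectionD (i j : 'I_n) v : i != j ->
  reflection (eps i + eps j) v = weyl_act (tperm i j, [set i; j]) v.
Proof.
move=> ij; rewrite /reflection !dotD_eps; apply/rowP => k; rewrite !mxE !inE !eqxx /=.
rewrite (eq_sym j i) (negbTE ij).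
case: tpermP => [->|->|/eqP/negbTE-> /eqP/negbTE->];
  rewrite ?eqxx /= ?orbT /= ?subr0 ?mul1r ?addr0 ?mulr0 ?subr0 //.
  by rewrite (negbTE ij) /=; field.
by rewrite eq_sym (negbTE ij) /=; field.
Qed.

Lemma reflectionZ c (i : 'I_n) v : c != 0 ->
  reflection (c *: eps i) v = weyl_act (1%g, [set i]) v.
Proof.
move=> c0; rewrite /reflection !dotZ_eps; apply/rowP => k; rewrite !mxE !inE !eqxx perm1 /=.
by case: eqVneq => [->|_] /=; rewrite ?mulr0 ?subr0 ?mul1r //; field.
Qed.

Lemma odd_tperm_set0 (i j : 'I_n) : i != j -> sgn_odd (tperm i j, set0).
Proof. by move=> ij; rewrite /sgn_odd /= odd_tperm ij cards0. Qed.

Lemma mem_pos_roots g a : a \in pos_roots g n ->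
  [\/ exists i j : 'I_n, (i < j)%N /\ a = eps i - eps j,
      exists i j : 'I_n, (i < j)%N /\ a = eps i + eps j
    | exists c i, [/\ c != 0, a = c *: eps i & c = if g is SP then 2 else 1] /\ g <> SOeven].
Proof.
rewrite !mem_cat => /or3P[/mapP[[i j]]|/mapP[[i j]]|].
- by rewrite mem_filter => /andP[ij _] ->; apply: Or31; exists i, j.
- by rewrite mem_filter => /andP[ij _] ->; apply: Or32; exists i, j.
case: g => // /mapP[i _ ->]; apply: Or33.
- by exists 1, i; rewrite scale1r.
- by exists 2, i.
Qed.

Lemma pos_root_reflection g a : a \in pos_roots g n ->
  exists2 w, sgn_odd w & forall v, reflection a v = weyl_act w v.
Proof.
case/mem_pos_roots => [[i [j [ij ->]]]|[i [j [ij ->]]]|[c [i [[c0 -> _] _]]]].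
- have ne : i != j by rewrite -val_eqE /= ltn_eqF.
  by exists (tperm i j, set0); [apply: odd_tperm_set0|move=> v; apply: reflectionB].
- have ne : i != j by rewrite -val_eqE /= ltn_eqF.
  exists (tperm i j, [set i; j]); last by move=> v; apply: reflectionD.
  by rewrite /sgn_odd /= odd_tperm cards2 ne.
- exists (1%g, [set i]); last by move=> v; apply: reflectionZ.
  by rewrite /sgn_odd /= odd_perm1 cards1.
Qed.

Definition sgn_one : sgn_perm n := (1%g, set0).

Lemma weyl_act_one v : weyl_act sgn_one v = v.
Proof. by apply/rowP => i; rewrite !mxE inE perm1 mul1r. Qed.

Lemma word_parity g w s : is_word g w s -> sgn_odd w = odd (size s).
Proof.
case=> sub wE.
suff [w0 o0 w0E] : exists2 w0, sgn_odd w0 = odd (size s) &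
    forall v, foldr (@reflection n) v s = weyl_act w0 v.
  by rewrite (@weyl_act_inj w w0) // => v; rewrite wE.
elim: s sub {wE} => [|a s IH] sub.
  by exists sgn_one => [|v]; rewrite /= ?weyl_act_one // /sgn_odd odd_perm1 cards0.
have [|w0 o0 w0E] := IH; first by move=> b bs; apply: sub; rewrite inE bs orbT.
have /sub : a \in a :: s by rewrite mem_head.
rewrite mem_filter => /andP[_ /pos_root_reflection[wa oa waE]].
exists (sgn_comp wa w0) => [|v]; first by rewrite sgn_odd_comp oa o0.
by rewrite /= w0E waE weyl_act_comp.
Qed.

(** * Generation of the Weyl group by simple reflections *)

Section Generation.
Variable g : lie_type.

(** With this shift, [height] is the pairing with half the sum of the positive coroots, which is (n,
    ..., 1), (n - 1/2, ..., 1/2) and (n - 1, ..., 0) in types B, C and D. *)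
Definition height_shift : rat := match g with SOodd => 1 | SP => 2^-1 | SOeven => 0 end.

Definition height v : rat := \sum_(j < n) (n%:R - 1 - j%:R + height_shift) * v 0 j.

Lemma heightD u v : height (u + v) = height u + height v.
Proof. by rewrite -big_split; apply: eq_bigr => j _; rewrite mxE mulrDr. Qed.

Lemma heightZ c v : height (c *: v) = c * height v.
Proof. by rewrite mulr_sumr; apply: eq_bigr => j _; rewrite mxE mulrCA. Qed.

Lemma height_eps (i : 'I_n) : height (eps i) = n%:R - 1 - i%:R + height_shift.
Proof.
rewrite /height (bigD1 i) //= !mxE !eqxx mulr1 big1 ?addr0 // => k /negbTE ki.
by rewrite !mxE ki andbF mulr0.
Qed.

Lemma height_pos_root a : a \in pos_roots g n -> 1 <= height a.
Proof.
have bnd (i : 'I_n) : i%:R + 1 <= n%:R :> rat by rewrite natr1 ler_nat.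
have hs0 : 0 <= height_shift by rewrite /height_shift; case: g; lra.
case/mem_pos_roots => [[i [j [ij ->]]]|[i [j [ij ->]]]|[c [i [[_ -> cE] gE]]]].
- rewrite -scaleN1r heightD heightZ !height_eps.
  have : i%:R + 1 <= j%:R :> rat by rewrite natr1 ler_nat.
  lra.
- rewrite heightD !height_eps.
  have : i%:R + 1 <= j%:R :> rat by rewrite natr1 ler_nat.
  move: (bnd j); lra.
- rewrite heightZ height_eps {}cE; move: (bnd i) gE.
  rewrite /height_shift; case: g => // h _; lra.
Qed.

(** A sum of two positive roots has height at least 2, so a root of height 1 is indecomposable. *)
Lemma height1_simple a : a \in pos_roots g n -> height a = 1 -> a \in simple_roots g n.
Proof.
move=> aR a1; rewrite mem_filter aR andbT; apply/hasPn => b bR; apply/hasPn => c cR.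
apply/eqP => E; move: (height_pos_root bR) (height_pos_root cR).
by move: a1; rewrite E heightD; lra.
Qed.

Definition generated w := exists s, is_word g w s.

Lemma generated_comp w w0 : generated w -> generated w0 -> generated (sgn_comp w w0).
Proof.
move=> [s [sub sE]] [s0 [sub0 s0E]]; exists (s ++ s0); split.
  by move=> a; rewrite mem_cat => /orP[/sub|/sub0].
by move=> v; rewrite -weyl_act_comp foldr_cat -s0E -sE.
Qed.

Lemma generated_one : generated sgn_one.
Proof. by exists [::]; split => // v; rewrite weyl_act_one. Qed.

Lemma generated_simple a w : a \in simple_roots g n ->
  (forall v, reflection a v = weyl_act w v) -> generated w.
Proof.
move=> aS E; exists [:: a]; split => [b|v /=]; last by rewrite E.
by rewrite inE => /eqP ->.
Qed.

Lemma mem_rootB (i j : 'I_n) : (i < j)%N -> eps i - eps j \in pos_roots g n.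
Proof.
move=> ij; rewrite mem_cat; apply/orP; left; apply/mapP; exists (i, j) => //.
by rewrite mem_filter ij mem_enum.
Qed.

Lemma mem_rootD (i j : 'I_n) : (i < j)%N -> eps i + eps j \in pos_roots g n.
Proof.
move=> ij; rewrite !mem_cat; apply/orP; right; apply/orP; left.
by apply/mapP; exists (i, j) => //; rewrite mem_filter ij mem_enum.
Qed.

Lemma generated_adjacent (i j : 'I_n) : j = i.+1 :> nat -> generated (tperm i j, set0).
Proof.
move=> ji; apply: (@generated_simple (eps i - eps j)) => [|v].
  apply: height1_simple; first by apply: mem_rootB; rewrite ji.
  by rewrite -scaleN1r heightD heightZ !height_eps ji -natr1; ring.
by apply: reflectionB; rewrite -val_eqE /= ji ltn_eqF.
Qed.

Lemma sgn_comp_perm (s t : 'S_n) : sgn_comp (s, set0) (t, set0) = ((s * t)%g, set0).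
Proof. by congr (_, _); apply/setP => i; rewrite !inE. Qed.

Lemma generated_tperm (i j : 'I_n) : generated (tperm i j, set0).
Proof.
wlog ij : i j / (i <= j)%N => [H|].
  by case: (leqP i j) => [/H|/ltnW/H]; rewrite // tpermC.
have [d] := ubnP (j - i); elim: d i j ij => // d IH i j ij le.
case: (posnP (j - i)) => [ji0|jgt].
  have -> : j = i by apply: val_inj => /=; lia.
  by rewrite tperm1; apply: generated_one.
have lt : (j.-1 < n)%N by move: (ltn_ord j); lia.
pose k := Ordinal lt; have kj : generated (tperm k j, set0).
  by apply: generated_adjacent; rewrite /=; lia.
case: (eqVneq i k) => [->//|ik].
(* Conjugating by the adjacent transposition of [k] and [j] reduces the distance by 1. *)
have -> : (tperm i j, set0) =
    sgn_comp (sgn_comp (tperm k j, set0) (tperm i k, set0)) (tperm k j, set0) :> sgn_perm n.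
  rewrite !sgn_comp_perm; congr (_, _).
  have <- : (tperm i k ^ tperm k j)%g = tperm i j.
    by rewrite tpermJ tpermL tpermD // -val_eqE /=; move: ik; rewrite -val_eqE /=; lia.
  by rewrite conjgE tpermV mulgA.
apply: (generated_comp _ kj); apply: (generated_comp kj).
by apply: IH => /=; move: ik; rewrite -?val_eqE /=; lia.
Qed.

Lemma generated_perm (s : 'S_n) : generated (s, set0).
Proof.
case: (prod_tpermP s) => ts -> _; elim: ts => [|t ts IH].
  by rewrite big_nil; apply: generated_one.
by rewrite big_cons -sgn_comp_perm; apply: generated_comp (generated_tperm _ _) IH.
Qed.

Lemma sgn_comp_sign_perm (E : {set 'I_n}) (s : 'S_n) :
  sgn_comp (1%g, E) (s, set0) = (s, E).
Proof. by congr (_, _); [rewrite mul1g|apply/setP => i; rewrite !inE addbF]. Qed.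

(** Conjugation by a permutation moves the set of sign changes. *)
Lemma generated_signs (E : {set 'I_n}) (s : 'S_n) :
  generated (1%g, E) -> generated (1%g, [set i | s i \in E]).
Proof.
move=> h; have -> : (1%g, [set i | s i \in E]) =
    sgn_comp (s, set0) (sgn_comp (1%g, E) ((s^-1)%g, set0)) :> sgn_perm n.
  rewrite sgn_comp_sign_perm; congr (_, _); first by rewrite mulgV.
  by apply/setP => i; rewrite !inE.
by apply: generated_comp (generated_perm _) (generated_comp h (generated_perm _)).
Qed.

Lemma sgn_comp_signs (E F : {set 'I_n}) : [disjoint E & F] ->
  sgn_comp (1%g, E) (1%g, F) = (1%g, E :|: F).
Proof.
move=> dis; congr (_, _); first by rewrite mulg1.
apply/setP => i; rewrite !inE perm1; have := disjointFr dis (x := i).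
by case: (i \in E) => // ->.
Qed.

Lemma generated_sign1 (i : 'I_n) : g <> SOeven -> generated (1%g, [set i]).
Proof.
move=> gE; have lt : (n.-1 < n)%N by case: n i => // [[]].
pose z := Ordinal lt; pose c : rat := if g is SP then 2 else 1.
have c0 : c != 0 by rewrite /c; case: g.
have Gz : generated (1%g, [set z]).
  apply: (@generated_simple (c *: eps z)) => [|v]; last exact: reflectionZ.
  apply: height1_simple.
    rewrite !mem_cat; apply/orP; right; apply/orP; right.
    rewrite /c; case: g gE => // _; apply/mapP; exists z; rewrite ?mem_enum ?scale1r //.
  rewrite heightZ height_eps /=.
  have -> : n%:R = n.-1%:R + 1 :> rat by rewrite natr1 prednK // (leq_ltn_trans _ lt).
  rewrite /c /height_shift; case: g gE => // _; lra.
have -> : [set i] = [set k | tperm i z k \in [set z]].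
  apply/setP => k; rewrite !inE; apply/eqP/eqP => [->|h]; first by rewrite tpermL.
  by apply: (@perm_inj _ (tperm i z)); rewrite h tpermL.
exact: generated_signs.
Qed.

Lemma generated_sign2 (i j : 'I_n) : i != j -> generated (1%g, [set i; j]).
Proof.
move=> ij.
have n2 : (1 < n)%N.
  by move: ij; rewrite -val_eqE /=; move: (ltn_ord i) (ltn_ord j); lia.
have l1 : (n.-1 < n)%N by lia.
have l2 : (n.-2 < n)%N by lia.
pose z := Ordinal l1; pose y := Ordinal l2.
have yz : y != z by rewrite -val_eqE /=; lia.
have Gz : generated (1%g, [set y; z]).
  (* A nonzero shift excludes type D, and single sign changes are then available. With shift 0 the
     root [eps y + eps z] has height 1, and its reflection is the double sign change up to a
     transposition. *)
  case: (eqVneq height_shift 0) => h0; last first.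
    rewrite -sgn_comp_signs.
      by apply: generated_comp; apply: generated_sign1 => gE; move: h0; rewrite /height_shift gE eqxx.
    by rewrite disjoints_subset; apply/subsetP => k; rewrite !inE => /eqP ->.
  have -> : (1%g, [set y; z]) = sgn_comp (tperm y z, [set y; z]) (tperm y z, set0) :> sgn_perm n.
    by congr (_, _); [rewrite tperm2|apply/setP => k; rewrite !inE addbF].
  apply: (generated_comp _ (generated_tperm _ _)).
  apply: (@generated_simple (eps y + eps z)) => [|v]; last exact: reflectionD.
  apply: height1_simple; first by apply: mem_rootD => /=; lia.
  rewrite heightD !height_eps h0 /=.
  have -> : n%:R = n.-2%:R + 2 :> rat by rewrite -natrD; congr _%:R; lia.
  have -> : n.-1%:R = n.-2%:R + 1 :> rat by rewrite natr1; congr _%:R; lia.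
  by ring.
pose s := (tperm i y * tperm (tperm i y j) z)%g.
have si : s i = y.
  rewrite permM tpermL tpermD //; last by rewrite eq_sym.
  by rewrite -{2}(tpermL i y) (inj_eq perm_inj) eq_sym.
have sj : s j = z by rewrite permM tpermL.
have -> : [set i; j] = [set k | s k \in [set y; z]].
  by apply/setP => k; rewrite !inE -{1}si -sj !(inj_eq perm_inj).
exact: generated_signs.
Qed.

Lemma weyl_generated w : in_weyl g w -> generated w.
Proof.
case: w => [s E] wg; rewrite -(sgn_comp_sign_perm E s).
apply: generated_comp (generated_perm s).
have {}wg : (if g is SOeven then ~~ odd #|E| else true) by case: g wg.
(* Sign changes are removed one at a time, in type D two at a time so that their number stays
   even. *)
have [d] := ubnP #|E|; elim: d E wg => // d IH E wg le.
case: (set_0Vmem E) => [->|[i iE]]; first exact: generated_one.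
have split1 : E = [set i] :|: (E :\ i).
  by apply/setP => k; rewrite !inE; case: (eqVneq k i) => // ->.
have c1 := cardsD1 i E; rewrite iE in c1.
have [ge|gne] : g = SOeven \/ g <> SOeven by case: g; [right|right|left].
  have oE : ~~ odd #|E| by move: wg; rewrite ge.
  case: (set_0Vmem (E :\ i)) => [E0|[j jE]].
    by move: oE; rewrite c1 E0 cards0.
  have c2 := cardsD1 j (E :\ i); rewrite jE in c2.
  have ij : i != j by move: jE; rewrite !inE eq_sym => /andP[].
  have split2 : E = [set i; j] :|: (E :\ i :\ j).
    apply/setP => k; rewrite !inE; case: (eqVneq k i) => [->|_] //=.
    by case: (eqVneq k j) => [->|_] //=; move: jE; rewrite !inE => /andP[].
  rewrite split2 -sgn_comp_signs; last first.
    by rewrite disjoints_subset; apply/subsetP => k; rewrite !inE => /orP[]/eqP ->;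
      rewrite eqxx // andbF.
  apply: generated_comp; first exact: generated_sign2.
  apply: IH; last by lia.
  by rewrite ge; move: oE; rewrite c1 c2 /= negbK.
rewrite split1 -sgn_comp_signs; last first.
  by rewrite disjoints_subset; apply/subsetP => k; rewrite !inE => /eqP ->; rewrite eqxx.
apply: generated_comp; first exact: generated_sign1.
by apply: IH; [case: g gne|lia].
Qed.

(** [weyl_length] is chosen by [epsilon], so a shortest word must first be shown to exist; the sign
    is then the parity of that word. *)
Lemma weyl_lengthE w : in_weyl g w ->
  (-1) ^+ weyl_length g w = (-1) ^+ sgn_odd w :> int.
Proof.
move=> /weyl_generated[s0 ws0].
have [m [[s ws sm] mmin]] : exists m, is_length g w m.
  have [m] := ubnP (size s0); elim: m s0 ws0 => // m IH s0 ws0 le.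
  case: (excluded_middle_informative (exists2 s, is_word g w s & (size s < size s0)%N)).
    by case=> s ws lt; apply: IH ws _; apply: leq_trans lt _.
  move=> H; exists (size s0); split; first by exists s0.
  by move=> s ws; rewrite leqNgt; apply/negP => lt; apply: H; exists s.
have [[s' ws' <-] _] : is_length g w (weyl_length g w).
  by apply: epsilon_spec; exists m; split => //; exists s.
by rewrite -signr_odd (word_parity ws').
Qed.

End Generation.
End WeylSign.

(** * Morris' recurrence for the Lusztig coefficients *)

Local Notation ivec n := {ffun 'I_n -> int}.
Local Notation mvec n B := {ffun 'I_n -> 'I_B}.

Definition iunit n (i : 'I_n) : ivec n := [ffun j => (j == i)%:R].
Definition idelta n : ivec n := [ffun i : 'I_n => (n - i.+1)%N%:Z].
Definition fcons n (x : int) (b : ivec n) : ivec n.+1 :=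
  [ffun i => if unlift ord0 i is Some j then b j else x].
Definition fskip n (j : 'I_n.+1) (l : ivec n.+1) : ivec n := [ffun i => l (lift j i)].
Definition fperm n (l : ivec n) (s : 'S_n) : ivec n := [ffun i => l (s i)].

Lemma fperm_tperm n (l : ivec n) i j : l i = l j -> fperm l (tperm i j) = l.
Proof. by move=> E; apply/ffunP => x; rewrite ffunE; case: tpermP => [->|->|]. Qed.

Definition itot n B (m : mvec n B) : nat := (\sum_i m i)%N.
Definition imul n B (m : mvec n B) : ivec n := [ffun i => (m i : nat)%:Z].

Lemma fcons0 n x (b : ivec n) : fcons x b ord0 = x.
Proof. by rewrite ffunE unlift_none. Qed.

Lemma fconsS n x (b : ivec n) i : fcons x b (lift ord0 i) = b i.
Proof. by rewrite ffunE liftK. Qed.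

Lemma fcons_eta n (b : ivec n.+1) : b = fcons (b ord0) (fskip ord0 b).
Proof.
apply/ffunP => i; case: (unliftP ord0 i) => [j|] ->; last by rewrite fcons0.
by rewrite fconsS ffunE.
Qed.

Lemma fcons_add n x y (b c : ivec n) : fcons x b + fcons y c = fcons (x + y) (b + c).
Proof. by apply/ffunP => i; rewrite !ffunE; case: unlift => [j|]; rewrite ?ffunE. Qed.

Lemma fcons_opp n x (b : ivec n) : - fcons x b = fcons (- x) (- b).
Proof. by apply/ffunP => i; rewrite !ffunE; case: unlift => [j|]; rewrite ?ffunE. Qed.

Lemma fcons_muln n x (b : ivec n) j : fcons x b *+ j = fcons (x *+ j) (b *+ j).
Proof.
apply/ffunP => i; rewrite ffunMnE !ffunE.
by case: unlift => [k|] //; rewrite ffunMnE.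
Qed.

Lemma fcons_sum n (I : finType) (f : I -> int) (b : I -> ivec n) :
  \sum_i fcons (f i) (b i) = fcons (\sum_i f i) (\sum_i b i).
Proof.
apply/ffunP => i; rewrite sum_ffunE !ffunE.
case: (unliftP ord0 i) => [j|] ->; last by apply: eq_bigr => k _; rewrite fcons0.
by rewrite sum_ffunE; apply: eq_bigr => k _; rewrite fconsS.
Qed.

Lemma fcons_eq0 n x (b : ivec n) : (fcons x b == 0) = (x == 0) && (b == 0).
Proof.
apply/eqP/andP => [H|[/eqP-> /eqP->]]; last first.
  by apply/ffunP => i; rewrite !ffunE; case: unlift => // j; rewrite ffunE.
split; apply/eqP; first by move/ffunP/(_ ord0): H; rewrite fcons0 ffunE.
by apply/ffunP => i; move/ffunP/(_ (lift ord0 i)): H; rewrite fconsS !ffunE.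
Qed.

Lemma iunit0 n : iunit (ord0 : 'I_n.+1) = fcons 1 0.
Proof.
by apply/ffunP => i; rewrite !ffunE; case: (unliftP ord0 i) => [j|] ->; rewrite ?ffunE.
Qed.

Lemma iunitS n (i : 'I_n) : iunit (lift ord0 i) = fcons 0 (iunit i).
Proof.
apply/ffunP => k; rewrite !ffunE; case: (unliftP ord0 k) => [j|] ->.
  by rewrite ffunE (inj_eq lift_inj).
by [].
Qed.

Lemma sum_iunit n B (m : mvec n B) : \sum_i iunit i *+ m i = imul m.
Proof.
apply/ffunP => j; rewrite sum_ffunE ffunE (bigD1 j) //= ffunMnE ffunE eqxx big1 => [|i ij].
  by rewrite addr0 -natz.
by rewrite ffunMnE ffunE eq_sym (negbTE ij) mul0rn.
Qed.

Lemma cnt_fcons n B (L : seq (nat * ivec n)) k x b :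
  cnt B [seq (y.1, fcons 0 y.2) | y <- L] k (fcons x b) = if x == 0 then cnt B L k b else 0.
Proof.
elim: L k b => [|y L IH] k b /=; first by rewrite fcons_eq0; case: (x == 0); rewrite ?andbF.
under eq_bigr => j _ do rewrite fcons_muln fcons_opp fcons_add mul0rn oppr0 addr0 IH.
by case: (x == 0) => //; rewrite big1.
Qed.

Section Roots.
Variable g : lie_type.

Definition axis_roots n : seq (ivec n) :=
  match g with
  | SOodd => [seq iunit i | i <- enum 'I_n]
  | SP => [seq iunit i *+ 2 | i <- enum 'I_n]
  | SOeven => [::]
  end.

Definition roots n : seq (ivec n) :=
  [seq iunit p.1 - iunit p.2 | p : 'I_n * 'I_n <- enum {: 'I_n * 'I_n} & (p.1 < p.2)%N] ++
  [seq iunit p.1 + iunit p.2 | p : 'I_n * 'I_n <- enum {: 'I_n * 'I_n} & (p.1 < p.2)%N] ++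
  axis_roots n.

Definition rootsL n := [seq (1%N, v) | v <- roots n].

Definition tau : int := match g with SOodd => 1 | SP => 2 | SOeven => 0 end.

(* The Weyl group acts on weights shifted by rho; writing such a weight as
   l + tau/2 with l integral, the sign changes become l_i |-> - l_i - tau. *)
Definition iact n (w : sgn_perm n) (l : ivec n) : ivec n :=
  [ffun i => if i \in w.2 then - l (w.1 i) - tau else l (w.1 i)].

Definition kostant B n k (b : ivec n) : int := cnt B (rootsL n) k b.

(* The coefficient of q^k for mu = 0, where l stands for lambda + delta. *)
Definition lieK B n k (l : ivec n) : int :=
  \sum_(w : sgn_perm n | in_weyl g w)
    (-1) ^+ sgn_odd w * kostant B k (iact w l - idelta n).

Definition iemb n (b : ivec n) : weight n := \row_i (b i)%:~R.

Lemma iemb_is_additive n : zmod_morphism (@iemb n).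
Proof. by move=> b c; apply/rowP => i; rewrite !mxE !ffunE rmorphB. Qed.

HB.instance Definition _ n :=
  GRing.isZmodMorphism.Build (ivec n) (weight n) (@iemb n) (@iemb_is_additive n).

Lemma iemb_inj n : injective (@iemb n).
Proof.
move=> b c /rowP H; apply/ffunP => i; move: (H i); rewrite !mxE; exact: intr_inj.
Qed.

Lemma iemb_unit n (i : 'I_n) : iemb (iunit i) = eps i.
Proof. by apply/rowP => j; rewrite !mxE ffunE eqxx /=; case: (j == i). Qed.

Lemma pos_roots_emb n : pos_roots g n = map (@iemb n) (roots n).
Proof.
rewrite /pos_roots /roots /axis_roots !map_cat -!map_comp; congr (_ ++ (_ ++ _)).
- by apply: eq_map => p /=; rewrite raddfB /= !iemb_unit.
- by apply: eq_map => p /=; rewrite raddfD /= !iemb_unit.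
case: g => //; rewrite -map_comp; apply: eq_map => i /=; rewrite ?raddfMn /= iemb_unit //.
by rewrite scaler_nat.
Qed.

Lemma kostant_q_emb B n k (b : ivec n) : (k < B)%N -> kostant_q g k (iemb b) = kostant B k b.
Proof.
rewrite /kostant_q /kostant /rootsL pos_roots_emb.
elim: (roots n) k b => [|v L IH] k b kB /=.
  by rewrite /qe_one -(inj_eq (@iemb_inj n)) raddf0.
rewrite /qe_div (big_ord_widen B (fun j => foldr (@qe_div n) (@qe_one n) (map (@iemb n) L) (k - j)%N (iemb b - iemb v *+ j))) //.
apply: eq_big => [j|j _]; first by rewrite mul1n ltnS.
by rewrite mul1n -raddfMn -raddfB IH // (leq_ltn_trans (leq_subr _ _)).
Qed.

Lemma sum_gt_ord n k : (\sum_(j < n) (k < j) = n - k.+1)%N.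
Proof. by elim: n => [|n IH]; rewrite ?big_ord0 // big_ord_recr /= IH; lia. Qed.

(** The roots e_i - e_j and e_i + e_j add up to 2 e_i, which gives delta after halving; the axis
    roots contribute the constant tau / 2. *)
Lemma rhoE n : rho g n = iemb (idelta n) + const_mx (tau%:~R / 2).
Proof.
rewrite /rho /pos_roots !big_cat /= !big_map !big_filter !big_enum_cond /= addrA -big_split /=.
apply/rowP => k; rewrite !mxE ffunE summxE.
have -> : \sum_(p : 'I_n * 'I_n | (p.1 < p.2)%N)
    (eps p.1 - eps p.2 + (eps p.1 + eps p.2)) 0 k = 2 * (n - k.+1)%:R :> rat.
  rewrite -sum_gt_ord natr_sum mulr_sumr.
  rewrite (eq_bigr (fun p => 2 * (k == p.1)%:R)) => [|p _]; last first.
    by rewrite !mxE !eqxx /=; ring.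
  rewrite -(pair_big_dep xpredT (fun i j : 'I_n => (i < j)%N)
             (fun i j => 2 * (k == i)%:R)) /= (bigD1 k) //=.
  rewrite [X in _ + X]big1 => [|i ik]; last first.
    by rewrite big1 // => j _; rewrite eq_sym (negbTE ik) mulr0.
  by rewrite addr0 big_mkcond; apply: eq_bigr => j _; rewrite eqxx; case: (k < j)%N; rewrite ?mulr0.
rewrite mulrDr mulrA mulVf // mul1r; congr (_ + _).
rewrite /tau; case: (g); rewrite ?big_nil ?mxE ?mulr0 ?mul0r // big_map big_enum /= summxE (bigD1 k) //=;
  rewrite big1 ?addr0 => [|i ik]; rewrite !mxE eqxx ?eqxx ?(eq_sym k) ?(negbTE ik) /= ?mulr0 ?mulr1 //.
Qed.

Lemma iact_emb n (w : sgn_perm n) (l : ivec n) :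
  weyl_act w (iemb l + const_mx (tau%:~R / 2)) = iemb (iact w l) + const_mx (tau%:~R / 2).
Proof.
apply/rowP => i; rewrite !mxE ffunE; case: (i \in w.2); rewrite ?mul1r //.
by rewrite rmorphB rmorphN /= expr1; field.
Qed.

Definition part_ivec n (la : seq nat) : ivec n := [ffun i : 'I_n => (nth 0%N la i)%:Z].

Lemma lusztig_coefE B n la k : (k < B)%N ->
  lusztig_coef g n la [::] k = lieK B k (part_ivec n la + idelta n).
Proof.
move=> kB; apply: eq_bigr => w wg; rewrite weyl_lengthE //; congr (_ * _).
rewrite -kostant_q_emb //; congr (kostant_q _ _ _).
rewrite /dot_act rhoE.
have -> : part_weight n la = iemb (part_ivec n la).
  by apply/rowP => i; rewrite !mxE ffunE pmulrn.
have -> : part_weight n [::] = 0 by apply/rowP => i; rewrite !mxE nth_nil.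
by rewrite subr0 addrA -raddfD iact_emb raddfB opprD addrACA subrr addr0.
Qed.

Lemma pairs_recl n : perm_eq
  [seq p : 'I_n.+1 * 'I_n.+1 <- enum {: 'I_n.+1 * 'I_n.+1} | (p.1 < p.2)%N]
  ([seq (ord0, lift ord0 i) | i <- enum 'I_n] ++
   [seq (lift ord0 p.1, lift ord0 p.2) |
      p : 'I_n * 'I_n <- enum {: 'I_n * 'I_n} & (p.1 < p.2)%N]).
Proof.
apply: uniq_perm.
- by apply: filter_uniq; apply: enum_uniq.
- have I1 : injective (fun i : 'I_n => (ord0 : 'I_n.+1, lift ord0 i)).
    by move=> i j /(congr1 snd) /= /lift_inj.
  have I2 : injective (fun p : 'I_n * 'I_n => (lift ord0 p.1, lift ord0 p.2)).
    move=> [i j] [i' j'] E; move: (congr1 fst E) (congr1 snd E) => /=.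
    by move=> /lift_inj -> /lift_inj ->.
  rewrite cat_uniq (map_inj_uniq I1) (map_inj_uniq I2) enum_uniq filter_uniq; last exact: enum_uniq.
  rewrite andbT.
  apply/hasPn => x /mapP[p _ ->]; by apply/mapP => -[i _ /(congr1 (val \o fst))].
move=> [i j]; rewrite mem_filter mem_enum mem_cat andbT /=.
case: (unliftP ord0 j) => [j'|] ->; last first.
  by rewrite ltn0; apply/esym/negbTE; rewrite negb_or; apply/andP; split; apply/mapP => -[p _ /(congr1 (val \o snd))].
case: (unliftP ord0 i) => [i'|] ->; last first.
  by rewrite map_f ?mem_enum.
rewrite /= /bump !leq0n ltn_add2l; apply/idP/orP => [h|].
  by right; apply/mapP; exists (i', j') => //; rewrite mem_filter h mem_enum.
case=> /mapP[p]; first by move=> _ /(congr1 (val \o fst)).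
rewrite mem_filter => /andP[+ _] E; move: (congr1 fst E) (congr1 snd E) => /=.
by move=> /lift_inj -> /lift_inj ->.
Qed.

Definition extra_root n : seq (nat * ivec n.+1) :=
  match g with
  | SOodd => [:: (1%N, fcons 1 0)] | SP => [:: (1%N, fcons 2 0)] | SOeven => [::]
  end.

Lemma roots_recl n : perm_eq (rootsL n.+1)
  ([seq (1%N, fcons 1 (- iunit i)) | i <- enum 'I_n] ++
   ([seq (1%N, fcons 1 (iunit i)) | i <- enum 'I_n] ++
   (extra_root n ++ [seq (y.1, fcons 0 y.2) | y <- rootsL n]))).
Proof.
pose f n' (v : ivec n') := (1%N, v); pose h (y : nat * ivec n) := (y.1, fcons 0 y.2).
pose prs n' := [seq p : 'I_n' * 'I_n' <- enum {: 'I_n' * 'I_n'} | (p.1 < p.2)%N].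
have E1 : perm_eq (map (@f n.+1) [seq iunit p.1 - iunit p.2 | p : 'I_n.+1 * 'I_n.+1 <- prs n.+1])
   ([seq (1%N, fcons 1 (- iunit i)) | i <- enum 'I_n] ++
    map h (map (@f n) [seq iunit p.1 - iunit p.2 | p : 'I_n * 'I_n <- prs n])).
  rewrite -!map_comp; apply: perm_trans (perm_map _ (pairs_recl n)) _.
  rewrite map_cat -!map_comp; apply/seq.permP => P; congr (count P _).
  by congr (_ ++ _); apply: eq_map => i; rewrite /f /h /= ?iunit0 !iunitS fcons_opp fcons_add ?subr0 ?sub0r.
have E2 : perm_eq (map (@f n.+1) [seq iunit p.1 + iunit p.2 | p : 'I_n.+1 * 'I_n.+1 <- prs n.+1])
   ([seq (1%N, fcons 1 (iunit i)) | i <- enum 'I_n] ++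
    map h (map (@f n) [seq iunit p.1 + iunit p.2 | p : 'I_n * 'I_n <- prs n])).
  rewrite -!map_comp; apply: perm_trans (perm_map _ (pairs_recl n)) _.
  rewrite map_cat -!map_comp; apply/seq.permP => P; congr (count P _).
  by congr (_ ++ _); apply: eq_map => i; rewrite /f /h /= ?iunit0 !iunitS fcons_add ?addr0 ?add0r.
have E3 : map (@f n.+1) (axis_roots n.+1) = extra_root n ++ map h (map (@f n) (axis_roots n)).
  rewrite /extra_root /axis_roots; case: (g) => //=; rewrite enum_ordSl /= iunit0 -!map_comp; congr (_ :: _).
  - by apply: eq_map => i; rewrite /f /h /= iunitS.
  - by rewrite /f fcons_muln mul0rn.
  - by apply: eq_map => i; rewrite /f /h /= iunitS fcons_muln mul0rn.
rewrite /rootsL /roots !map_cat -/(prs n) -/(prs n.+1) -/(f n) -/(f n.+1) E3.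
apply: perm_trans (perm_cat E1 (perm_cat E2 (perm_refl _))) _.
by apply/seq.permP => p; rewrite !count_cat -/h; lia.
Qed.

(** * Expansion of the alternating sum along the first coordinate *)

Section Recursion.
Variables (n B : nat).

(* The multiplicities of the roots e_0 + e_i, of the roots e_0 - e_i, and of the
   remaining root e_0 or 2 e_0 (absent in type D). *)
Definition triple := (mvec n B * mvec n B * 'I_B)%type.
Implicit Type z : triple.

Definition extra_ok (t : nat) := if g is SOeven then t == 0%N else true.
Definition extra_deg := if g is SP then 2 else 1%N.
(** The sum of the chosen roots has degree [cost] in q, first coordinate [deg] and other coordinates
    [shift]. The two degrees differ only through the root 2 e_0 of type C, which counts once in q
    and twice in the coordinate. *)
Definition cost z := (itot z.1.1 + itot z.1.2 + z.2)%N.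
Definition deg z := (itot z.1.1 + itot z.1.2 + extra_deg * z.2)%N.
Definition shift z : ivec n := imul z.1.1 - imul z.1.2.

Lemma kostant_recl k x (b : ivec n) : (k < B)%N ->
  kostant B k (fcons x b) =
  \sum_(z : triple | [&& extra_ok z.2, (cost z <= k)%N & (deg z)%:Z == x])
     kostant B (k - cost z) (b - shift z).
Proof.
move=> kB; rewrite /kostant (cnt_perm _ _ _ (roots_recl n)) cnt_block ?enum_uniq //.
have all_enum (m : mvec n B) :
  [forall i, (i \in enum 'I_n) || (m i == 0 :> nat)] by apply/forallP => i; rewrite mem_enum.
have S1 (m : mvec n B) :
    \sum_i fcons 1 (iunit i) *+ m i = fcons (itot m)%:Z (imul m).
  under eq_bigr => i _ do rewrite fcons_muln.
  by rewrite fcons_sum sum_iunit -natr_sum natz.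
have S2 (m : mvec n B) :
    \sum_i fcons 1 (- iunit i) *+ m i = fcons (itot m)%:Z (- imul m).
  under eq_bigr => i _ do rewrite fcons_muln mulNrn.
  by rewrite fcons_sum sumrN sum_iunit -natr_sum natz.
have X k' y c : (k' < B)%N ->
    cnt B (extra_root n ++ [seq (y.1, fcons 0 y.2) | y <- rootsL n]) k' (fcons y c) =
    \sum_(t < B | [&& extra_ok t, (t <= k')%N & (extra_deg * t)%N%:Z == y]) cnt B (rootsL n) (k' - t) c.
  move=> k'B; rewrite /extra_root /extra_ok /extra_deg; case: (g) => /=.
  - rewrite [RHS]big_mkcond /= [LHS]big_mkcond /=; apply: eq_bigr => t _; rewrite !mul1n.
    case: leqP => // _; rewrite fcons_muln fcons_opp fcons_add mul0rn oppr0 addr0 cnt_fcons.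
    by rewrite subr_eq0 eq_sym natz.
  - rewrite [RHS]big_mkcond /= [LHS]big_mkcond /=; apply: eq_bigr => t _; rewrite !mul1n.
    case: leqP => // _; rewrite fcons_muln fcons_opp fcons_add mul0rn oppr0 addr0 cnt_fcons.
    by rewrite subr_eq0 eq_sym -[2 *+ t]mulr_natr !natz -PoszM.
  - rewrite cnt_fcons; have B0 : (0 < B)%N by apply: leq_ltn_trans k'B.
    rewrite big_mkcond (bigD1 (Ordinal B0)) //= big1 ?addr0 => [|t].
      by rewrite mul1n eq_sym subn0.
    by rewrite -val_eqE /= => /negbTE ->.
pose F (z : triple) := if [&& extra_ok z.2, (cost z <= k)%N & (deg z)%:Z == x]
  then cnt B (rootsL n) (k - cost z) (b - shift z) else 0.
transitivity (\sum_z F z); last by rewrite [RHS]big_mkcond.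
transitivity (\sum_be \sum_ga \sum_t F (be, ga, t)); last first.
  by rewrite !pair_bigA; apply: eq_bigr => -[[]].
rewrite exchange_big big_mkcond /=; apply: eq_bigr => ga _; rewrite all_enum /= -/(itot ga).
have kle k1 : (k - k1 < B)%N by apply: leq_ltn_trans (leq_subr _ _) kB.
case: leqP => hga; last first.
  rewrite big1 // => be _; rewrite big1 // => t _; rewrite /F /cost /= [(_ <= k)%N]leqNgt.
  by rewrite (_ : (k < _)%N) ?andbF //; lia.
rewrite cnt_block ?enum_uniq // big_mkcond; apply: eq_bigr => be _; rewrite all_enum /= -/(itot be).
case: leqP => hbe; last first.
  rewrite big1 // => t _; rewrite /F /cost /= [(_ <= k)%N]leqNgt.
  by rewrite (_ : (k < _)%N) ?andbF //; lia.
rewrite S1 S2 !fcons_opp !fcons_add X; last by rewrite -subnDA.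
rewrite big_mkcond; apply: eq_bigr => t _; rewrite /F /cost /deg /shift /=.
have -> : ((itot be + itot ga + extra_deg * t)%N%:Z == x) =
          ((extra_deg * t)%N%:Z == x - (itot ga)%:Z - (itot be)%:Z).
  by apply/eqP/eqP; lia.
have -> : (itot be + itot ga + t <= k)%N = (t <= k - itot ga - itot be)%N by lia.
case: ifP => // _; congr (cnt _ _ _ _); first by lia.
by rewrite opprK opprB addrA.
Qed.

Lemma idelta_recl (m : nat) : idelta m.+1 = fcons m%:Z (idelta m).
Proof.
apply/ffunP => i; rewrite !ffunE; case: (unliftP ord0 i) => [j|] ->; rewrite ?ffunE /=.
  by rewrite /bump leq0n subSS.
by rewrite subn1.
Qed.

(** [shift] is subtracted outside the action and added inside it, so the two families of roots are
    exchanged at the unreflected coordinates and kept at the reflected ones. *)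
Definition tri_swap (w : sgn_perm n) (z : triple) : triple :=
  ([ffun i => if (w.1^-1)%g i \in w.2 then z.1.1 ((w.1^-1)%g i) else z.1.2 ((w.1^-1)%g i)],
   [ffun i => if (w.1^-1)%g i \in w.2 then z.1.2 ((w.1^-1)%g i) else z.1.1 ((w.1^-1)%g i)], z.2).

Lemma iact_shift w (l : ivec n) z :
  iact w l - shift z = iact w (l + shift (tri_swap w z)).
Proof.
apply/ffunP => i; rewrite !ffunE permK; case: (i \in w.2); ring.
Qed.

Lemma tri_swap_tot w z :
  (itot (tri_swap w z).1.1 + itot (tri_swap w z).1.2 = itot z.1.1 + itot z.1.2)%N.
Proof.
rewrite /itot -!big_split /= [RHS](reindex_inj (@perm_inj _ (w.1^-1)%g)) /=.
by apply: eq_bigr => i _; rewrite !ffunE; case: ifP => _ //; rewrite addnC.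
Qed.

Lemma tri_swap_inj w : injective (tri_swap w).
Proof.
move=> [[be ga] t] [[be' ga'] t'] [H1 H2 ->].
have K i : be i = be' i /\ ga i = ga' i.
  move/ffunP/(_ (w.1 i)): H1; move/ffunP/(_ (w.1 i)): H2; rewrite !ffunE permK.
  by case: (i \in w.2) => -> ->.
by congr (_, _, _); apply/ffunP => i; case: (K i).
Qed.

Lemma sum_sets_lift (P : pred {set 'I_n.+1}) (f : {set 'I_n.+1} -> int) :
  (forall E, P E -> ord0 \in E -> f E = 0) ->
  \sum_(E | P E) f E = \sum_(E : {set 'I_n} | P (lift ord0 @: E)) f (lift ord0 @: E).
Proof.
move=> f0; rewrite (bigID (fun E : {set 'I_n.+1} => ord0 \in E)) /= big1 ?add0r => [|E]; last first.
  by case/andP; apply: f0.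
rewrite (reindex_onto (fun E : {set 'I_n} => lift ord0 @: E)
                      (fun E => [set i | lift ord0 i \in E])) /=; last first.
  move=> E /andP[_ nE]; apply/setP => i; apply/imsetP/idP => [[j]|iE]; first by rewrite inE => + ->.
  case: (unliftP ord0 i) iE nE => [j|] -> iE; last by rewrite iE.
  by exists j; rewrite ?inE.
apply: eq_bigl => E; rewrite -andbA andb_idr // => _; apply/andP; split.
  by apply/imsetP => -[j _]; apply/eqP; rewrite neq_lift.
by apply/eqP/setP => i; rewrite inE mem_imset //; apply: lift_inj.
Qed.

Lemma iact_lift (j : 'I_n.+1) (s : 'S_n) (E : {set 'I_n}) (l : ivec n.+1) :
  iact (lift_perm ord0 j s, lift ord0 @: E) l = fcons (l j) (iact (s, E) (fskip j l)).
Proof.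
apply/ffunP => i; rewrite !ffunE /=; case: (unliftP ord0 i) => [k|] ->.
  by rewrite mem_imset ?lift_perm_lift ?ffunE //; apply: lift_inj.
rewrite lift_perm_id; case: imsetP => // -[k _] /eqP.
by rewrite (negbTE (neq_lift _ _)).
Qed.

(* Expansion along the first coordinate: only the roots involving it see it,
   and it must be filled by an unreflected entry of l. *)
Lemma lieK_recl k (l : ivec n.+1) : (k < B)%N -> (0 < n)%N -> (forall i, 0 <= l i) ->
  lieK B k l = \sum_(j < n.+1) (-1) ^+ j *
    \sum_(z : triple | [&& extra_ok z.2, (cost z <= k)%N & (deg z)%:Z == l j - n%:Z])
      lieK B (k - cost z) (fskip j l + shift z).
Proof.
move=> kB n0 l0; rewrite /lieK.
transitivity (\sum_(s : 'S_n.+1) \sum_(E : {set 'I_n.+1} | in_weyl g (s, E))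
   (-1) ^+ sgn_odd (s, E) * kostant B k (iact (s, E) l - idelta n.+1)).
  rewrite (pair_big_dep xpredT (fun s E => in_weyl g (s, E)) (fun s E => (-1) ^+ sgn_odd (s, E) *
    kostant B k (iact (s, E) l - idelta n.+1))) /=.
  by apply: eq_big => [[s E]|[s E]].
rewrite (sum_lift_perm ord0); apply: eq_bigr => j _; rewrite mulr_sumr.
have cond (E : {set 'I_n}) (s : 'S_n) :
    in_weyl g (lift_perm ord0 j s, lift ord0 @: E) = in_weyl g (s, E).
  by case: (g) => //=; rewrite card_imset //; apply: lift_inj.
have inner (w : sgn_perm n) x (l' : ivec n) :
    \sum_(z : triple | [&& extra_ok z.2, (cost z <= k)%N & (deg z)%:Z == x])
       kostant B (k - cost z) (iact w l' - idelta n - shift z) =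
    \sum_(z : triple | [&& extra_ok z.2, (cost z <= k)%N & (deg z)%:Z == x])
       kostant B (k - cost z) (iact w (l' + shift z) - idelta n).
  rewrite [RHS](reindex_inj (@tri_swap_inj w)); apply: eq_big => z.
    by rewrite /cost /deg tri_swap_tot.
  by move=> _; rewrite addrAC iact_shift /cost tri_swap_tot.
transitivity (\sum_(s : 'S_n) \sum_(E : {set 'I_n} | in_weyl g (s, E))
   (-1) ^+ j * ((-1) ^+ sgn_odd (s, E) *
   \sum_(z : triple | [&& extra_ok z.2, (cost z <= k)%N & (deg z)%:Z == l j - n%:Z])
       kostant B (k - cost z) (iact (s, E) (fskip j l + shift z) - idelta n))).
  apply: eq_bigr => s _; rewrite sum_sets_lift; last first.
    (* A reflected first coordinate is [- l j - tau - n], negative even for [tau = 0] because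
       [0 < n], whereas [deg] is a natural number. *)
    move=> E _ E0; rewrite idelta_recl [iact _ _]fcons_eta fcons_opp fcons_add kostant_recl //.
    rewrite big_pred0 ?mulr0 // => z; apply/negP => /and3P[_ _ /eqP].
    rewrite ffunE E0 lift_perm_id; move: (l0 j); rewrite /tau; case: (g); lia.
  apply: eq_big => [E|E _]; first exact: cond.
  rewrite iact_lift idelta_recl fcons_opp fcons_add kostant_recl // inner mulrA; congr (_ * _).
  rewrite -[(-1) ^+ j]signr_odd -signr_addb; congr (_ ^+ _); rewrite /sgn_odd /=.
  rewrite odd_lift_perm card_imset; last exact: lift_inj.
  by rewrite /= addbA.
rewrite (pair_big_dep xpredT (fun s E => in_weyl g (s, E)) (fun s E => (-1) ^+ j * ((-1) ^+ sgn_odd (s, E) *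
   \sum_(z : triple | [&& extra_ok z.2, (cost z <= k)%N & (deg z)%:Z == l j - n%:Z])
       kostant B (k - cost z) (iact (s, E) (fskip j l + shift z) - idelta n)))) /=.
rewrite -mulr_sumr -mulr_sumr [in RHS]exchange_big /=; congr (_ * _).
by apply: eq_big => [[s E]|[s E] _] //=; rewrite mulr_sumr.
Qed.
End Recursion.


End Roots.

(** * Cancellations in Morris' recurrence *)

Lemma sum_inj_ge n (f : 'I_n -> nat) : injective f -> ('C(n, 2) <= \sum_i f i)%N.
Proof.
elim: n f => [|n IH] f fi; first by rewrite big_ord0.
have [i fn] : exists i, (n <= f i)%N.
  case: (pickP (fun i => n <= f i)%N) => [i h|H]; first by exists i.
  have lt i : (f i < n)%N by rewrite ltnNge H.
  have /leq_card : injective (fun i => Ordinal (lt i)) by move=> i j /(congr1 val) /fi.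
  by rewrite !card_ord ltnn.
rewrite (bigD1_ord i) //= binS bin1 addnC leq_add //.
by apply: IH => j k /fi /lift_inj.
Qed.

(** Distinct positive integers add up to at least 1 + ... + n. *)
Lemma not_inj_small n (f : 'I_n -> nat) :
  (forall i, 0 < f i)%N -> (\sum_i f i < 'C(n.+1, 2))%N ->
  exists i j, i != j /\ f i = f j.
Proof.
move=> f0 small; case: (injectiveP (fun i => (f i).-1)) => [fi|].
  have := sum_inj_ge fi; have : (\sum_i f i = \sum_i (f i).-1 + n)%N.
    rewrite -[X in (_ + X)%N]card_ord -sum1_card -big_split /=.
    by apply: eq_bigr => i _; rewrite addn1 prednK.
  by move: small; rewrite binS bin1; lia.
move/injectiveP/injectivePn => [i [j ij E]]; exists i, j; split => //.
by rewrite -(prednK (f0 i)) -(prednK (f0 j)) E.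
Qed.

(** * Antisymmetry under the Weyl group *)

Section Antisymmetry.
Variables (g : lie_type) (n B : nat).
Implicit Types (l : ivec n) (w : sgn_perm n).

Lemma iact_comp w w0 l : iact g w (iact g w0 l) = iact g (sgn_comp w w0) l.
Proof.
apply/ffunP => i; rewrite !ffunE inE permM.
by case: (i \in w.2); case: (w.1 i \in w0.2); rewrite /=; ring.
Qed.

Lemma sgn_comp_inj w0 : injective (fun w => sgn_comp w w0).
Proof.
move=> [s E] [s' E'] [/mulIg <- /setP H]; congr (_, _); apply/setP => i.
by move: (H i); rewrite !inE => /addIb.
Qed.

Lemma in_weyl_comp w w0 : in_weyl g w0 -> in_weyl g (sgn_comp w w0) = in_weyl g w.
Proof.
case: (g) => //=.
have -> : [set i | (i \in w.2) (+) (w.1 i \in w0.2)] =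
          [set i | (i \in w.2) (+) (i \in [set i | w.1 i \in w0.2])].
  by apply/setP => i; rewrite !inE.
by rewrite odd_card_addb card_preim_perm => /negbTE ->; rewrite addbF.
Qed.

Lemma lieK_act w0 k l : in_weyl g w0 ->
  lieK g B k (iact g w0 l) = (-1) ^+ sgn_odd w0 * lieK g B k l.
Proof.
move=> w0g; rewrite /lieK mulr_sumr [RHS](reindex_inj (@sgn_comp_inj w0)) /=.
apply: eq_big => w; first by rewrite in_weyl_comp.
by move=> _; rewrite iact_comp sgn_odd_comp mulrA -signr_addb addbC addbK.
Qed.

Lemma lieK_tperm k l i j : i != j ->
  lieK g B k (fperm l (tperm i j)) = - lieK g B k l.
Proof.
move=> ij; have -> : fperm l (tperm i j) = iact g (tperm i j, set0) l.
  by apply/ffunP => k'; rewrite !ffunE inE.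
rewrite lieK_act; last by case: (g); rewrite //= cards0.
by rewrite odd_tperm_set0 // mulN1r.
Qed.

Lemma lieK_eq0 k l i j : i != j -> l i = l j -> lieK g B k l = 0.
Proof.
move=> ij E; have := lieK_tperm k l ij.
rewrite fperm_tperm //.
by lia.
Qed.

Lemma lieK_reflect k l l' i : g <> SOeven ->
  l' i = - l i - tau g -> (forall j, j != i -> l' j = l j) ->
  lieK g B k l' = - lieK g B k l.
Proof.
move=> gE E E'; have -> : l' = iact g (1%g, [set i]) l.
  apply/ffunP => j; rewrite ffunE inE perm1.
  by case: eqVneq => [->|/E'].
rewrite lieK_act; last by case: (g) gE.
by rewrite /sgn_odd /= odd_perm1 cards1 mulN1r.
Qed.

(** As [tau] is 0, the reflection in e_i + e_j fixes [l]; it is odd, and it lies in the Weyl group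
    because it changes two signs. *)
Lemma lieK_opp_eq0 k l i j : g = SOeven -> i != j -> l i = - l j -> lieK g B k l = 0.
Proof.
move=> gE ij E; have := @lieK_act (tperm i j, [set i; j]) k l.
have -> : iact g (tperm i j, [set i; j]) l = l.
  apply/ffunP => x; rewrite ffunE !inE /tau gE /= !subr0.
  case: tpermP => [->|->|/eqP/negbTE-> /eqP/negbTE-> //]; rewrite eqxx ?orbT ?E ?opprK //.
rewrite gE /= cards2 ij => /(_ isT); rewrite /sgn_odd /= odd_tperm ij cards2 ij /= -gE.
by lia.
Qed.

Lemma lieK_abs_eq0 k l i j : g = SOeven -> i != j -> `|l i|%N = `|l j|%N -> lieK g B k l = 0.
Proof.
move=> gE ij E; have [E'|E'] : l i = l j \/ l i = - l j by lia.
  exact: lieK_eq0 ij E'.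
exact: lieK_opp_eq0 E'.
Qed.

End Antisymmetry.

(** * Reduction of the kernel when the last coordinate is zero *)

Section Kernel.
Variables (g : lie_type) (m B : nat).
Local Notation n := m.+1.
Local Notation triple := (triple m.+1 B).
Local Notation last := (ord_max : 'I_m.+1).
Implicit Types (z : triple) (l : ivec m.+1).

Lemma triple_ind (P : triple -> Prop) :
  (forall (be ga : mvec n B) (t : 'I_B), P (be, ga, t)) -> forall z, P z.
Proof. by move=> H [[be ga] t]. Qed.

Definition ord_upd (t : 'I_B) (v : nat) : 'I_B := insubd t v.

Lemma ord_updE t v : ord_upd t v = (if (v < B)%N then v else t) :> nat.
Proof. by rewrite val_insubd. Qed.

Definition set_at (f : mvec n B) i (v : nat) : mvec n B :=
  [ffun j => if j == i then insubd (f j) v else f j].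

Lemma set_atE f i v : (v < B)%N ->
  forall j, set_at f i v j = (if j == i then v else f j) :> nat.
Proof. by move=> vB j; rewrite ffunE; case: eqP => // _; rewrite val_insubd vB. Qed.

Lemma itot_set_at f i v : (v < B)%N -> (itot (set_at f i v) + f i = itot f + v)%N.
Proof.
move=> vB; rewrite /itot (bigD1 i) //= [in RHS](bigD1 i) //= set_atE // eqxx.
under eq_bigr => j ji do rewrite set_atE // (negbTE ji).
by lia.
Qed.

Lemma leq_itot (f : mvec n B) i : (f i <= itot f)%N.
Proof. by rewrite /itot (bigD1 i) //= leq_addr. Qed.

Lemma leq_itot2 (f : mvec n B) i j : i != j -> (f i + f j <= itot f)%N.
Proof.
by move=> ij; rewrite /itot (bigD1 i) //= (bigD1 j) 1?eq_sym //= addnA leq_addr.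
Qed.

Lemma shiftE l z j : (l + shift z) j = l j + ((z.1.1 j : nat)%:Z - (z.1.2 j : nat)%:Z).
Proof. by rewrite !ffunE. Qed.

Local Notation kernel k x l :=
  (\sum_(z : triple | [&& extra_ok g z.2, (cost z <= k)%N & (deg g z)%:Z == x])
     lieK g B (k - cost z) (l + shift z)).

Definition below (J : {pred 'I_n}) l z := [forall i in J, (z.1.2 i : nat)%:Z < l i].

(* Exchanging the coordinates i and last of l + shift z reverses the sign and
   cancels the terms with l i <= z.1.2 i. *)
Lemma kernel_cut k x l : (k < B)%N -> (forall i, 0 <= l i) -> l last = 0 ->
  kernel k x l =
  \sum_(z : triple | [&& extra_ok g z.2, (cost z <= k)%N & (deg g z)%:Z == x] &&
                     below (predC1 last) l z)
     lieK g B (k - cost z) (l + shift z).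
Proof.
move=> kB l0 ll.
(* The constraints are imposed one coordinate at a time. The involution for [i] alters the second
   vector only at [i] and [last], and [last] stays outside the list, so the constraints already
   imposed persist. *)
suff H (J : seq 'I_n) : last \notin J ->
  kernel k x l =
  \sum_(z : triple | [&& extra_ok g z.2, (cost z <= k)%N & (deg g z)%:Z == x] &&
                     below (mem J) l z)
     lieK g B (k - cost z) (l + shift z).
  rewrite (H (enum (predC1 last))) ?mem_enum ?inE ?eqxx //.
  by apply: eq_bigl => z; congr (_ && _); apply: eq_forallb => i; rewrite /= mem_enum.
elim: J => [_|i J IH].
  by apply: eq_bigl => z; rewrite (_ : below _ _ _) ?andbT //; apply/forallP.
rewrite inE negb_or eq_sym => /andP[il lJ]; rewrite IH //.
(* As [l last] is 0, exchanging the two coordinates of [l + shift z] amounts to swapping two entries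
   of the first vector and carrying the amount [l i] between two entries of the second, with
   unchanged totals. *)
pose be' (be : mvec n B) := [ffun j => be (tperm i last j)].
pose ga' (ga : mvec n B) :=
   set_at (set_at ga i (`|l i|%N + ga last)) last (ga i - `|l i|)%N.
pose h (z : triple) : triple := (be' z.1.1, ga' z.1.2, z.2).
rewrite (bigID (fun z : triple => (z.1.2 i : nat)%:Z < l i)) /= [X in _ + X](sum_involution (h := h)) ?addr0.
  apply: eq_bigl => z; rewrite -andbA; congr (_ && _).
  apply/andP/forallP => [[/forallP bJ bi] j|bJ].
    by rewrite inE; apply/implyP => /orP[/eqP -> //|jJ]; move/implyP: (bJ j); apply.
  split; last by move/implyP: (bJ i); apply; rewrite inE eqxx.
  by apply/forallP => j; apply/implyP => jJ; move/implyP: (bJ j); apply; rewrite inE jJ orbT.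
have tbe be : itot (be' be) = itot be.
  rewrite /itot [RHS](reindex_inj (@perm_inj _ (tperm i last))) /=.
  by apply: eq_bigr => j _; rewrite ffunE.
have li : l i = `|l i|%N by have := l0 i; case: (l i).
move: li; set L := `|l i|%N => li.
have gaP (ga : mvec n B) : (L + itot ga < B + ga i)%N -> (L <= ga i)%N ->
   (forall j, ga' ga j = (if j == last then ga i - L else
     if j == i then L + ga last else ga j)%N :> nat) /\ itot (ga' ga) = itot ga.
  move=> gB Lga; have g2 := leq_itot2 ga il.
  have v1 : (L + ga last < B)%N by lia.
  have v2 : (ga i - L < B)%N by have := ltn_ord (ga i); lia.
  split=> [j|]; first by rewrite /ga' set_atE // set_atE.
  have := itot_set_at (set_at ga i (L + ga last)) last v2.
  have := itot_set_at ga i v1.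
  by rewrite set_atE // eq_sym (negbTE il) /= -/(ga' ga); lia.
have key (be ga : mvec n B) (t : 'I_B) : (cost (be, ga, t) <= k)%N -> (L <= ga i)%N ->
    (forall j, ga' ga j = (if j == last then ga i - L else
       if j == i then L + ga last else ga j)%N :> nat) /\ itot (ga' ga) = itot ga.
  by rewrite /cost /= => ck Lga; apply: gaP => //; lia.
elim/triple_ind=> be ga t /andP[/andP[/and3P[/= zo zk zx] /forallP bJ]]; rewrite -leNgt li lez_nat => Lga.
have [gaE tga] := key be ga t zk Lga.
have cz : cost (h (be, ga, t)) = cost (be, ga, t) by rewrite /cost /= tbe tga.
split.
- rewrite cz /deg /= tbe tga zo zk /= -/(deg g (be, ga, t)) zx /= gaE eqxx (negbTE il).
  rewrite -leNgt lez_nat leq_addr andbT.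
  apply/forallP => j; apply/implyP => jJ; rewrite /= gaE.
  have jl : j != last by apply: contraNneq lJ => <-.
  rewrite (negbTE jl); case: eqVneq => [ji|_]; last by move/implyP: (bJ j); apply.
  by move/implyP: (bJ j) => /(_ jJ) /=; rewrite ji li ltz_nat ltnNge Lga.
- have zk' : (cost (be' be, ga' ga, t) <= k)%N by move: zk; rewrite -cz.
  have L' : (L <= ga' ga i)%N by rewrite gaE (negbTE il) eqxx leq_addr.
  have [gaE' _] := key _ _ _ zk' L'.
  rewrite /h /=; congr (_, _, _); apply/ffunP => j; first by rewrite !ffunE tpermK.
  apply: val_inj; rewrite /= gaE' !gaE !eqxx (negbTE il).
  case: (eqVneq j last) => [->|jl]; first by lia.
  by case: (eqVneq j i) => [->|ji] //; lia.
- rewrite cz -(lieK_tperm _ _ _ _ il); congr (lieK _ _ _ _); apply/ffunP => j.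
  rewrite shiftE [fperm _ _ j]ffunE shiftE /= gaE ffunE; case: tpermP => [->|->|/eqP/negbTE ji /eqP/negbTE jl].
  + by rewrite (negbTE il) eqxx ll li; lia.
  + by rewrite eqxx ll li; lia.
  + by rewrite jl ji.
Qed.
(* In the stable range the roots at the last coordinate and the third entry of a
   triple reduce to a single multiplicity, of these cost and degree. *)
Definition stab_coef := if g is SP then 1%N else 2.
Definition scost z := (itot z.1.1 + itot z.1.2 + stab_coef * z.2)%N.
Definition sdeg z := (itot z.1.1 + itot z.1.2 + 2 * z.2)%N.

Local Notation stable_kernel k r l :=
  (\sum_(z : triple | [&& (scost z <= k)%N, sdeg z == r, z.1.2 last == 0%N :> nat &
                     below (predC1 last) l z])
     lieK g B (k - scost z) (l + shift z)).

Lemma below_set_at l be be' ga t t' v : below (predC1 last) l (be', set_at ga last v, t') =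
  below (predC1 last) l (be, ga, t).
Proof.
apply: eq_forallb => i; rewrite !inE /=; case: (eqVneq i last) => //= il.
by rewrite ffunE (negbTE il).
Qed.

(* Reflecting the last coordinate of l + shift z exchanges z.1.1 last and
   z.1.2 last - 1. *)
Lemma kernel_stableC k r l : g = SP -> (k < B)%N -> (forall i, 0 <= l i) -> l last = 0 ->
  kernel k r%:Z l = stable_kernel k r l.
Proof.
move=> gE kB l0 ll; rewrite kernel_cut //.
have cE z : scost z = cost z by rewrite /scost /stab_coef gE mul1n.
have dE z : deg g z = sdeg z by rewrite /deg /extra_deg gE.
have oE t : extra_ok g t by rewrite /extra_ok gE.
pose h (z : triple) : triple := (set_at z.1.1 last (z.1.2 last - 1)%N, set_at z.1.2 last (z.1.1 last).+1, z.2).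
rewrite (bigID (fun z : triple => z.1.2 last == 0%N :> nat)) /= [X in _ + X](sum_involution (h := h)) ?addr0.
  apply: eq_big => [z|z _]; last by rewrite cE.
  by rewrite oE cE dE eqz_nat /=; case: (_ <= k)%N; case: (_ == r); rewrite //= andbC.
have key (be ga : mvec n B) (t : 'I_B) : (cost (be, ga, t) <= k)%N ->
    (0 < ga last)%N ->
    [/\ forall j, set_at be last (ga last - 1)%N j = (if j == last then ga last - 1 else be j)%N :> nat,
        forall j, set_at ga last (be last).+1 j = (if j == last then (be last).+1 else ga j)%N :> nat &
        (itot (set_at be last (ga last - 1)) + itot (set_at ga last (be last).+1) =
          itot be + itot ga)%N].
  rewrite /cost /= => ck g0; have v1 : (ga last - 1 < B)%N by have := ltn_ord (ga last); lia.
  have v2 : ((be last).+1 < B)%N by have := leq_itot be last; have := leq_itot ga last; lia.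
  split=> [j|j|]; rewrite ?set_atE //.
  by have := itot_set_at be last v1; have := itot_set_at ga last v2; lia.
elim/triple_ind=> be ga t /andP[/andP[/and3P[/= zo zk zx] bJ]]; rewrite -lt0n => g0.
have [E1 E2 E3] := key be ga t zk g0.
have cz : cost (h (be, ga, t)) = cost (be, ga, t) by rewrite /cost /= E3.
split.
- rewrite cz /deg /= E3 zo zk /= -/(deg g (be, ga, t)) zx /= E2 eqxx andbT.
  by rewrite (below_set_at _ be _ _ t).
- have zk' : (cost (h (be, ga, t)) <= k)%N by rewrite cz.
  have [||F1 F2 _] := key (h (be, ga, t)).1.1 (h (be, ga, t)).1.2 t => //.
    by rewrite /= E2 eqxx.
  rewrite /h /=; congr (_, _, _); apply/ffunP => j; apply: val_inj; rewrite /= ?F1 ?F2 /= ?E1 ?E2 eqxx.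
    by case: (eqVneq j last) => [->|//]; lia.
  by case: (eqVneq j last) => [->|//]; lia.
- rewrite cz; apply: (@lieK_reflect _ _ _ _ _ _ last); first by rewrite gE.
    by rewrite !shiftE /= E1 E2 eqxx ll /tau gE; lia.
  by move=> j jl; rewrite !shiftE /= E1 E2 (negbTE jl).
Qed.

(* The reflection is now l_last |-> - l_last - 1; the involution absorbs the unit
   in the parity of z.2, and only even z.2 survive. *)
Lemma kernel_stableB k r l : g = SOodd -> (k < B)%N -> (forall i, 0 <= l i) -> l last = 0 ->
  kernel k r%:Z l = stable_kernel k r l.
Proof.
move=> gE kB l0 ll; rewrite kernel_cut //.
have dE z : deg g z = cost z by rewrite /deg /extra_deg gE mul1n.
have oE t : extra_ok g t by rewrite /extra_ok gE.
pose h (z : triple) : triple :=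
  if odd z.2 then (set_at z.1.1 last (z.1.2 last), set_at z.1.2 last (z.1.1 last).+1, ord_upd z.2 (z.2.-1))
  else (set_at z.1.1 last (z.1.2 last - 1)%N, set_at z.1.2 last (z.1.1 last), ord_upd z.2 (z.2.+1)).
rewrite (bigID (fun z : triple => ~~ odd z.2 && (z.1.2 last == 0%N :> nat))) /=.
rewrite [X in _ + X](sum_involution (h := h)) ?addr0.
  (* Doubling the third entry identifies the third entries of the stable kernel with the surviving
     even multiplicities of e_0. Values whose double exceeds the range are excluded on both
     sides. *)
  pose d (z : triple) : triple := (z.1, ord_upd z.2 (2 * z.2)%N).
  pose d' (z : triple) : triple := (z.1, ord_upd z.2 (z.2./2)).
  have halfB (t : 'I_B) : (t./2 < B)%N by have := ltn_ord t; lia.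
  rewrite (reindex_onto d d') /=; last first.
    case=> [[be ga] t] /andP[_ /andP[/= et _]]; congr (_, _); apply: val_inj.
    rewrite /= !ord_updE halfB /=.
    have -> : (2 * t./2 = t)%N by have := odd_double_half t; rewrite (negbTE et); lia.
    by rewrite ltn_ord.
  have C (be ga : mvec n B) (t : 'I_B) : (2 * t < B)%N -> scost (be, ga, t) = cost (d (be, ga, t)).
    by move=> tB; rewrite /scost /cost /= /stab_coef gE ord_updE tB.
  apply: eq_big => [[[be ga] t]|[[be ga] t]]; rewrite oE dE eqz_nat /=.
    case: (ltnP (2 * t) B) => tB; last first.
      transitivity false.
        apply/negP => /andP[/andP[_ _] /eqP/(congr1 (fun z : triple => z.2 : nat))] /=.
        by rewrite !ord_updE [(2 * t < B)%N]ltnNge tB /= halfB; lia.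
      apply/esym/negP => /and3P[+ _ _]; rewrite /scost /= /stab_coef gE; lia.
    have dd : d' (d (be, ga, t)) == (be, ga, t).
      by apply/eqP; congr (_, _); apply: val_inj; rewrite /= !ord_updE tB /= mul2n doubleK ltn_ord.
    rewrite dd andbT -C // ord_updE tB /=.
    have -> : sdeg (be, ga, t) = scost (be, ga, t) by rewrite /scost /stab_coef gE.
    by rewrite mul2n odd_double /= andbAC -!andbA.
  case/andP=> /andP[_ _] /eqP dd.
  have tB : (2 * t < B)%N.
    rewrite ltnNge; apply/negP => tB; move: (congr1 (fun z : triple => z.2 : nat) dd) => /=.
    by rewrite !ord_updE [(2 * t < B)%N]ltnNge tB /= halfB; have := ltn_ord t; lia.
  by rewrite C.
have key (be ga : mvec n B) (t : 'I_B) (vb vg : nat) : (cost (be, ga, t) <= k)%N ->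
    (vb + vg <= be last + ga last + t)%N ->
    [/\ forall j, set_at be last vb j = (if j == last then vb else be j)%N :> nat,
        forall j, set_at ga last vg j = (if j == last then vg else ga j)%N :> nat &
        (itot (set_at be last vb) + itot (set_at ga last vg) + (be last + ga last) =
          itot be + itot ga + (vb + vg))%N].
  rewrite /cost /= => ck g0.
  have h1 := leq_itot be last; have h2 := leq_itot ga last.
  have v1 : (vb < B)%N by lia.
  have v2 : (vg < B)%N by lia.
  split=> [j|j|]; rewrite ?set_atE //.
  by have := itot_set_at be last v1; have := itot_set_at ga last v2; lia.
have costB z : (cost z <= k)%N -> (z.1.1 last + z.1.2 last + z.2 < B)%N.
  by case: z => [[be ga] t]; rewrite /cost /=; have := leq_itot be last; have := leq_itot ga last; lia.
elim/triple_ind=> be ga t /andP[/andP[/and3P[/= zo zk zx] bJ]] bad.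
have tB := costB _ zk; rewrite /= in tB.
case: (boolP (odd t)) bad => /= ot bad.
  have t0 : (0 < t)%N by case: (nat_of_ord t) ot.
  have [|E1 E2 E3] := key be ga t (ga last) (be last).+1 zk; first by lia.
  have hE : h (be, ga, t) = (set_at be last (ga last), set_at ga last (be last).+1, ord_upd t t.-1).
    by rewrite /h /= ot.
  have tE : ord_upd t t.-1 = t.-1 :> nat by rewrite ord_updE; case: ifP => //; lia.
  have et : odd t.-1 = false by move: ot; rewrite -{1}(prednK t0) /= => /negbTE.
  have cz : cost (h (be, ga, t)) = cost (be, ga, t) by rewrite hE /cost /= tE; lia.
  split.
  + rewrite cz zk dE cz -dE zx /extra_ok gE /= hE (below_set_at _ be _ _ t) bJ /= E2 eqxx tE et.
    by [].
  + have zk' : (cost (h (be, ga, t)) <= k)%N by rewrite cz.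
    rewrite hE in zk' *; have := key _ _ _ ((be last).+1 - 1)%N (ga last) zk'.
    rewrite E1 E2 eqxx => -[|F1 F2 _]; first by lia.
    rewrite /h /= tE et /= E1 E2 eqxx; congr (_, _, _); [apply/ffunP => j|apply/ffunP => j|];
      apply: val_inj; rewrite /= ?F1 ?F2 ?E1 ?E2.
    * by case: (eqVneq j last) => [->|//]; lia.
    * by case: (eqVneq j last) => [->|//]; lia.
    * by rewrite ord_updE tE prednK // ltn_ord.
  + rewrite cz hE; apply: (@lieK_reflect _ _ _ _ _ _ last); first by rewrite gE.
      by rewrite !shiftE /= E1 E2 eqxx ll /tau gE; lia.
    by move=> j jl; rewrite !shiftE /= E1 E2 (negbTE jl).
rewrite -lt0n in bad.
have [|E1 E2 E3] := key be ga t (ga last - 1)%N (be last) zk; first by lia.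
have hE : h (be, ga, t) = (set_at be last (ga last - 1), set_at ga last (be last), ord_upd t t.+1).
  by rewrite /h /= (negbTE ot).
have tE : ord_upd t t.+1 = t.+1 :> nat by rewrite ord_updE; case: ifP => //; lia.
have cz : cost (h (be, ga, t)) = cost (be, ga, t) by rewrite hE /cost /= tE; lia.
split.
+ rewrite cz zk dE cz -dE zx /extra_ok gE /= hE (below_set_at _ be _ _ t) bJ /= E2 eqxx tE /=.
  by rewrite ot.
+ have zk' : (cost (h (be, ga, t)) <= k)%N by rewrite cz.
  rewrite hE in zk' *; have := key _ _ _ (be last) (ga last - 1).+1 zk'.
  rewrite E1 E2 eqxx => -[|F1 F2 _]; first by lia.
  rewrite /h /= tE /= ot /= E1 E2 eqxx; congr (_, _, _); [apply/ffunP => j|apply/ffunP => j|];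
    apply: val_inj; rewrite /= ?F1 ?F2 ?E1 ?E2.
  * by case: (eqVneq j last) => [->|//]; lia.
  * by case: (eqVneq j last) => [->|//]; lia.
  * by rewrite ord_updE tE /= ltn_ord.
+ rewrite cz hE; apply: (@lieK_reflect _ _ _ _ _ _ last); first by rewrite gE.
    by rewrite !shiftE /= E1 E2 eqxx ll /tau gE; lia.
  by move=> j jl; rewrite !shiftE /= E1 E2 (negbTE jl).
Qed.

(** The condition [below] and the unequal last entries make all coordinates nonzero, and their
    absolute values are too small to be distinct. *)
Lemma lieK_small_eq0 k l z : g = SOeven -> (forall i, 0 <= l i) -> l last = 0 ->
  (\sum_i `|l i|%N + (itot z.1.1 + itot z.1.2) < 'C(n.+1, 2))%N ->
  below (predC1 last) l z -> z.1.1 last != z.1.2 last :> nat ->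
  lieK g B k (l + shift z) = 0.
Proof.
move=> gE l0 ll small /forallP bl ne.
have [||i [j [ij E]]] := @not_inj_small n (fun i => `|((l + shift z)%R i)|%N).
- move=> i; rewrite shiftE; case: (eqVneq i last) => [->|il]; first by rewrite ll; lia.
  by move/implyP: (bl i) => /(_ il) h; lia.
- apply: leq_ltn_trans small; rewrite /itot -!big_split /=; apply: leq_sum => i _.
  by rewrite shiftE; lia.
by apply: lieK_abs_eq0 E.
Qed.

(** Type D has no reflection of a single coordinate. Instead the size bound kills every term in
    which e_0 + e_last and e_0 - e_last have different multiplicities, and the common multiplicity
    becomes the third entry of the stable triple. *)
Lemma kernel_stableD k r l : g = SOeven -> (k < B)%N -> (forall i, 0 <= l i) -> l last = 0 ->
  (\sum_i `|l i|%N + r < 'C(n.+1, 2))%N ->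
  kernel k r%:Z l = stable_kernel k r l.
Proof.
move=> gE kB l0 ll small; rewrite kernel_cut //.
have dE z : deg g z = cost z by rewrite /deg /extra_deg gE mul1n.
have oE t : extra_ok g t = (t == 0%N) by rewrite /extra_ok gE.
have sE z : scost z = sdeg z by rewrite /scost /stab_coef gE.
have B0 : (0 < B)%N by apply: leq_ltn_trans kB.
pose d (z : triple) : triple := (set_at z.1.1 last z.2, set_at z.1.2 last z.2, ord_upd z.2 0).
pose d' (z : triple) : triple := (set_at z.1.1 last 0, set_at z.1.2 last 0, z.1.2 last).
rewrite (bigID (fun z : triple => z.1.1 last == z.1.2 last :> nat)) /= [X in _ + X]big1 ?addr0; last first.
  move=> z /andP[/andP[/and3P[zo zk zd] bl] ne]; apply: lieK_small_eq0 ne => //.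
  apply: leq_ltn_trans small; rewrite leq_add2l; move: zd; rewrite dE eqz_nat => /eqP <-.
  exact: leq_addr.
rewrite [RHS](bigID (fun z : triple => z.1.1 last == 0%N :> nat)) /= [X in _ + X]big1 ?addr0; last first.
  move=> z /andP[/and4P[zk zd gl bl] ne]; apply: lieK_small_eq0 bl _ => //; last by rewrite (eqP gl).
  apply: leq_ltn_trans small; rewrite leq_add2l; move: zd => /eqP <-.
  exact: leq_addr.
rewrite (reindex_onto d d') /=; last first.
  elim/triple_ind=> be ga t /andP[/andP[/and3P[/= zo _ _] _] /eqP bg]; rewrite oE in zo.
  congr (_, _, _); last by apply: val_inj; rewrite /= ord_updE B0 (eqP zo).
    by apply/ffunP => j; apply: val_inj; rewrite /= !set_atE //; case: eqVneq => [->|].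
  by apply/ffunP => j; apply: val_inj; rewrite /= !set_atE //; case: eqVneq => [->|].
have C : forall z, z.1.1 last = 0%N :> nat -> z.1.2 last = 0%N :> nat -> cost (d z) = scost z.
  elim/triple_ind=> be ga t /= b0 g0; rewrite sE /cost /sdeg /= ord_updE B0.
  have := itot_set_at be last (ltn_ord t); have := itot_set_at ga last (ltn_ord t); lia.
have W : forall z, (d' (d z) == z) = (z.1.1 last == 0%N :> nat) && (z.1.2 last == 0%N :> nat).
  elim/triple_ind=> be ga t; apply/eqP/andP => /= [[<- <- _]|[/eqP b0 /eqP g0]].
    by rewrite !set_atE // eqxx.
  congr (_, _, _); last by apply: val_inj; rewrite /= set_atE // eqxx.
    by apply/ffunP => j; apply: val_inj; rewrite /= !set_atE //; case: eqVneq => [->|].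
  by apply/ffunP => j; apply: val_inj; rewrite /= !set_atE //; case: eqVneq => [->|].
apply: eq_big => [z|z].
  rewrite W; case: (eqVneq (z.1.1 last : nat) 0%N) => b0; rewrite ?andbF //=.
  case: (eqVneq (z.1.2 last : nat) 0%N) => g0; rewrite ?andbF //= !andbT.
  rewrite dE C // -sE eqz_nat oE ord_updE B0 !set_atE ?eqxx //= andbT.
  by rewrite andbA (below_set_at _ z.1.1 _ _ z.2); case: z b0 g0 => [[]].
rewrite W => /andP[_ /andP[/eqP b0 /eqP g0]]; rewrite C //; congr (lieK _ _ _ _).
apply/ffunP => j; rewrite !shiftE /= !set_atE //; case: eqVneq => [->|] //.
by rewrite b0 g0 !subrr.
Qed.

Lemma kernel_stable k r l : (k < B)%N -> (forall i, 0 <= l i) -> l last = 0 ->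
  (\sum_i `|l i|%N + r < 'C(n.+1, 2))%N ->
  kernel k r%:Z l = stable_kernel k r l.
Proof.
have : [\/ g = SOodd, g = SP | g = SOeven].
  by case: (g); [apply: Or31|apply: Or32|apply: Or33].
case=> gE kB l0 ll small; [exact: kernel_stableB|exact: kernel_stableC|exact: kernel_stableD].
Qed.

End Kernel.

(** * Symmetric products over edges *)

Lemma cnt_neg_eq0 n B (L : seq (nat * ivec n)) k (b : ivec n) i :
  (forall y, y \in L -> 0 <= y.2 i) -> b i < 0 -> cnt B L k b = 0.
Proof.
elim: L k b => [|y L IH] k b L0 b0 /=.
  by case: (eqVneq b 0) b0 => [->|_]; rewrite ?andbF // ffunE.
rewrite big1 // => j _; apply: IH => [z zL|].
  by apply: L0; rewrite inE zL orbT.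
rewrite !ffunE ffunMnE subr_lt0; apply: lt_le_trans b0 _.
by apply/mulrn_wge0/L0/mem_head.
Qed.

Section SymmetricSeries.
Variables (par : bool) (B : nat).

(* The edge (a, (i, j)) with i <= j stands for the factor
   1 / (1 - q^(a+1) x_i x_j). *)
Definition edge N := ('I_B * ('I_N * 'I_N))%type.

Definition edge_ok N (e : edge N) :=
  (e.2.1 < e.2.2)%N || (e.2.1 == e.2.2) && (odd e.1.+1 == par).

Definition edges N : seq (edge N) := [seq e <- enum {: edge N} | edge_ok e].

Lemma edges_uniq N : uniq (edges N).
Proof. by apply: filter_uniq; apply: enum_uniq. Qed.

Lemma mem_edges N (e : edge N) : (e \in edges N) = edge_ok e.
Proof. by rewrite mem_filter mem_enum andbT. Qed.

Definition edge_vec N (e : edge N) : ivec N := iunit e.2.1 + iunit e.2.2.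

Definition edgesL N := [seq (e.1.+1, edge_vec e) | e : edge N <- edges N].

Definition symF N k (b : ivec N) : int := cnt B (edgesL N) k b.

Lemma symF_neg N k (b : ivec N) i : b i < 0 -> symF k b = 0.
Proof.
apply: cnt_neg_eq0 => y /mapP[e _ ->] /=; rewrite !ffunE.
by case: (i == _); case: (i == _).
Qed.

Definition edge_perm N (s : 'S_N) (e : edge N) : edge N :=
  (e.1, if (s e.2.1 <= s e.2.2)%N then (s e.2.1, s e.2.2) else (s e.2.2, s e.2.1)).

Lemma edge_perm_ok N (s : 'S_N) e : edge_ok e -> edge_ok (edge_perm s e).
Proof.
case: e => a [i j]; rewrite /edge_ok /edge_perm /= => /orP[ij|/andP[/eqP-> ->]].
  have : s i != s j :> nat by rewrite (inj_eq val_inj) (inj_eq perm_inj) -val_eqE /= ltn_eqF.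
  by move=> ne; case: (leqP (s i) (s j)) => h /=; [rewrite ltn_neqAle ne h|rewrite h].
by rewrite leqnn eqxx orbT.
Qed.

Lemma edge_permK N (s : 'S_N) e : edge_ok e -> edge_perm s^-1 (edge_perm s e) = e.
Proof.
case: e => a [i j]; rewrite /edge_ok /edge_perm /= => h.
have ij : (i <= j)%N by case/orP: h => [/ltnW|/andP[/eqP -> _]].
case: (leqP (s i) (s j)) => _ /=; rewrite !permK ?ij //.
by case: (leqP j i) => // ji; congr (_, (_, _)); apply: val_inj => /=; lia.
Qed.

Lemma symF_perm N k (b : ivec N) (s : 'S_N) : symF k (fperm b s) = symF k b.
Proof.
have add : zmod_morphism (fun v : ivec N => fperm v s).
  by move=> u v; apply/ffunP => i; rewrite !ffunE.
pose Mix := GRing.isZmodMorphism.Build (ivec N) (ivec N) (fun v => fperm v s) add.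
pose f : {additive ivec N -> ivec N} := HB.pack (fun v : ivec N => fperm v s) Mix.
have fi : injective f.
  move=> u v /ffunP H; apply/ffunP => i; move: (H ((s^-1)%g i)); rewrite !ffunE permKV //.
rewrite /symF -(cnt_map_inj B (edgesL N) k b fi); apply: cnt_perm.
rewrite perm_sym -map_comp.
have E (e : edge N) : (e.1.+1, f (edge_vec e)) = ((edge_perm (s^-1)%g e).1.+1, edge_vec (edge_perm (s^-1)%g e)).
  congr (_, _); apply/ffunP => i; rewrite /edge_perm !ffunE /=.
  have inv j : (s i == j) = (i == (s^-1)%g j) by rewrite -(inj_eq (@perm_inj _ (s^-1)%g)) permK.
  by rewrite !inv; case: ifP => _ /=; rewrite // addrC.
rewrite (eq_map (g := (fun e : edge N => (e.1.+1, edge_vec e)) \o edge_perm (s^-1)%g)) //.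
rewrite map_comp; apply: perm_map.
apply: uniq_perm.
- rewrite map_inj_in_uniq ?edges_uniq // => e e'; rewrite !mem_edges => oe oe' H.
  by rewrite -(edge_permK (s^-1)%g oe) H edge_permK.
- exact: edges_uniq.
move=> e; apply/mapP/idP => [[e' + ->]|].
  by rewrite !mem_edges => /edge_perm_ok.
rewrite mem_edges => oe; exists (edge_perm s e); first by rewrite mem_edges edge_perm_ok.
by rewrite edge_permK.
Qed.

Definition glK N k (l : ivec N) : int :=
  \sum_(s : 'S_N) (-1) ^+ s * symF k (fperm l s - idelta N).

Lemma fpermB N (b c : ivec N) s : fperm (b - c) s = fperm b s - fperm c s.
Proof. by apply/ffunP => i; rewrite !ffunE. Qed.

Lemma fperm_comp N (b : ivec N) s t : fperm (fperm b s) t = fperm b (t * s)%g.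
Proof. by apply/ffunP => i; rewrite !ffunE permM. Qed.

Lemma fperm1 N (b : ivec N) : fperm b 1%g = b.
Proof. by apply/ffunP => i; rewrite ffunE perm1. Qed.

(** Symmetry of the series moves the permutation from [l] to delta, which gives the indices of a
    Jacobi-Trudi determinant. *)
Lemma glK_alt N k (l : ivec N) :
  glK k l = \sum_(s : 'S_N) (-1) ^+ s * symF k (l - fperm (idelta N) s).
Proof.
rewrite /glK (reindex_inj invg_inj) /=; apply: eq_bigr => s _.
rewrite odd_permV; congr (_ * _); rewrite -(symF_perm _ _ s) fpermB fperm_comp.
by rewrite mulgV fperm1.
Qed.

Lemma glK_tperm N k (l : ivec N) i j : i != j ->
  glK k (fperm l (tperm i j)) = - glK k l.
Proof.
move=> ij; rewrite /glK -sumrN (reindex_inj (@mulIg _ (tperm i j))) /=.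
apply: eq_bigr => s _; rewrite odd_permM odd_tperm ij addbT -mulNr.
rewrite fperm_comp -mulgA tperm2 mulg1; congr (_ * _).
by case: (odd_perm s).
Qed.

Lemma glK_eq0 N k (l : ivec N) i j : i != j -> l i = l j -> glK k l = 0.
Proof.
move=> ij E; have := glK_tperm k l ij.
rewrite fperm_tperm //.
by lia.
Qed.

Definition edge_lift N (e : edge N) : edge N.+1 := (e.1, (lift ord0 e.2.1, lift ord0 e.2.2)).

Lemma edges_recl N : perm_eq (edges N.+1)
  ([seq (a, (ord0, ord0)) | a : 'I_B <- enum 'I_B & odd a.+1 == par] ++
   [seq (a, (ord0, lift ord0 i)) | a : 'I_B <- enum 'I_B, i : 'I_N <- enum 'I_N] ++
   [seq edge_lift e | e <- edges N]).
Proof.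
have lift_inj0 : injective (@edge_lift N).
  move=> [a [i j]] [a' [i' j']] E.
  move: (congr1 (fun e : edge N.+1 => e.1) E) (congr1 (fun e : edge N.+1 => e.2.1) E)
        (congr1 (fun e : edge N.+1 => e.2.2) E) => /=.
  by move=> -> /lift_inj -> /lift_inj ->.
apply: uniq_perm; first exact: edges_uniq.
  have I1 : injective (fun a : 'I_B => (a, (ord0 : 'I_N.+1, ord0 : 'I_N.+1))).
    by move=> a a' /(congr1 fst).
  rewrite !cat_uniq (map_inj_uniq I1) (map_inj_uniq lift_inj0) edges_uniq andbT.
  rewrite filter_uniq; last exact: enum_uniq.
  rewrite allpairs_uniq ?enum_uniq //=; last first.
    move=> [a i] [a' i'] _ _ /= E; move: (congr1 fst E) (congr1 (fun e => e.2.2) E) => /=.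
    by move=> -> /lift_inj ->.
  apply/andP; split.
    apply/hasPn => x; rewrite mem_cat => /orP[/allpairsP[[a i] [_ _ ->]]|/mapP[e _ ->]];
      by apply/mapP => -[a' _ /(congr1 (fun e => val e.2.2))].
  apply/hasPn => x /mapP[e _ ->]; apply/allpairsP => -[[a i] [_ _ /(congr1 (fun e => val e.2.1))]] //.
move=> [a [i j]]; rewrite mem_edges !mem_cat.
case: (unliftP ord0 i) => [i'|] ->; last case: (unliftP ord0 j) => [j'|] ->.
- case: (unliftP ord0 j) => [j'|] ->; last first.
    have -> : edge_ok (a, (lift ord0 i', ord0)) = false by [].
    apply/esym/negP => /or3P[].
    + by case/mapP => a' _ /(congr1 (fun e => val e.2.1)).
    + by case/allpairsP => -[a' i1] [_ _ /(congr1 (fun e => val e.2.1))].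
    + by case/mapP => e _ /(congr1 (fun e => val e.2.2)).
  have -> : (a, (lift ord0 i', lift ord0 j')) = edge_lift (a, (i', j')) by [].
  rewrite (mem_map lift_inj0) mem_edges /edge_ok /= /bump !leq0n ltn_add2l (inj_eq lift_inj).
  rewrite [X in _ = X || _](_ : _ = false).
    rewrite [X in _ = _ || (X || _)](_ : _ = false) //.
    by apply/negP => /allpairsP[[a' i1] [_ _ /(congr1 (fun e => val e.2.1))]].
  by apply/negP => /mapP[a' _ /(congr1 (fun e => val e.2.1))].
- rewrite /edge_ok /=; apply/esym/orP; right; apply/orP; left.
  by apply/allpairsP; exists (a, j'); rewrite !mem_enum.
rewrite /edge_ok /=; apply/idP/or3P => [h|[]].
- by apply: Or31; apply/mapP; exists a; rewrite // mem_filter h mem_enum.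
- by case/mapP => a'; rewrite mem_filter => /andP[+ _] /(congr1 fst) /= -> .
- by case/allpairsP => -[a' i1] [_ _ /(congr1 (fun e => val e.2.2))].
- by case/mapP => e _ /(congr1 (fun e => val e.2.1)).
Qed.

Definition loopsL N (s : seq nat) : seq (nat * ivec N.+1) :=
  [seq (a, fcons 2 0) | a <- s & odd a == par].
Definition crossL N (s : seq nat) : seq (nat * ivec N.+1) :=
  [seq (a, fcons 1 (iunit i)) | a : nat <- s, i : 'I_N <- enum 'I_N].

Lemma edgesL_recl N : perm_eq (edgesL N.+1)
  (loopsL N (iota 1 B) ++ crossL N (iota 1 B) ++ [seq (y.1, fcons 0 y.2) | y <- edgesL N]).
Proof.
apply: perm_trans (perm_map _ (edges_recl N)) _.
have cE : iota 1 B = [seq (a : 'I_B).+1 | a <- enum 'I_B].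
  by rewrite (iotaDl 1 0) -val_enum_ord -map_comp; apply: eq_map => a; rewrite /= add1n.
rewrite !map_cat -!map_comp; apply/seq.permP => P; congr (count P _).
congr (_ ++ (_ ++ _)).
- rewrite /loopsL cE filter_map -map_comp; apply: eq_map => a /=.
  by rewrite /edge_vec /= iunit0 fcons_add addr0.
- rewrite /crossL cE map_allpairs allpairs_mapl !enumT; apply: eq_allpairs => a i /=.
  by rewrite /edge_vec /= iunit0 iunitS fcons_add addr0 add0r.
- apply: eq_map => e /=.
  by rewrite /edge_vec /= !iunitS fcons_add addr0.
Qed.

(** The substitution of q u for the first variable u. *)
Definition shiftL N (y : nat * ivec N.+1) := ((y.1 + `|y.2 ord0|)%N, y.2).

Lemma cnt_shift N (L : seq (nat * ivec N.+1)) k x (b : ivec N) :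
  (forall y, y \in L -> 0 <= y.2 ord0) ->
  cnt B (map (@shiftL N) L) k (fcons x b) =
  if (0 <= x) && (`|x| <= k)%N then cnt B L (k - `|x|) (fcons x b) else 0.
Proof.
elim: L k x b => [|y L IH] k x b L0 /=.
  rewrite fcons_eq0; case: (eqVneq x 0) => [->|x0]; first by rewrite subn0.
  by rewrite !andbF if_same.
have y0 := L0 y (mem_head _ _); have {L0}L0 : forall z, z \in L -> 0 <= z.2 ord0.
  by move=> z zL; apply: L0; rewrite inE zL orbT.
case: y y0 => a w; rewrite [w]fcons_eta /= fcons0; move: (w ord0) (fskip ord0 w) => v u v0.
case: v v0 => // v _ /=.
under eq_bigr => j _.
  rewrite fcons_muln fcons_opp fcons_add IH //.
  rewrite (_ : x - v%:Z *+ j = x - (v * j)%N%:Z); last by rewrite -mulr_natr natz PoszM.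
  over.
under [in RHS]eq_bigr => j _.
  rewrite fcons_muln fcons_opp fcons_add.
  rewrite (_ : x - v%:Z *+ j = x - (v * j)%N%:Z); last by rewrite -mulr_natr natz PoszM.
  over.
rewrite big_mkcond /=; case: ifP => [/andP[x0 xk]|xk]; last first.
  rewrite big1 // => j _; case: ifP => // h1; case: ifP => // /andP[h2 h3].
  by move: xk h1; rewrite mulnDl; move: h2 h3; case: x => x /=; lia.
rewrite [RHS]big_mkcond; apply: eq_bigr => j _; rewrite mulnDl.
case: x x0 xk => // x _ /= xk.
case: (leP (v * j)%N%:Z x%:Z) => h; last first.
  have neg : x%:Z - (v * j)%N%:Z < 0 by lia.
  rewrite [0 <= _]leNgt neg /= if_same; case: ifP => // _.
  by rewrite (@cnt_neg_eq0 _ _ _ _ _ ord0) // fcons0.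
have -> : (0 <= x%:Z - (v * j)%N%:Z) by lia.
have -> : (`|x%:Z - (v * j)%N%:Z| <= k - (a * j + v * j))%N = (x + v * j <= k - (a * j + v * j) + v * j + v * j)%N.
  by lia.
case: (leqP (a * j) (k - x)) => h2.
  have -> : (a * j + v * j <= k)%N by lia.
  have -> : (x + v * j <= k - (a * j + v * j) + v * j + v * j)%N by lia.
  by congr (cnt _ _ _ _); lia.
by case: ifP => // h3; case: ifP => // h4; exfalso; lia.
Qed.

Lemma cnt_cat_big N (L E : seq (nat * ivec N)) k b : (0 < B)%N ->
  (forall y, y \in E -> (k < y.1)%N) -> cnt B (L ++ E) k b = cnt B L k b.
Proof.
move=> B0 big; rewrite (cnt_perm _ _ _ (permEl (perm_catC L E))).
elim: E big => //= y E IH big; rewrite -IH; last by move=> z zE; apply: big; rewrite inE zE orbT.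
apply: (@cnt_big_degree _ B y (E ++ L)) => //; exact/big/mem_head.
Qed.

Definition loop_deg := if par then 1%N else 2.

(* F(u, x) = F(q u, x) / ((1 - q^c u^2) prod_i (1 - q u x_i)), where c = loop_deg:
   every edge at the first vertex either has minimal colour or comes from an
   edge of the same kind with smaller colour. *)
Lemma symF_shift N k x (b : ivec N) : (k < B)%N ->
  symF k (fcons x b) =
  \sum_(ga : mvec N B | (itot ga <= k)%N)
    \sum_(s < B | (loop_deg * s <= k - itot ga)%N)
      (let k' := (k - itot ga - loop_deg * s)%N in
       let x' := x - (itot ga)%:Z - (2 * s)%N%:Z in
       if (0 <= x') && (`|x'| <= k')%N then symF (k' - `|x'|) (fcons x' (b - imul ga)) else 0).
Proof.
move=> kB; have B0 : (0 < B)%N by apply: leq_ltn_trans kB.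
pose L := loopsL N (iota 1 B) ++ crossL N (iota 1 B) ++ [seq (y.1, fcons 0 y.2) | y <- edgesL N].
have LE k' b' : symF k' b' = cnt B L k' b' by apply: cnt_perm; apply: edgesL_recl.
(* Colours stop at degree [B], so the functional equation becomes exact only after adding these
   factors of degree above [B], which are invisible in degree [k]. *)
pose E := [seq (B.+1, fcons 1 (iunit i)) | i <- enum 'I_N] ++ loopsL N [:: B.+1; B.+2].
have EL : perm_eq (L ++ E)
   ([seq (1%N, fcons 1 (iunit i)) | i <- enum 'I_N] ++ (loop_deg, fcons 2 0) :: map (@shiftL N) L).
  have C : [seq (1%N, fcons 1 (iunit i)) | i <- enum 'I_N] ++ map (@shiftL N) (crossL N (iota 1 B)) =
     crossL N (iota 1 B) ++ [seq (B.+1, fcons 1 (iunit i)) | i <- enum 'I_N].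
    transitivity (crossL N (iota 1 B.+1)).
      rewrite /crossL [iota 1 B.+1]/= allpairs_cons; congr (_ ++ _).
      rewrite map_allpairs -[2%N]/(1 + 1)%N iotaDl allpairs_mapl; apply: eq_allpairs => a i.
      by rewrite /shiftL /= fcons0 addnC.
    by rewrite /crossL -(addn1 B) iotaD allpairs_cat /= cats0 add1n addn1.
  (* Rescaling the first variable raises the degree of a loop by 2, which preserves its parity. *)
  have Z : (loop_deg, fcons 2 0) :: map (@shiftL N) (loopsL N (iota 1 B)) =
     loopsL N (iota 1 B) ++ loopsL N [:: B.+1; B.+2].
    transitivity (loopsL N (iota 1 (2 + B))).
      rewrite iotaD /loopsL filter_cat map_cat.
      have -> : [seq (a, fcons 2 0) | a <- iota 1 2 & odd a == par] = [:: (loop_deg, fcons 2 (0 : ivec N))].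
        by rewrite /loop_deg /=; case: par.
      congr (_ :: _); rewrite (iotaDl 2 1) filter_map -!map_comp.
      rewrite (eq_filter (a2 := fun a => odd a == par)) => [|a /=]; last by rewrite negbK.
      by apply: eq_map => a; rewrite /shiftL /= fcons0 addnC.
    by rewrite addnC iotaD /loopsL filter_cat map_cat.
  have T : map (@shiftL N) [seq (y.1, fcons 0 y.2) | y <- edgesL N] = [seq (y.1, fcons 0 y.2) | y <- edgesL N].
    by rewrite -map_comp; apply: eq_map => y; rewrite /shiftL /= fcons0 addn0.
  apply/seq.permP => P; have := congr1 (count P) C; have := congr1 (count P) Z.
  rewrite /L /E !map_cat T !count_cat /= !count_cat; lia.
rewrite LE -(@cnt_cat_big _ L E) //; last first.
  move=> y; rewrite mem_cat => /orP[/mapP[i _ ->]|/mapP[a]]; first by rewrite /=; lia.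
  by rewrite mem_filter !inE => /andP[_ /orP[]/eqP->] -> /=; lia.
have L0 y : y \in L -> 0 <= y.2 ord0.
  rewrite !mem_cat => /or3P[/mapP[a _ ->]|/allpairsP[[a i] [_ _ ->]]|/mapP[e _ ->]] /=;
    by rewrite fcons0.
rewrite (cnt_perm _ _ _ EL) cnt_block ?enum_uniq //.
apply: eq_big => [ga|ga _].
  by rewrite (_ : [forall i, _]) //; apply/forallP => i; rewrite mem_enum.
rewrite -/(itot ga) /=; apply: eq_bigr => s _.
have -> : \sum_i fcons 1 (iunit i) *+ ga i = fcons (itot ga)%:Z (imul ga).
  under eq_bigr => i _ do rewrite fcons_muln.
  by rewrite fcons_sum sum_iunit -natr_sum natz.
rewrite fcons_muln !fcons_opp !fcons_add mul0rn subr0.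
have -> : 2 *+ s = (2 * s)%N%:Z :> int by rewrite -mulr_natr !natz PoszM.
by rewrite cnt_shift //; case: ifP => // _; rewrite LE.
Qed.

End SymmetricSeries.

(** * The same recurrence for alternating sums over permutations *)

(* In the coordinates l = lambda + delta this appends a zero part. *)
Definition pad N (l : ivec N) : ivec N.+1 :=
  [ffun i => if unlift ord_max i is Some j then l j + 1 else 0].

Lemma pad_max N (l : ivec N) : pad l ord_max = 0.
Proof. by rewrite ffunE unlift_none. Qed.

Lemma pad_lift N (l : ivec N) i : pad l (lift ord_max i) = l i + 1.
Proof. by rewrite ffunE liftK. Qed.

Section Pieri.
Variables (par : bool) (B N : nat).
Local Notation symF := (symF par B).
Local Notation glK := (glK par B).
Local Notation bvec := (mvec N.+1 B).
Local Notation pairs := ('S_N.+1 * mvec N.+1 B)%type.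

Lemma pairs_ind (P : pairs -> Prop) :
  (forall (s : 'S_N.+1) (be : bvec), P (s, be)) -> forall z, P z.
Proof. by move=> H [s be]. Qed.

Lemma hook_vecE (l : ivec N.+1) (be : bvec) (s : 'S_N.+1) j :
  (l + imul be - fperm (idelta N.+1) s) j = l j + (be j : nat)%:Z - (N - s j)%N%:Z.
Proof. by rewrite !ffunE subSS. Qed.

Definition low_free v (z : pairs) := [forall p, (z.1 p < v)%N ==> (z.2 p == 0 :> nat)].

(* Exchanging the positions of the values v and v + 1 in the permutation, with
   their boxes adjusted, reverses the sign. *)
Lemma low_free_step k r l v : (r < B)%N -> (v < N)%N ->
  \sum_(z : pairs | (itot z.2 == r) && low_free v z)
    (-1) ^+ z.1 * symF k (l + imul z.2 - fperm (idelta N.+1) z.1) =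
  \sum_(z : pairs | (itot z.2 == r) && low_free v.+1 z)
    (-1) ^+ z.1 * symF k (l + imul z.2 - fperm (idelta N.+1) z.1).
Proof.
move=> rB vN; have v1 : (v < N.+1)%N by lia.
have v2 : (v.+1 < N.+1)%N by lia.
pose x := Ordinal v1; pose y := Ordinal v2.
have xy : x != y by rewrite -val_eqE /= ltn_eqF.
(* One box passes from the position of value [v] to that of value [v + 1]. This compensates the
   change in delta, so the argument of [symF] stays the same while the sign changes. *)
pose h (z : pairs) : pairs := ((z.1 * tperm x y)%g,
  set_at (set_at z.2 ((z.1^-1)%g x) (z.2 ((z.1^-1)%g x) - 1)%N) ((z.1^-1)%g y) (z.2 ((z.1^-1)%g y)).+1).
rewrite (bigID (fun z : pairs => z.2 ((z.1^-1)%g x) == 0%N :> nat)) /= [X in _ + X](sum_involution (h := h)) ?addr0.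
  apply: eq_bigl; apply: pairs_ind => s be /=; rewrite -andbA; congr (_ && _).
  apply/andP/forallP => [[/forallP lf b0] p|lf].
    apply/implyP; rewrite /= ltnS leq_eqVlt => /orP[/eqP E|lt].
      suff <- : (s^-1)%g x = p by [].
      by apply: (@perm_inj _ s); rewrite permKV; apply: val_inj.
    by move/implyP: (lf p); apply.
  split; last by move/implyP: (lf ((s^-1)%g x)); apply; rewrite /= permKV /=.
  by apply/forallP => p; apply/implyP => lt; move/implyP: (lf p); apply; apply: leq_trans lt _.
have key (s : 'S_N.+1) (be : bvec) : itot be = r -> (0 < be ((s^-1)%g x))%N ->
   (forall j, (h (s, be)).2 j = (if j == (s^-1)%g y then (be ((s^-1)%g y)).+1 else
      if j == (s^-1)%g x then be ((s^-1)%g x) - 1 else be j)%N :> nat) /\ itot (h (s, be)).2 = r.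
  move=> tb b0; have pq : (s^-1)%g x != (s^-1)%g y by rewrite (inj_eq perm_inj).
  have g2 := leq_itot2 be pq.
  have w1 : (be ((s^-1)%g x) - 1 < B)%N by have := ltn_ord (be ((s^-1)%g x)); lia.
  have w2 : ((be ((s^-1)%g y)).+1 < B)%N by lia.
  split=> [j|]; first by rewrite /h /= set_atE // set_atE.
  have := itot_set_at (set_at be ((s^-1)%g x) (be ((s^-1)%g x) - 1)) ((s^-1)%g y) w2.
  have := itot_set_at be ((s^-1)%g x) w1.
  by rewrite set_atE // eq_sym (negbTE pq) /= /h /=; lia.
apply: pairs_ind => s be /= /andP[/andP[/eqP tb /forallP lf]]; rewrite -lt0n => b0.
have [bE tb'] := key s be tb b0.
have pq : (s^-1)%g x != (s^-1)%g y by rewrite (inj_eq perm_inj).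
have ix : ((s * tperm x y)^-1)%g x = (s^-1)%g y by rewrite invMg tpermV permM tpermL.
have iy : ((s * tperm x y)^-1)%g y = (s^-1)%g x by rewrite invMg tpermV permM tpermR.
split.
- rewrite tb' eqxx /= ix bE eqxx /= andbT.
  apply/forallP => p; apply/implyP; rewrite permM => lt; rewrite bE.
  have spx : s p != x by apply: contraTneq lt => ->; rewrite tpermL /=; lia.
  have spy : s p != y by apply: contraTneq lt => ->; rewrite tpermR /=; lia.
  rewrite tpermD 1?eq_sym // in lt.
  have px : p != (s^-1)%g x by apply: contraNneq spx => ->; rewrite permKV.
  have py : p != (s^-1)%g y by apply: contraNneq spy => ->; rewrite permKV.
  by rewrite (negbTE px) (negbTE py); move/implyP: (lf p); apply.
- have [|bE' _] := key (s * tperm x y)%g (h (s, be)).2 tb'.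
    by rewrite ix bE eqxx.
  have hE : h (s, be) = ((s * tperm x y)%g, (h (s, be)).2) by [].
  rewrite hE [LHS]surjective_pairing; congr (_, _); first by rewrite /= -mulgA tperm2 mulg1.
  apply/ffunP => j; apply: ord_inj; rewrite bE' ix iy !bE !eqxx (negbTE pq).
  case: (eqVneq j ((s^-1)%g x)) => [->|jx]; first by rewrite /=; lia.
  by case: (eqVneq j ((s^-1)%g y)) => [->|jy] //; rewrite /=; lia.
- rewrite odd_permM odd_tperm xy addbT -mulNr; congr (_ * _); first by case: (odd_perm s).
  congr (symF _ _); apply/ffunP => j.
  rewrite !hook_vecE bE permM.
  case: (eqVneq j ((s^-1)%g y)) => [->|jy].
    by rewrite permKV tpermR /=; lia.
  case: (eqVneq j ((s^-1)%g x)) => [->|jx].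
    by rewrite permKV tpermL /=; lia.
  rewrite tpermD //; [apply: contraNneq jx => ->|apply: contraNneq jy => ->]; by rewrite permK.
Qed.

Lemma fsnoc_perm k (c : ivec N) (r : int) (v : ivec N.+1) :
  v ord_max = r -> (forall j, v (lift ord_max j) = c j) -> symF k v = symF k (fcons r c).
Proof.
move=> vr vc; rewrite -(symF_perm _ _ _ (fcons r c) (lift_perm ord_max ord0 1)).
congr (symF _ _); apply/ffunP => i; rewrite ffunE.
case: (unliftP ord_max i) => [j|] ->; first by rewrite lift_perm_lift perm1 fconsS vc.
by rewrite lift_perm_id fcons0 vr.
Qed.

(* Pieri's rule in determinantal form: it turns the first variable of F into
   the sum over all ways of adding boxes, before straightening. *)
Lemma glK_pieri k r (l : ivec N) : (r < B)%N ->
  \sum_(s : 'S_N) (-1) ^+ s * symF k (fcons r%:Z (fperm l s - idelta N)) =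
  \sum_(be : bvec | itot be == r) glK k (pad l + imul be).
Proof.
move=> rB; under [RHS]eq_bigr => be _ do rewrite glK_alt.
rewrite exchange_big pair_big_dep /=.
rewrite (eq_bigl (fun z : pairs => (itot z.2 == r) && low_free 0 z)) => [|z]; last first.
  by rewrite (_ : low_free 0 z) ?andbT //; apply/forallP.
have {}step v : (v <= N)%N ->
  \sum_(z : pairs | (itot z.2 == r) && low_free 0 z)
    (-1) ^+ z.1 * symF k (pad l + imul z.2 - fperm (idelta N.+1) z.1) =
  \sum_(z : pairs | (itot z.2 == r) && low_free v z)
    (-1) ^+ z.1 * symF k (pad l + imul z.2 - fperm (idelta N.+1) z.1).
  by elim: v => // v IH vN; rewrite (IH (ltnW vN)); apply: low_free_step.
rewrite (step N) //.
rewrite -(pair_big_dep xpredT (fun s be => (itot be == r) && low_free N (s, be))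
  (fun s be => (-1) ^+ s * symF k (pad l + imul be - fperm (idelta N.+1) s))) /=.
(* If the permutation moves the last position, that position holds the padded 0 and no box, so its
   exponent is negative; otherwise it carries all [r] boxes. *)
rewrite (sum_lift_perm ord_max) (bigD1 ord_max) //= [X in _ + X]big1 ?addr0; last first.
  move=> j jm; rewrite big1 // => s _; rewrite big1 // => be /andP[_ /forallP/(_ ord_max)].
  have lt : (j < N)%N by move: jm; rewrite -val_eqE /=; have := ltn_ord j; lia.
  rewrite /= lift_perm_id lt /= => /eqP b0.
  by rewrite (@symF_neg _ _ _ _ _ ord_max) ?mulr0 // hook_vecE pad_max b0 lift_perm_id; lia.
have B0 : (0 < B)%N by apply: leq_ltn_trans rB.
pose be0 : bvec := [ffun p => if p == ord_max then Ordinal rB else Ordinal B0].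
have be0E p : be0 p = (if p == ord_max then r else 0)%N :> nat.
  by rewrite ffunE; case: eqP.
rewrite [LHS](reindex_inj invg_inj); apply: eq_bigr => s _ /=.
rewrite (big_pred1 be0) => [|be].
  rewrite odd_lift_perm addbb addFb odd_permV; congr (_ * _).
  rewrite [RHS](@fsnoc_perm _ (l - fperm (idelta N) s) r%:Z).
  - rewrite -(symF_perm _ _ _ _ (lift_perm ord0 ord0 s)); congr (symF _ _).
    apply/ffunP => i; rewrite ffunE; case: (unliftP ord0 i) => [j|] ->.
      by rewrite lift_perm_lift !fconsS !ffunE permK.
    by rewrite lift_perm_id !fcons0.
  - by rewrite hook_vecE pad_max lift_perm_id be0E eqxx subnn subr0 add0r.
  - move=> j; rewrite hook_vecE pad_lift lift_perm_lift be0E eq_sym (negbTE (neq_lift _ _)).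
    rewrite !ffunE lift_max; have -> : (N - s j = (N - (s j).+1).+1)%N by have := ltn_ord (s j); lia.
    by rewrite addr0 -addn1 PoszD; ring.
apply/andP/eqP => [[/eqP tb /forallP lf]|->].
  have z0 p : p != ord_max -> be p = 0%N :> nat.
    move=> pm; move/implyP: (lf p) => /= H; apply/eqP/H.
    case: (unliftP ord_max p) pm => [j|] ->; last by rewrite eqxx.
    by rewrite lift_perm_lift lift_max ltn_ord.
  apply/ffunP => p; apply: ord_inj; rewrite be0E; case: eqVneq => [->|/z0 //].
  by rewrite -tb /itot (bigD1 ord_max) //= big1 ?addn0.
split.
  by rewrite /itot (bigD1 ord_max) //= be0E eqxx big1 ?addn0 // => p /negbTE pm; rewrite be0E pm.
apply/forallP => p; apply/implyP => /=; case: (unliftP ord_max p) => [j|] -> lt; rewrite be0E.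
  by rewrite [lift _ _ == _]eq_sym (negbTE (neq_lift _ _)).
by move: lt; rewrite lift_perm_id ltnn.
Qed.

End Pieri.

Lemma cnt_cat_pos B N (L1 L2 : seq (nat * ivec N.+1)) k (b : ivec N.+1) : (0 < B)%N ->
  (forall y, y \in L1 -> 0 < y.2 ord0) -> (forall y, y \in L2 -> 0 <= y.2 ord0) ->
  b ord0 = 0 -> cnt B (L1 ++ L2) k b = cnt B L2 k b.
Proof.
move=> B0 L1p L2p b0; elim: L1 L1p => //= y L1 IH L1p.
rewrite (bigD1 (Ordinal B0)) ?muln0 //= mulr0n subr0 subn0 IH; last first.
  by move=> z zL; apply: L1p; rewrite inE zL orbT.
rewrite big1 ?addr0 // => j /andP[_]; rewrite -val_eqE /= -lt0n => j0.
apply: (@cnt_neg_eq0 _ _ _ _ _ ord0) => [z|].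
  rewrite mem_cat => /orP[zL|/L2p //]; apply/ltW/L1p.
  by rewrite inE zL orbT.
rewrite !ffunE ffunMnE b0 sub0r oppr_lt0 pmulrn_lgt0 //.
exact/L1p/mem_head.
Qed.

Lemma symF_cons0 par B N k (b : ivec N) : (0 < B)%N ->
  symF par B k (fcons 0 b) = symF par B k b.
Proof.
move=> B0; rewrite /symF (cnt_perm _ _ _ (edgesL_recl _ _ _)) catA cnt_cat_pos ?fcons0 //.
- by rewrite cnt_fcons eqxx.
- by move=> y; rewrite mem_cat => /orP[/mapP[a _ ->]|/allpairsP[[a i] [_ _ ->]]]; rewrite /= fcons0.
- by move=> y /mapP[e _ ->]; rewrite /= fcons0.
Qed.

(** Pieri's rule with no box. *)
Lemma glK_pad par B N k (l : ivec N) : (0 < B)%N -> glK par B k (pad l) = glK par B k l.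
Proof.
move=> B0; have := glK_pieri par k l B0.
rewrite (big_pred1 [ffun=> Ordinal B0]) => [|be].
  have -> : imul [ffun=> Ordinal B0] = 0 :> ivec N.+1 by apply/ffunP => i; rewrite !ffunE.
  by rewrite addr0 => <-; apply: eq_bigr => s _; rewrite symF_cons0.
apply/eqP/eqP => [/eqP|->]; last by rewrite /itot big1 // => i _; rewrite ffunE.
rewrite sum_nat_eq0 => /forallP H; apply/ffunP => i; apply: ord_inj.
by rewrite ffunE; apply/eqP/(H i).
Qed.

Definition type_parity (g : lie_type) := if g is SP then true else false.

Section Recursion.
Variables (g : lie_type) (B m : nat).
Let par := type_parity g.
Local Notation triple := (triple m.+1 B).

(** The counterpart of the stable kernel. In a triple, the second vector comes from the factors 1 /
    (1 - q u x_i) of [symF_shift], the third entry from the loop of least degree, and the first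
    vector from Pieri's rule for the remaining power of the rescaled variable u. *)
Lemma glK_recl k (l : ivec m.+1) : (k < B)%N ->
  glK par B k l = \sum_(j < m.+1) (-1) ^+ j *
    \sum_(z : triple | [&& (scost g z <= k)%N, (sdeg z)%:Z == l j - m%:Z, z.1.2 ord_max == 0%N :> nat &
                     below (predC1 ord_max) (pad (fskip j l)) z])
      glK par B (k - scost g z) (pad (fskip j l) + shift z).
Proof.
move=> kB; have B0 : (0 < B)%N by apply: leq_ltn_trans kB.
rewrite {1}/glK (sum_lift_perm ord0); apply: eq_bigr => j _; rewrite mulr_sumr.
set l' := fskip j l; set x := l j - m%:Z.
(* The exponent of the first variable and the degree that remain once these factors are removed;
   undoing the rescaling then costs the exponent itself in degree. *)
pose xx (ga : mvec m B) (s : 'I_B) := x - (itot ga)%:Z - (2 * s)%N%:Z.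
pose kk (ga : mvec m B) (s : 'I_B) := (k - itot ga - loop_deg par * s)%N.
pose ok (ga : mvec m B) (s : 'I_B) :=
  [&& (itot ga <= k)%N, (loop_deg par * s <= k - itot ga)%N, 0 <= xx ga s & (`|xx ga s| <= kk ga s)%N].
transitivity (\sum_(ga : mvec m B) \sum_(s < B) if ok ga s then (-1) ^+ j *
    \sum_(t : 'S_m) (-1) ^+ t * symF par B (kk ga s - `|xx ga s|) 
      (fcons (xx ga s) (fperm (l' - imul ga) t - idelta m)) else 0).
  under eq_bigr => t _.
    have -> : fperm l (lift_perm ord0 j t) - idelta m.+1 = fcons x (fperm l' t - idelta m).
      rewrite idelta_recl [fperm _ _]fcons_eta fcons_opp fcons_add; congr (fcons _ _).
        by rewrite ffunE lift_perm_id.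
      by congr (_ - _); apply/ffunP => i; rewrite !ffunE lift_perm_lift.
    rewrite symF_shift // odd_lift_perm signr_addb signr_odd.
    rewrite (reindex_inj (h := fun ga : mvec m B => [ffun i => ga (t i)] : mvec m B)); last first.
      move=> ga ga' /ffunP H; apply/ffunP => i; move: (H ((t^-1)%g i)).
      by rewrite !ffunE permKV.
    have tt (ga : mvec m B) : itot [ffun i => ga (t i)] = itot ga.
      rewrite /itot [RHS](reindex_inj (@perm_inj _ t)); by apply: eq_bigr => i _; rewrite ffunE.
    under eq_bigr => ga _.
      rewrite tt.
      have -> : fperm l' t - idelta m - imul [ffun i => ga (t i)] = fperm (l' - imul ga) t - idelta m.
        by apply/ffunP => i; rewrite !ffunE; ring.
      over.
    under eq_bigl => ga do rewrite tt.
    rewrite big_mkcond mulr_sumr. over.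
  rewrite exchange_big; apply: eq_bigr => ga _ /=.
  case: (leqP (itot ga) k) => gk; last first.
    rewrite !big1 // => [s _|t _]; last by rewrite mulr0.
    by rewrite /ok leqNgt gk.
  under eq_bigr => t _ do rewrite mulr_sumr big_mkcond /=.
  rewrite exchange_big; apply: eq_bigr => s _ /=.
  rewrite -/(xx ga s) -/(kk ga s) /ok gk /=; case: leqP => sk /=; last by rewrite big1.
  case: ifP => _; last by rewrite big1 // => t _; rewrite mulr0.
  by rewrite mulr_sumr; apply: eq_bigr => t _; rewrite mulrA.
pose z0 : 'I_B := Ordinal B0.
pose ext (ga : mvec m B) : mvec m.+1 B :=
  [ffun i => if unlift ord_max i is Some j then ga j else z0].
pose res (ga : mvec m.+1 B) : mvec m B := [ffun i => ga (lift ord_max i)].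
have ext_max ga : ext ga ord_max = z0 by rewrite ffunE unlift_none.
have ext_lift ga i : ext ga (lift ord_max i) = ga i by rewrite ffunE liftK.
have extK ga : res (ext ga) = ga by apply/ffunP => i; rewrite ffunE ext_lift.
have resK (ga : mvec m.+1 B) : ga ord_max = 0%N :> nat -> ext (res ga) = ga.
  move=> g0; apply/ffunP => i; case: (unliftP ord_max i) => [i'|] ->.
    by rewrite ext_lift ffunE.
  by rewrite ext_max; apply: ord_inj.
have tot_ext ga : itot (ext ga) = itot ga.
  by rewrite /itot (bigD1_ord ord_max) //= ext_max add0n; apply: eq_bigr => i _; rewrite ext_lift.
pose bel (ga : mvec m B) := [forall i, (ga i : nat)%:Z < l' i + 1].
have belE be ga s : below (predC1 ord_max) (pad l') (be, ext ga, s) = bel ga.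
  apply/forallP/forallP => [H i|H i]; last first.
    case: (unliftP ord_max i) => [i'|] ->; last by rewrite inE eqxx.
    by apply/implyP => _; rewrite /= ext_lift pad_lift; apply: H.
  move/implyP: (H (lift ord_max i)); rewrite inE eq_sym neq_lift => /(_ isT).
  by rewrite /= ext_lift pad_lift.
have shiftE' be ga s : pad l' + shift (be, ext ga, s) = pad (l' - imul ga) + imul be.
  apply/ffunP => i; rewrite shiftE [RHS]ffunE [imul _ i]ffunE /=.
  case: (unliftP ord_max i) => [i'|] ->; last by rewrite !pad_max ext_max subr0.
  by rewrite !pad_lift ext_lift !ffunE; ring.
pose F be ga s := (-1) ^+ j * glK par B (k - scost g (be, ext ga, s)) (pad (l' - imul ga) + imul be).
pose C be ga s := [&& (scost g (be, ext ga, s) <= k)%N, (sdeg (be, ext ga, s))%:Z == x & bel ga].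
transitivity (\sum_(ga : mvec m B) \sum_(s < B) \sum_(be : mvec m.+1 B | C be ga s) F be ga s).
  apply: eq_bigr => ga _; apply: eq_bigr => s _.
  have ldE : loop_deg par = stab_coef g by rewrite /loop_deg /stab_coef /par /type_parity; case: (g).
  (* Where this bound fails at some [i], the corresponding exponent is negative in every term of the
     alternating sum. *)
  case: (boolP (bel ga)) => [hb|]; last first.
    rewrite /bel negb_forall => /existsP[i hi]; rewrite [RHS]big_pred0; last first.
      move=> be; rewrite /C /bel [X in [&& _, _ & X]](_ : _ = false) ?andbF //.
      by apply/negbTE; rewrite negb_forall; apply/existsP; exists i.
    case: ifP => // _; rewrite big1 ?mulr0 // => t _.
    rewrite (@symF_neg _ _ _ _ _ (lift ord0 ((t^-1)%g i))) ?mulr0 // fconsS !ffunE permKV.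
    by move: hi; rewrite [l' i]ffunE; lia.
  case: (boolP (ok ga s)) => [/and4P[h1 h2 h3 h4]|nok]; last first.
    rewrite big_pred0 // => be; apply/negP => /and3P[h1 /eqP h2 _]; move: nok.
    rewrite /ok /xx /kk ldE -h2; move: h1; rewrite /scost /sdeg /= tot_ext.
    lia.
  have E : xx ga s = `|xx ga s|%N by move: h3; case: (xx ga s).
  rewrite E glK_pieri ?mulr_sumr; last by apply: leq_ltn_trans h4 _; apply: leq_ltn_trans kB; rewrite /kk; lia.
  apply: eq_big => be.
    rewrite /C hb andbT /scost /sdeg /= tot_ext -ldE; apply/eqP/andP => [tb|[c1 /eqP c2]].
      move: h1 h2 h3 h4; rewrite /kk -tb; move: tb; rewrite /xx => tb h1 h2 h3 h4.
      by split; [lia|apply/eqP; lia].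
    by move: h3; rewrite /xx; lia.
  move=> /eqP tb; rewrite /F; congr (_ * glK _ _ _ _).
  by rewrite /kk /scost /= tot_ext -ldE; lia.
transitivity (\sum_be \sum_(ga : mvec m.+1 B | ga ord_max == 0%N :> nat) \sum_(s < B | C be (res ga) s) F be (res ga) s); last first.
  under eq_bigr => be _ do rewrite pair_big_dep /=.
  rewrite pair_big_dep /= (reindex (fun z : triple => (z.1.1, (z.1.2, z.2)))); last first.
    by exists (fun z => (z.1, z.2.1, z.2.2)) => [[[]]|[? []]].
  apply: eq_big => [[[be ga] s]|[[be ga] s] /andP[/eqP g0 _]] /=.
    case: (eqVneq (ga ord_max : nat) 0%N) => g0 /=; last by rewrite !andbF.
    by rewrite /C -(belE be _ s) resK.
  by rewrite /F -(shiftE' _ _ s) resK.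
transitivity (\sum_be \sum_ga \sum_(s < B | C be ga s) F be ga s).
  by under eq_bigr => ga _ do rewrite (exchange_big_dep xpredT) //=; rewrite exchange_big.
apply: eq_bigr => be _; rewrite [RHS](reindex_onto ext res) => [|ga /eqP /resK //].
apply: eq_big => [ga|ga _]; first by rewrite extK ext_max !eqxx.
by rewrite extK.
Qed.
End Recursion.

(** * Stable values of the Lusztig coefficients *)

Lemma sum_inj_lt n (f : 'I_n -> nat) : injective f -> (forall i, f i < n)%N ->
  (\sum_i f i = 'C(n, 2))%N.
Proof.
move=> fi lt; rewrite -bin2_sum big_mkord.
have hi : injective (fun i => Ordinal (lt i)) by move=> i j /(congr1 val) /fi.
by rewrite [RHS](reindex_inj hi).
Qed.

Lemma inj_has_large n (f : 'I_n.+1 -> nat) : injective f -> exists i, (n <= f i)%N.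
Proof.
move=> fi; case: (pickP (fun i => n <= f i)%N) => [i h|H]; first by exists i.
have lt i : (f i < n)%N by rewrite ltnNge H.
have /leq_card : injective (fun i => Ordinal (lt i)) by move=> i j /(congr1 val) /fi.
by rewrite !card_ord ltnn.
Qed.

Lemma fskip_pad m (l : ivec m.+1) j : fskip (lift ord_max j) (pad l) = pad (fskip j l).
Proof.
apply/ffunP => i; rewrite [LHS]ffunE; case: (unliftP ord_max i) => [i'|] ->; last first.
  rewrite pad_max; have -> : lift (lift ord_max j) ord_max = ord_max.
    apply: ord_inj; rewrite /= /bump [(m.+1 <= j)%N]leqNgt ltn_ord add0n.
    by rewrite -ltnS ltn_ord.
  by rewrite pad_max.
rewrite pad_lift [RHS](_ : _ = l (lift j i') + 1); last by rewrite ffunE.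
rewrite -pad_lift; congr (pad l _); apply: ord_inj; rewrite [RHS]lift_max /= /bump.
by rewrite [(m.+1 <= j)%N]leqNgt [(m <= i')%N]leqNgt !ltn_ord.
Qed.

Lemma noninj_witness n (f : 'I_n -> int) : ~ injective f -> exists i j, i != j /\ f i = f j.
Proof. by move/injectiveP/injectivePn => [i [j ij E]]; exists i, j. Qed.

Section Compare.
Variables (g : lie_type) (B : nat).
Let par := type_parity g.

Definition isize n (c : ivec n) : nat := \sum_i `|c i|%N.

Lemma lieK_eq_glK_rank1 k (c : ivec 1) : (k < B)%N -> c ord0 = 0 -> lieK g B k c = glK par B k c.
Proof.
move=> kB c0; have B0 : (0 < B)%N by apply: leq_ltn_trans kB.
have {c0}-> : c = 0 by apply/ffunP => i; rewrite (ord1 i) c0 ffunE.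
have d0 : idelta 1 = 0 by apply/ffunP => i; rewrite !ffunE; case: i => [[]].
have pos (L : seq (nat * ivec 1)) : (forall y, y \in L -> 0 < y.2 ord0) -> cnt B L k 0 = (k == 0%N)%:R.
  by move=> Lp; rewrite -[L]cats0 cnt_cat_pos ?ffunE //= eqxx andbT.
have E1 : glK par B k (0 : ivec 1) = (k == 0%N)%:R.
  rewrite /glK (big_pred1 1%g) => [|s]; last first.
    by apply/esym/eqP/permP => i; rewrite [LHS]ord1 [RHS]ord1.
  rewrite odd_perm1 mul1r d0 subr0 fperm1 /symF pos // => y /mapP[e _ ->] /=.
  by rewrite !ffunE (ord1 e.2.1) (ord1 e.2.2).
have rp y : y \in rootsL g 1 -> 0 < y.2 ord0.
  case/mapP => v; rewrite !mem_cat => /or3P[/mapP[p]|/mapP[p]|] .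
  - by rewrite mem_filter (ord1 p.1) (ord1 p.2).
  - by rewrite mem_filter (ord1 p.1) (ord1 p.2).
  by rewrite /axis_roots; case: (g) => // /mapP[i _ ->] -> /=; rewrite ?ffunMnE ffunE (ord1 i).
have K0 : kostant g B k (0 : ivec 1) = (k == 0%N)%:R by apply: pos.
have Kn (v : ivec 1) : v ord0 < 0 -> kostant g B k v = 0.
  by apply: cnt_neg_eq0 => y /rp /ltW.
rewrite E1 /lieK (bigD1 (1%g, set0)) /=; last by case: (g); rewrite //= cards0.
rewrite /sgn_odd /= odd_perm1 cards0 mul1r d0 subr0.
have -> : iact g (1%g, set0) (0 : ivec 1) = 0 by apply/ffunP => i; rewrite !ffunE inE.
rewrite K0 big1 ?addr0 // => -[s E] /andP[wE ne].
have s1 : s = 1%g by apply/permP => i; rewrite [LHS]ord1 [RHS]ord1.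
have E0 : ord0 \in E.
  apply: contraNT ne => nE; rewrite s1; apply/eqP; congr (_, _).
  by apply/setP => i; rewrite (ord1 i) inE (negbTE nE).
(* The reflected coordinate becomes [- tau], negative in types B and C; in type D this element is
   not in the Weyl group. *)
rewrite Kn ?mulr0 // subr0 !ffunE /= E0.
move: wE; rewrite /tau; case: (g) => //=.
have -> : E = [set ord0] by apply/setP => i; rewrite (ord1 i) inE E0 eqxx.
by rewrite cards1.
Qed.

(** For distinct entries the size is at least ['C(n.+1, 2)], and [S] bounds the excess. An excess of
    0 is inherited by the recurrence. Otherwise a large entry forces the number of coordinates to be
    large, since the other entries are distinct. The term [S.+1 * k] is what the descent may lose:
    one [S.+1] for each unit of degree spent. *)
Lemma lieK_eq_glK S n k (c : ivec n.+1) : (k < B)%N -> (forall i, 0 <= c i) ->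
  (isize c <= S + 'C(n.+1, 2))%N ->
  (isize c <= 'C(n.+1, 2))%N \/ (exists i, 2 * S + 1 + S.+1 * k <= `|c i|)%N ->
  lieK g B k c = glK par B k c.
Proof.
elim: n k c => [|m IH] k c kB c0 small cond.
  apply: lieK_eq_glK_rank1 => //; move: small cond; rewrite /isize big_ord1 /= => small [h|[i]].
    by move: h; rewrite leqn0 absz_eq0 => /eqP.
  have -> : i = ord0 by apply: val_inj; case: i => [[]].
  by move=> h; exfalso; move: small h; rewrite bin_small //; lia.
have dec : injective c \/ ~ injective c by case: (injectiveP c) => h; [left|right].
case: dec => [ci|/noninj_witness[i [j [ij E]]]]; last first.
  by rewrite (lieK_eq0 _ _ _ ij E) (glK_eq0 _ _ _ ij E).
have fi : injective (fun i => `|c i|%N).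
  by move=> i j E; apply: ci; have := c0 i; have := c0 j; lia.
have binS3 : ('C(m.+3, 2) = 'C(m.+2, 2) + m.+2)%N by rewrite binS bin1 addnC.
have binS2 : ('C(m.+2, 2) = 'C(m.+1, 2) + m.+1)%N by rewrite binS bin1 addnC.
have Mbound i : (`|c i| + 'C(m.+1, 2) <= isize c)%N.
  rewrite /isize (bigD1_ord i) //= leq_add2l; apply: sum_inj_ge => a b /fi; exact: lift_inj.
have Sm : (isize c <= 'C(m.+2, 2))%N \/ (S < m.+1)%N.
  case: cond => [|[i h]]; [by left|right].
  by have := Mbound i; move: h small; rewrite binS2; move: (S.+1 * k)%N; lia.
(* Distinct entries that are all positive would exceed the size bound, so some entry is 0;
   antisymmetry moves it to the end. *)
wlog cmax : c c0 small cond ci fi Mbound Sm / c ord_max = 0.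
  move=> H.
  have [i ci0] : exists i, c i = 0.
    case: (pickP (fun i => c i == 0)) => [i /eqP|nz]; first by exists i.
    have [||i [j [ij E]]] := @not_inj_small _ (fun i => `|c i|%N).
    - by move=> i; rewrite lt0n absz_eq0 nz.
    - by rewrite -/(isize c) binS3; case: Sm => h; lia.
    by move: ij; rewrite (fi _ _ E) eqxx.
  case: (eqVneq i ord_max) => [im|im]; first by apply: H; rewrite // -im.
  pose c' := fperm c (tperm i ord_max).
  have sz : isize c' = isize c.
    rewrite /isize [RHS](reindex_inj (@perm_inj _ (tperm i ord_max))) /=.
    by apply: eq_bigr => a _; rewrite ffunE.
  suff : lieK g B k c' = glK par B k c' by rewrite lieK_tperm // glK_tperm // => /oppr_inj.
  apply: H; rewrite ?sz //.
  - by move=> a; rewrite ffunE.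
  - case: cond => [|[a h]]; [by left|right]; exists (tperm i ord_max a).
    by rewrite ffunE tpermK.
  - by move=> a b; rewrite !ffunE => /ci /perm_inj.
  - by move=> a b; rewrite !ffunE => /fi /perm_inj.
  - by move=> a; rewrite ffunE.
  - by rewrite ffunE tpermR.
pose l : ivec m.+1 := [ffun i => c (lift ord_max i) - 1].
have cE : c = pad l.
  apply/ffunP => i; case: (unliftP ord_max i) => [j|] ->; last by rewrite pad_max.
  by rewrite pad_lift ffunE subrK.
have B0 : (0 < B)%N by apply: leq_ltn_trans kB.
have cpos i : 0 < c (lift ord_max i).
  rewrite lt0r c0 andbT; apply/eqP => h.
  have /ci/eqP : c (lift ord_max i) = c ord_max by rewrite h cmax.
  by rewrite eq_sym (negbTE (neq_lift _ _)).
(* Dropping the final 0 on the symmetric side lets both recurrences end with [m.+1] coordinates. *)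
rewrite [in RHS]cE glK_pad // lieK_recl // glK_recl //.
rewrite (bigD1_ord ord_max) //= [X in X + _](_ : _ = 0); last first.
  by rewrite big_pred0 ?mulr0 // => z; rewrite cmax; apply/negP => /and3P[_ _ /eqP]; lia.
rewrite add0r; apply: eq_bigr => j _.
have -> : bump m.+1 j = j by rewrite /bump leqNgt ltn_ord.
congr (_ * _).
have cj : c (lift ord_max j) = l j + 1 by rewrite cE pad_lift.
have -> : c (lift ord_max j) - m.+1%:Z = l j - m%:Z by rewrite cj; lia.
have -> : fskip (lift ord_max j) c = pad (fskip j l) by rewrite cE fskip_pad.
case: (ltrP (l j - m%:Z) 0) => [neg|].
  by rewrite !big_pred0 // => z; apply/negP; [case/and4P => _ /eqP|case/and3P => _ _ /eqP]; lia.
case E : (l j - m%:Z) => [r|//] _.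
pose d := pad (fskip j l).
have sd : (isize d + r + m.+1 = isize c)%N.
  rewrite {2}/isize (bigD1_ord (lift ord_max j)) //= cj.
  have -> : isize d = (\sum_(i < m.+1) `|c (lift (lift ord_max j) i)|)%N.
    by rewrite /isize /d -fskip_pad -cE; apply: eq_bigr => i _; rewrite ffunE.
  by move: (\sum_(i < m.+1) _)%N => T; move: E; lia.
have d0 i : 0 <= d i by rewrite /d -fskip_pad -cE ffunE.
rewrite kernel_stable //; first 1 last.
- exact: pad_max.
- by rewrite -/(isize d); case: Sm; lia.
apply: eq_big => [z|]; first by rewrite eqz_nat.
elim/triple_ind => be ga t /and4P[zk /eqP zr /eqP /= gl bl].
set z := (be, ga, t) in zk zr bl *.
pose c' := d + shift z; rewrite -/c'.
have c'E i : c' i = d i + ((be i : nat)%:Z - (ga i : nat)%:Z) by rewrite /c' shiftE.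
have c'0 i : 0 <= c' i.
  rewrite c'E; case: (eqVneq i ord_max) => [->|im]; first by rewrite /d pad_max gl; lia.
  rewrite addrCA addr_ge0 // subr_ge0; apply/ltW.
  by move/forallP/(_ i)/implyP: bl; apply.
have sc' : (isize c' + itot ga = isize d + itot be)%N.
  rewrite /isize /itot -!big_split /=; apply: eq_bigr => i _.
  by have := c'0 i; have := d0 i; rewrite c'E; move: (d i) => x; lia.
have kle : (k - scost g z < B)%N by apply: leq_ltn_trans (leq_subr _ _) kB.
have szc' : (isize c' + m.+1 <= isize c)%N by move: zr sc' sd; rewrite /sdeg /=; lia.
have dec' : injective c' \/ ~ injective c' by case: (injectiveP c') => h; [left|right].
case: dec' => [ci'|/noninj_witness[a [b [ab Eab]]]]; last first.
  by rewrite (lieK_eq0 _ _ _ ab Eab) (glK_eq0 _ _ _ ab Eab).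
apply: IH => //; first by move: szc' small; rewrite binS2; lia.
case: (leqP (isize c) 'C(m.+2, 2)) => [le|gt].
  by left; move: szc' le; rewrite binS2; lia.
have [i hi] : exists i, (2 * S + 1 + S.+1 * k <= `|c i|)%N by case: cond => //; lia.
(* The excess is positive, so the entries are not a mere rearrangement of delta. *)
have [i1 hi1] : exists i, (m.+2 <= `|c i|)%N.
  case: (pickP (fun i => m.+2 <= `|c i|)%N) => [i1 h1|H]; first by exists i1.
  have /= := @sum_inj_lt m.+2 (fun i => `|c i|%N) fi (fun i => _).
  rewrite -/(isize c) => E'; move: gt; rewrite E' ?ltnn // => a.
  by rewrite ltnNge H.
(* When nothing is shifted, the step only deletes an entry equal to [m.+1]; should this be the large
   entry, [i1] replaces it. *)
case: (posnP r) => [r0|rpos].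
  right; have z0 : scost g z = 0%N /\ shift z = 0.
    move: zr; rewrite r0 /sdeg /scost /= => zr; split.
      have -> : t = 0%N :> nat by lia.
      by rewrite muln0; lia.
    have b0 i' : be i' = 0%N :> nat by have := leq_itot be i'; lia.
    have g0 i' : ga i' = 0%N :> nat by have := leq_itot ga i'; lia.
    by apply/ffunP => i'; rewrite !ffunE /= b0 g0.
  case: z0 => -> sh0; rewrite subn0.
  have dE i' : c' i' = c (lift (lift ord_max j) i').
    by rewrite /c' sh0 addr0 /d -fskip_pad -cE ffunE.
  have [i2 [hi2 ne2]] : exists i2, (2 * S + 1 + S.+1 * k <= `|c i2|)%N /\ i2 != lift ord_max j.
    case: (eqVneq i (lift ord_max j)) => [ij|ne]; last by exists i.
    have cjE : `|c i|%N = m.+1 by rewrite ij cj; move: E; rewrite r0; lia.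
    exists i1; split; first by lia.
    by apply: contraTneq hi1 => ->; rewrite -ij cjE ltnn.
  case: (unliftP (lift ord_max j) i2) hi2 ne2 => [i' ->|->]; last by rewrite eqxx.
  by move=> h _; exists i'; rewrite dE.
have fi' : injective (fun i => `|c' i|%N).
  by move=> a b Eab; apply: ci'; have := c'0 a; have := c'0 b; move: (c' a) (c' b) Eab => x y; lia.
(* Among [m.+1] distinct naturals one is at least [m], and this is large enough because the
   remaining degree has dropped. *)
have [a ha] := inj_has_large fi'; right; exists a; apply: leq_trans ha.
have sc1 : (0 < scost g z)%N.
  move: zr rpos => <-; rewrite /sdeg /scost /stab_coef; case: (g) => /=; lia.
have kS : (S.+1 * (k - scost g z) + S.+1 <= S.+1 * k)%N.
  by rewrite addnC -mulnS leq_mul2l; lia.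
by have := Mbound i; move: hi small; rewrite binS2; lia.
Qed.
End Compare.

(** * Monomial characters *)

Section SignedAction.
Variables (gT : finGroupType) (X : finType) (D : pred X).
Variables (to : X -> gT -> X) (sg : X -> gT -> bool).
Hypothesis to1 : forall x, to x 1%g = x.
Hypothesis toM : forall x g h, to x (g * h)%g = to (to x g) h.
Hypothesis toD : forall x g, D x -> D (to x g).
Hypothesis sgM : forall x g h, D x -> sg x (g * h)%g = sg x g (+) sg (to x g) h.

Let G := [set: gT]%G.

(** Monomial matrices; the cocycle condition [sgM] makes them multiplicative. *)
Definition signed_mx (g : gT) : 'M[algC]_#|D| :=
  \matrix_(i, j) ((-1) ^+ sg (enum_val i) g *+ (enum_val j == to (enum_val i) g)).

Lemma signed_act1 x : D x -> sg x 1%g = false.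
Proof. by move=> Dx; have := sgM 1%g 1%g Dx; rewrite mulg1 to1 addbb. Qed.

Lemma signed_mx_repr : mx_repr G signed_mx.
Proof.
split=> [|g h _ _]; apply/matrixP => i j; rewrite !mxE.
  rewrite to1 signed_act1; last exact: enum_valP.
  by rewrite (inj_eq (@enum_val_inj _ D)) eq_sym.
have Di : D (enum_val i) := enum_valP i.
rewrite (eq_bigr (fun k : 'I_#|D| => (-1) ^+ sg (enum_val i) g *+ (enum_val k == to (enum_val i) g) *
  ((-1) ^+ sg (enum_val k) h *+ (enum_val j == to (enum_val k) h)))) => [|k _]; last by rewrite !mxE.
rewrite -(big_enum_val (fun y => (-1) ^+ sg (enum_val i) g *+ (y == to (enum_val i) g) *
  ((-1) ^+ sg y h *+ (enum_val j == to y h)))) /=.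
rewrite (bigD1 (to (enum_val i) g)) /=; last exact: toD.
rewrite eqxx big1 ?addr0 => [|y /andP[_ /negbTE ->]]; last by rewrite mul0r.
by rewrite mulr1n sgM // toM mulrnAr -signr_addb.
Qed.

Definition signed_char : 'CF(G) := cfRepr (MxRepresentation signed_mx_repr).

Lemma signed_char_char : signed_char \is a character.
Proof. exact: cfRepr_char. Qed.

Lemma signed_charE g : signed_char g = \sum_(x | D x && (to x g == x)) (-1) ^+ sg x g.
Proof.
rewrite cfunE inE /= mulr1n /mxtrace.
rewrite big_mkcondr (big_enum_val (fun x => if to x g == x then (-1) ^+ sg x g else 0)) /=.
by apply: eq_bigr => i _; rewrite mxE eq_sym; case: eqP.
Qed.

Section Orbits.
Variables (T : finType) (inv : X -> T) (gd : pred T).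
Hypothesis invP : forall x y, D x -> D y -> inv x = inv y <-> exists g, y = to x g.
Hypothesis gdP : forall x, D x -> gd (inv x) -> forall g, to x g = x -> sg x g = false.
Hypothesis ngdP : forall x, D x -> ~~ gd (inv x) -> exists2 g, to x g = x & sg x g = true.

(** On the stabiliser the sign is a linear character, whose sum is zero unless it is trivial. *)
Lemma sum_stab_sign x : D x ->
  \sum_(g | to x g == x) (-1) ^+ sg x g = (if gd (inv x) then #|[pred g | to x g == x]| else 0%N)%:R :> algC.
Proof.
move=> Dx; case: ifP => [gx|/negbT /(ngdP Dx) [h hx sh]].
  rewrite (eq_bigr (fun=> 1)) => [|g /eqP xg]; last by rewrite (gdP Dx gx xg).
  by rewrite sumr_const.
set S := \sum_(g | _) _; suff : S = - S.
  by move/eqP; rewrite -addr_eq0 -mulr2n mulrn_eq0 /= => /eqP.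
rewrite {1}/S (reindex_inj (mulgI h)) -sumrN; apply: eq_big => [g|g _] /=.
  by rewrite toM hx.
by rewrite sgM // hx sh signrN.
Qed.

Lemma card_orbit_stab x : D x ->
  (\sum_(y | D y && (inv y == inv x)) #|[pred g | to y g == y]| = #|gT|)%N.
Proof.
move=> Dx.
transitivity (\sum_(y | D y && (inv y == inv x)) \sum_(g | to x g == y) 1)%N.
  apply: eq_bigr => y /andP[Dy /eqP yx]; rewrite -sum1_card.
  have [h yE] := (invP Dx Dy).1 (esym yx).
  rewrite [RHS](reindex_inj (mulgI h)) /=; apply: eq_bigl => g.
  by rewrite inE toM -yE.
rewrite (exchange_big_dep xpredT) //= -sum1_card; apply: eq_bigr => g _.
rewrite (big_pred1 (to x g)) // => y; rewrite andbC [RHS]eq_sym; case: eqP => //= <-.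
by rewrite toD // eq_sym; apply/eqP; apply/invP; rewrite ?toD //; exists g.
Qed.

(** Burnside's lemma with signs: an orbit counts 1 when its stabilisers have trivial sign, and 0
    otherwise. Orbits are represented by their values under [inv]. *)
Lemma signed_orbits :
  #|gT|%:R^-1 * \sum_g \sum_(x | D x && (to x g == x)) (-1) ^+ sg x g =
  #|[set t | gd t & [exists x, D x && (inv x == t)]]|%:R :> algC.
Proof.
have n0 : #|gT|%:R != 0 :> algC.
  by rewrite pnatr_eq0 -lt0n; apply/card_gt0P; exists 1%g.
apply: (mulfI n0); rewrite mulrA divff // mul1r.
rewrite (exchange_big_dep D) => [|g x _ /andP[]] //=.
transitivity (\sum_(x | D x) (if gd (inv x) then #|[pred g | to x g == x]| else 0%N)%:R : algC).
  by apply: eq_bigr => x Dx; rewrite -sum_stab_sign //; apply: eq_bigl => g; rewrite Dx.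
rewrite -natr_sum -natrM; congr _%:R; rewrite -big_mkcondr /=.
set S := [set t | _].
rewrite (partition_big inv (mem S)) => [|x /andP[Dx gx]]; last first.
  by rewrite !inE gx; apply/existsP; exists x; rewrite Dx eqxx.
rewrite (eq_bigr (fun=> #|gT|)) => [|t]; first by rewrite sum_nat_const mulnC.
move=> tS; have : t \in S by [].
rewrite inE => /andP[gt /existsP[x /andP[Dx /eqP xt]]].
rewrite -(card_orbit_stab Dx) xt; apply: eq_bigl => y.
by case: (eqVneq (inv y) t) => [->|]; rewrite ?gt ?andbT ?andbF.
Qed.

End Orbits.
End SignedAction.

Section ProductOrbits.
Variables (gT : finGroupType) (X1 X2 : finType) (D1 : pred X1) (D2 : pred X2).
Variables (to1 : X1 -> gT -> X1) (sg1 : X1 -> gT -> bool).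
Variables (to2 : X2 -> gT -> X2) (sg2 : X2 -> gT -> bool).
Hypothesis to1_1 : forall x, to1 x 1%g = x.
Hypothesis to1M : forall x g h, to1 x (g * h)%g = to1 (to1 x g) h.
Hypothesis to1D : forall x g, D1 x -> D1 (to1 x g).
Hypothesis sg1M : forall x g h, D1 x -> sg1 x (g * h)%g = sg1 x g (+) sg1 (to1 x g) h.
Hypothesis to2_1 : forall x, to2 x 1%g = x.
Hypothesis to2M : forall x g h, to2 x (g * h)%g = to2 (to2 x g) h.
Hypothesis to2D : forall x g, D2 x -> D2 (to2 x g).
Hypothesis sg2M : forall x g h, D2 x -> sg2 x (g * h)%g = sg2 x g (+) sg2 (to2 x g) h.
Variables (T : finType) (inv : X1 -> X2 -> T) (gd : pred T).
Hypothesis invP : forall x y x' y', D1 x -> D2 y -> D1 x' -> D2 y' ->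
  inv x y = inv x' y' <-> exists g, x' = to1 x g /\ y' = to2 y g.
Hypothesis gdP : forall x y, D1 x -> D2 y -> gd (inv x y) ->
  forall g, to1 x g = x -> to2 y g = y -> sg1 x g = sg2 y g.
Hypothesis ngdP : forall x y, D1 x -> D2 y -> ~~ gd (inv x y) ->
  exists g, [/\ to1 x g = x, to2 y g = y & sg1 x g != sg2 y g].

(** The signs being real, the product of the two characters is the signed character of the product
    set, and its average is a signed orbit count. *)
Lemma cfdot_signed_char :
  '[signed_char to1_1 to1M to1D sg1M, signed_char to2_1 to2M to2D sg2M] =
  #|[set t | gd t & [exists x, exists y, [&& D1 x, D2 y & inv x y == t]]]|%:R.
Proof.
pose D (z : X1 * X2) := D1 z.1 && D2 z.2.
pose to (z : X1 * X2) g := (to1 z.1 g, to2 z.2 g).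
pose sg (z : X1 * X2) g := sg1 z.1 g (+) sg2 z.2 g.
have tM z g h : to z (g * h)%g = to (to z g) h by rewrite /to to1M to2M.
have tD z g : D z -> D (to z g) by case/andP => d1 d2; rewrite /D /= to1D // to2D.
have sM z g h : D z -> sg z (g * h)%g = sg z g (+) sg (to z g) h.
  case/andP => d1 d2; rewrite /sg sg1M // sg2M //=.
  by case: (sg1 _ _); case: (sg2 _ _); case: (sg1 _ _); case: (sg2 _ _).
pose inv' (z : X1 * X2) := inv z.1 z.2.
have iP z z' : D z -> D z' -> inv' z = inv' z' <-> exists g, z' = to z g.
  case: z z' => [x y] [x' y'] /andP[/= d1 d2] /andP[/= d3 d4]; rewrite /inv' /=.
  by rewrite (invP d1 d2 d3 d4); split=> [[g [-> ->]]|[g [-> ->]]]; exists g.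
have gP z : D z -> gd (inv' z) -> forall g, to z g = z -> sg z g = false.
  case: z => [x y] /andP[/= d1 d2] gz g [/= e1 e2].
  by rewrite /sg /= (gdP d1 d2 gz e1 e2) addbb.
have nP z : D z -> ~~ gd (inv' z) -> exists2 g, to z g = z & sg z g = true.
  case: z => [x y] /andP[/= d1 d2] /(ngdP d1 d2)[g [e1 e2 ne]]; exists g.
    by rewrite /to /= e1 e2.
  by rewrite /sg /=; case: (sg1 _ _) (sg2 _ _) ne => [] [].
transitivity (#|[set t | gd t & [exists z, D z && (inv' z == t)]]|%:R : algC); last first.
  congr _%:R; apply: eq_card => t; rewrite !inE; congr (_ && _).
  apply/existsP/existsP => [[[x y] /andP[/andP[d1 d2] e]]|[x /existsP[y /and3P[d1 d2 e]]]].
    by exists x; apply/existsP; exists y; apply/and3P.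
  by exists (x, y); rewrite /D /= d1 d2.
rewrite -(signed_orbits tM tD sM iP gP nP) cfdotE cardsT; congr (_ * _).
rewrite (eq_bigl xpredT) => [|g]; last by rewrite inE.
apply: eq_bigr => g _; rewrite !signed_charE rmorph_sum big_distrlr pair_big /=.
apply: eq_big => [z|z _]; last by rewrite rmorph_sign -signr_addb.
by rewrite /D /to -pair_eqE /= andbACA.
Qed.
End ProductOrbits.

Lemma word_perm m (T : finType) (u v : 'I_m -> T) :
  (forall t, #|[pred p | u p == t]| = #|[pred p | v p == t]|) ->
  exists g : 'S_m, forall p, v (g p) = u p.
Proof.
move=> E; pose s := [tuple u i | i < m]; pose t := [tuple v i | i < m].
have cE (w : 'I_m -> T) x : count_mem x [tuple w i | i < m] = #|[pred p | w p == x]|.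
  by rewrite -sum1_count big_map /= big_enum_cond -sum1_card.
have /tuple_permP[g sE] : perm_eq s t.
  by rewrite /perm_eq; apply/allP => x _; rewrite /= !cE E.
exists g => p; have : tnth s p = tnth [tuple tnth t (g i) | i < m] p by congr tnth; apply: val_inj.
by rewrite !tnth_mktuple => ->.
Qed.

Lemma word_exists m (T : finType) (M : T -> nat) : (\sum_t M t = m)%N ->
  exists u : 'I_m -> T, forall t, #|[pred p | u p == t]| = M t.
Proof.
move=> Mm; pose s := flatten [seq nseq (M t) t | t <- enum T].
have cE t : count_mem t s = M t.
  rewrite count_flatten -map_comp sumnE big_map big_enum /= (bigD1 t) //=.
  rewrite count_nseq /= eqxx mul1n big1 ?addn0 // => t' ne.
  by rewrite /= count_nseq /= (negbTE ne) mul0n.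
have sE : size s = m.
  rewrite -Mm size_flatten sumnE /shape -map_comp big_map big_enum /=.
  by apply: eq_bigr => t _; rewrite size_nseq.
have /eqP ss := sE; exists (tnth (Tuple ss)) => t.
rewrite -cE -[s in RHS]/(tval (Tuple ss)) -[in RHS](map_tnth_enum (Tuple ss)) -sum1_count big_map big_enum_cond -sum1_card.
by [].
Qed.

(** * Words and Young's characters *)

Lemma sum_card_fiber (X J : finType) (P : pred X) (y : X -> J) :
  (\sum_j #|[pred p | P p && (y p == j)]| = #|[pred p | P p]|)%N.
Proof.
rewrite -[RHS]sum1_card (partition_big y xpredT) //=.
by apply: eq_bigr => j _; rewrite -sum1_card; apply: eq_bigl => p; rewrite !inE.
Qed.

Section Words.
Variable m : nat.
Local Notation word N := {ffun 'I_m -> 'I_N}.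

Definition word_act N (x : word N) (g : 'S_m) : word N := [ffun p => x ((g^-1)%g p)].
Definition content N (x : word N) (i : 'I_N) : nat := #|[pred p | x p == i]|.
Definition word_dom N (b : ivec N) : pred (word N) := fun x => [forall i, (content x i)%:Z == b i].
Definition word_sign N (e : bool) (x : word N) (g : 'S_m) := e && odd_perm g.

Lemma word_act1 N (x : word N) : word_act x 1%g = x.
Proof. by apply/ffunP => p; rewrite ffunE invg1 perm1. Qed.

Lemma word_actM N (x : word N) g h : word_act x (g * h)%g = word_act (word_act x g) h.
Proof. by apply/ffunP => p; rewrite !ffunE invMg permM. Qed.

Lemma word_actE N (x : word N) (g : 'S_m) p : word_act x g (g p) = x p.
Proof. by rewrite ffunE permK. Qed.

Lemma word_act_eq N (x y : word N) (g : 'S_m) : (forall p, y (g p) = x p) -> y = word_act x g.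
Proof. by move=> H; apply/ffunP => p; rewrite ffunE -H permKV. Qed.

Lemma content_act N (x : word N) g i : content (word_act x g) i = content x i.
Proof.
rewrite /content -!sum1_card (reindex_inj (@perm_inj _ g)) /=.
by apply: eq_bigl => p; rewrite !inE word_actE.
Qed.

Lemma word_domD N (b : ivec N) x g : word_dom b x -> word_dom b (word_act x g).
Proof. by move/forallP => H; apply/forallP => i; rewrite content_act. Qed.

Lemma word_signM N e (b : ivec N) (x : word N) g h : word_dom b x ->
  word_sign e x (g * h)%g = word_sign e x g (+) word_sign e (word_act x g) h.
Proof. by move=> _; rewrite /word_sign odd_permM; case: e. Qed.

(* The permutation character on the words of content b, twisted by the sign
   character when e holds: the Frobenius preimage of h_b, respectively e_b. *)
Definition word_char N (e : bool) (b : ivec N) : 'CF([set: 'S_m]) :=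
  signed_char (@word_act1 N) (@word_actM N) (@word_domD N b) (@word_signM N e b).

Lemma word_char_char N e (b : ivec N) : word_char e b \is a character.
Proof. exact: signed_char_char. Qed.

Local Notation mat N M := {ffun 'I_M -> {ffun 'I_N -> 'I_m.+1}}.

(** The contingency table of two words, a complete invariant of the pair under simultaneous
    permutation of the positions. A cell never exceeds [m], so [inord] loses nothing. *)
Definition word_mat N M (x : word N) (y : word M) : mat N M :=
  [ffun j => [ffun i => inord #|[pred p | (x p == i) && (y p == j)]|]].

Lemma word_matE N M (x : word N) (y : word M) j i :
  word_mat x y j i = #|[pred p | (x p == i) && (y p == j)]| :> nat.
Proof.
rewrite !ffunE inordK // ltnS -[X in (_ <= X)%N]card_ord.
by apply: max_card.
Qed.

Definition mats N M (b : ivec N) (c : ivec M) : {set mat N M} :=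
  [set A : mat N M | (\sum_j imul (A j) == b) && [forall j, (itot (A j))%:Z == c j]].

Definition zero_one N M (A : mat N M) := [forall j, forall i, (A j i <= 1)%N].

Lemma word_mat_realized N M (b : ivec N) (c : ivec M) (A : mat N M) : \sum_i b i = m%:Z ->
  [exists x, exists y, [&& word_dom b x, word_dom c y & word_mat x y == A]] = (A \in mats b c).
Proof.
move=> bm; rewrite inE; apply/existsP/andP.
  case=> x /existsP[y /and3P[/forallP bx /forallP cy /eqP <-]]; split.
    apply/eqP/ffunP => i; rewrite sum_ffunE -(eqP (bx i)) /content.
    rewrite -(sum_card_fiber _ y) -natz natr_sum; apply: eq_bigr => j _.
    by rewrite ffunE word_matE natz.
  apply/forallP => j; rewrite -(eqP (cy j)) /content -(sum_card_fiber _ x) eqz_nat; apply/eqP.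
  by apply: eq_bigr => i _; rewrite word_matE; apply: eq_card => p; rewrite !inE andbC.
case=> /eqP Ab /forallP Ac.
have tot : (\sum_(e : 'I_N * 'I_M) A e.2 e.1 = m)%N.
  apply/eqP; rewrite -eqz_nat -bm -Ab -natz natr_sum; apply/eqP.
  rewrite -(pair_bigA _ (fun i j => (A j i)%:R)) /=; apply: eq_bigr => i _.
  by rewrite sum_ffunE; apply: eq_bigr => j _; rewrite ffunE natz.
have [u uE] := word_exists tot.
exists [ffun p => (u p).1]; apply/existsP; exists [ffun p => (u p).2].
have cE i j : #|[pred p | ([ffun p => (u p).1] p == i) && ([ffun p => (u p).2] p == j)]| = A j i.
  by rewrite -(uE (i, j)); apply: eq_card => p; rewrite !inE !ffunE -pair_eqE.
apply/and3P; split.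
- apply/forallP => i; rewrite /content -(sum_card_fiber _ (fun p => (u p).2)) -Ab sum_ffunE -natz natr_sum.
  apply/eqP; apply: eq_bigr => j _; rewrite ffunE -cE natz; congr Posz.
  by apply: eq_card => p; rewrite !inE !ffunE.
- apply/forallP => j; rewrite -(eqP (Ac j)) eqz_nat /content -(sum_card_fiber _ (fun p => (u p).1)); apply/eqP.
  by apply: eq_bigr => i _; rewrite -cE; apply: eq_card => p; rewrite !inE !ffunE andbC.
- by apply/eqP/ffunP => j; apply/ffunP => i; apply: ord_inj; rewrite word_matE cE.
Qed.

(** The stabiliser of a pair of words permutes positions within the cells of its table. When exactly
    one word is twisted, the sign of a permutation must be trivial on it, so only tables with cells
    at most 1 survive. *)
Lemma cfdot_word_char N M e e' (b : ivec N) (c : ivec M) : \sum_i b i = m%:Z ->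
  '[word_char e b, word_char e' c] =
  #|[set A in mats b c | (e == e') || zero_one A]|%:R.
Proof.
move=> bm; rewrite /word_char (@cfdot_signed_char _ _ _ _ _ _ _ _ _ _ _ _ _ _ _ _ _ _ (@word_mat N M) (fun A => (e == e') || zero_one A)).
- congr _%:R; apply: eq_card => A; rewrite !inE word_mat_realized //.
  by rewrite inE andbC.
- move=> x y x' y' _ _ _ _; split=> [E|[g [-> ->]]].
    have [|g gE] := @word_perm m _ (fun p => (x p, y p)) (fun p => (x' p, y' p)).
      case=> i j; have := word_matE x y j i; rewrite E word_matE => E'.
      by symmetry; apply: etrans E'; apply: eq_card => p; rewrite !inE -pair_eqE.
    by exists g; split; apply: word_act_eq => p; case: (gE p).
  apply/ffunP => j; apply/ffunP => i; apply: ord_inj; rewrite !word_matE.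
  rewrite -!sum1_card [RHS](reindex_inj (@perm_inj _ g)) /=.
  by apply: eq_bigl => p; rewrite !inE !word_actE.
- move=> x y _ _ /orP[/eqP -> //|/forallP zo] g gx gy.
  have -> : g = 1%g; last by rewrite /word_sign odd_perm1 !andbF.
  apply/permP => p; rewrite perm1; apply/eqP; apply/negP => /negP ne.
  move/forallP/(_ (x p)): (zo (y p)); rewrite word_matE leqNgt; apply/negP/negPn.
  apply/card_gt1P; exists (g p), p; rewrite !inE !eqxx; split => //.
  have -> : x (g p) = x p by rewrite -{1}gx word_actE.
  have -> : y (g p) = y p by rewrite -{1}gy word_actE.
  by rewrite !eqxx.
- move=> x y _ _; rewrite negb_or => /andP[ee]; rewrite /zero_one negb_forall => /existsP[j].
  rewrite negb_forall => /existsP[i]; rewrite -ltnNge word_matE => /card_gt1P[p [q [hp hq pq]]].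
  move: hp hq; rewrite !inE => /andP[/eqP xp /eqP yp] /andP[/eqP xq /eqP yq].
  exists (tperm p q); split.
  + by apply/ffunP => r; rewrite ffunE tpermV; case: tpermP => [->|->|] //; rewrite xp xq.
  + by apply/ffunP => r; rewrite ffunE tpermV; case: tpermP => [->|->|] //; rewrite yp yq.
  + by rewrite /word_sign odd_tperm pq !andbT.
Qed.

End Words.

(** * Kostka numbers and horizontal strips *)

Definition decreasing n (l : ivec n) := forall i i' : 'I_n, (i < i')%N -> l i' < l i.

Section Kostka.
Variables (m N' : nat).
Local Notation N := N'.+1.
Local Notation col := {ffun 'I_N -> 'I_m.+1}.

(** The matrices of [mats], with row sums indexed by [nat] so that the last row can be split off
    without changing [c]. *)
Definition kost K (b : ivec N) (c : nat -> int) : int :=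
  \sum_(A : {ffun 'I_K -> col} | (\sum_j imul (A j) == b) && [forall j : 'I_K, (itot (A j))%:Z == c j]) 1.

Lemma kost0 b c : kost 0 b c = (b == 0)%:R.
Proof.
pose A0 : {ffun 'I_0 -> col} := [ffun i => [ffun=> ord0]].
have E (A : {ffun 'I_0 -> col}) : A = A0 by apply/ffunP => -[].
rewrite /kost big_mkcond (big_pred1 A0) => [|A]; last by rewrite (E A) /= eqxx.
rewrite big_ord0 eq_sym (_ : [forall j, _]) ?andbT; last by apply/forallP => -[].
by case: (b == 0).
Qed.

Lemma kost_recl K b c :
  kost K.+1 b c = \sum_(ga : col | (itot ga)%:Z == c K) kost K (b - imul ga) c.
Proof.
pose snoc (z : col * {ffun 'I_K -> col}) : {ffun 'I_K.+1 -> col} :=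
  [ffun j => if unlift ord_max j is Some j' then z.2 j' else z.1].
have sm z : snoc z ord_max = z.1 by rewrite ffunE unlift_none.
have sl z j : snoc z (lift ord_max j) = z.2 j by rewrite ffunE liftK.
rewrite /kost pair_big_dep /= (reindex snoc) /=; last first.
  exists (fun A => (A ord_max, [ffun j => A (lift ord_max j)])) => [[ga A] _|A _].
    by rewrite sm; congr (_, _); apply/ffunP => j; rewrite ffunE sl.
  apply/ffunP => j; case: (unliftP ord_max j) => [j'|] ->; first by rewrite sl ffunE.
  by rewrite sm.
apply: eq_bigl => z; rewrite (bigD1_ord ord_max) //= sm.
under eq_bigr => j _ do rewrite sl.
have -> : (imul z.1 + \sum_(j < K) imul (z.2 j) == b) = (\sum_(j < K) imul (z.2 j) == b - imul z.1).
  by rewrite [RHS]eq_sym subr_eq eq_sym addrC.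
rewrite andbCA; congr (_ && _).
apply/forallP/andP => [H|[H1 /forallP H2] j].
  split; first by have := H ord_max; rewrite sm.
  by apply/forallP => j; have := H (lift ord_max j); rewrite sl lift_max.
by case: (unliftP ord_max j) => [j'|] ->; rewrite ?sl ?sm ?lift_max.
Qed.

Lemma kost_perm K b c (s : 'S_N) : kost K (fperm b s) c = kost K b c.
Proof.
pose h (A : {ffun 'I_K -> col}) : {ffun 'I_K -> col} := [ffun j => [ffun i => A j (s i)]].
have hi : injective h.
  move=> A A' /ffunP H; apply/ffunP => j; apply/ffunP => i; move/ffunP/(_ ((s^-1)%g i)): (H j).
  by rewrite !ffunE permKV.
rewrite /kost [LHS](reindex_inj hi) /=; apply: eq_bigl => A; congr (_ && _).
  have E j : imul (h A j) = fperm (imul (A j)) s by apply/ffunP => i; rewrite !ffunE.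
  under eq_bigr => j _ do rewrite E.
  have -> : \sum_(j < K) fperm (imul (A j)) s = fperm (\sum_(j < K) imul (A j)) s.
    by apply/ffunP => i; rewrite sum_ffunE !ffunE sum_ffunE; apply: eq_bigr => j _; rewrite !ffunE.
  apply/eqP/eqP => [/ffunP H|-> //]; apply/ffunP => i; move: (H ((s^-1)%g i)).
  by rewrite ffunE [RHS]ffunE permKV.
apply: eq_forallb => j; congr (_%:Z == _).
rewrite /itot [RHS](reindex_inj (@perm_inj _ s)) /=.
by apply: eq_bigr => i _; rewrite !ffunE.
Qed.

(** When [l - idelta N] is a partition and the row sums are at most [m], this is the Kostka number
    of that shape and content [c]. *)
Definition alt_kost K (l : ivec N) (c : nat -> int) : int :=
  \sum_(s : 'S_N) (-1) ^+ s * kost K (fperm l s - idelta N) c.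

Lemma alt_kostE K l c :
  alt_kost K l c = \sum_(s : 'S_N) (-1) ^+ s * kost K (l - fperm (idelta N) s) c.
Proof.
rewrite /alt_kost (reindex_inj invg_inj) /=; apply: eq_bigr => s _.
rewrite odd_permV -(kost_perm _ _ _ s) fpermB fperm_comp.
by rewrite mulgV fperm1.
Qed.

Lemma alt_kost_tperm K l c i j : i != j ->
  alt_kost K (fperm l (tperm i j)) c = - alt_kost K l c.
Proof.
move=> ij; rewrite /alt_kost -sumrN (reindex_inj (@mulIg _ (tperm i j))) /=.
apply: eq_bigr => s _; rewrite odd_permM odd_tperm ij addbT -mulNr.
rewrite fperm_comp -mulgA tperm2 mulg1; congr (_ * _).
by case: (odd_perm s).
Qed.

Lemma alt_kost_recl K l c :
  alt_kost K.+1 l c = \sum_(ga : col | (itot ga)%:Z == c K) alt_kost K (l - imul ga) c.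
Proof.
rewrite /alt_kost exchange_big /=; apply: eq_bigr => s _.
rewrite kost_recl mulr_sumr.
have hi : injective (fun ga : col => [ffun i => ga (s i)] : col).
  move=> ga ga' /ffunP H; apply/ffunP => i; move: (H ((s^-1)%g i)).
  by rewrite !ffunE permKV.
rewrite [LHS](reindex_inj hi) /=; apply: eq_big => ga.
  congr (_%:Z == _); rewrite /itot [RHS](reindex_inj (@perm_inj _ s)) /=.
  by apply: eq_bigr => i _; rewrite ffunE.
move=> _; congr (_ * kost _ _ _); apply/ffunP => i; rewrite !ffunE; ring.
Qed.

Definition strip (t : nat) (l : ivec N) (ga : col) :=
  [forall i : 'I_N, forall i' : 'I_N, ((i < t)%N && (i' == i.+1 :> nat)) ==> (l i' < l i - (ga i : nat)%:Z)].

(* Where the strip condition fails at t, exchanging the coordinates t and t + 1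
   of l - imul ga reverses the sign. *)
Lemma strip_step K (l : ivec N) (c : nat -> int) t :
  (t < N')%N -> decreasing l -> c K <= m%:Z ->
  \sum_(ga : col | ((itot ga)%:Z == c K) && strip t l ga) alt_kost K (l - imul ga) c =
  \sum_(ga : col | ((itot ga)%:Z == c K) && strip t.+1 l ga) alt_kost K (l - imul ga) c.
Proof.
move=> tN dec cK; have x1 : (t < N)%N by lia.
have y1 : (t.+1 < N)%N by lia.
pose x := Ordinal x1; pose y := Ordinal y1.
have xy : x != y by rewrite -val_eqE /= ltn_eqF.
have lxy : l y < l x by apply: dec.
pose L := `|l x - l y|%N.
have LE : l x = l y + L%:Z by rewrite /L; lia.
(* Carrying the amount [L] between the entries at [x] and [y] exchanges these two coordinates of
   [l - imul ga]; the bound on [c K] keeps the entries in range. *)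
pose h (ga : col) : col := set_at (set_at ga x (L + ga y)) y (ga x - L)%N.
rewrite (bigID (fun ga : col => l y < l x - (ga x : nat)%:Z)) /= [X in _ + X](sum_involution (h := h)) ?addr0.
  apply: eq_bigl => ga; rewrite -andbA; congr (_ && _).
  apply/andP/forallP => [[/forallP H hx] i|H].
    apply/forallP => i'; apply/implyP => /andP[]; rewrite ltnS leq_eqVlt => /orP[/eqP it|it] i'E.
      have -> : i = x by apply: ord_inj.
      by have -> : i' = y by apply: ord_inj; rewrite (eqP i'E) it.
    by move/forallP/(_ i')/implyP: (H i); apply; rewrite it.
  split; last by move/forallP/(_ y)/implyP: (H x); apply; rewrite /= ltnSn eqxx.
  apply/forallP => i; apply/forallP => i'; apply/implyP => /andP[it i'E].
  by move/forallP/(_ i')/implyP: (H i); apply; rewrite i'E ltnS ltnW.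
have key (ga : col) : (itot ga)%:Z = c K -> (L <= ga x)%N ->
   (forall j, h ga j = (if j == y then ga x - L else if j == x then L + ga y else ga j)%N :> nat)
   /\ itot (h ga) = itot ga.
  move=> gc Lx; have g2 := leq_itot2 ga xy.
  have gm : (itot ga <= m)%N by move: cK; rewrite -gc lez_nat.
  have v1 : (L + ga y < m.+1)%N by lia.
  have v2 : (ga x - L < m.+1)%N by have := ltn_ord (ga x); lia.
  split=> [j|]; first by rewrite /h set_atE // set_atE.
  have := itot_set_at (set_at ga x (L + ga y)) y v2.
  have := itot_set_at ga x v1.
  by rewrite set_atE // eq_sym (negbTE xy) /= -/(h ga); lia.
move=> ga /andP[/andP[/eqP gc /forallP H]]; rewrite -leNgt LE => bad.
have Lx : (L <= ga x)%N. by move: bad; rewrite -lez_nat; move: (l y) => u; lra.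
have [hE ht] := key ga gc Lx.
split.
- rewrite ht gc eqxx /= -leNgt hE (negbTE xy) eqxx; apply/andP; split; last by lia.
  apply/forallP => i; apply/forallP => i'; apply/implyP => /andP[it i'E]; rewrite hE.
  have ix : i != x by rewrite -val_eqE /= ltn_eqF.
  have iy : i != y by rewrite -val_eqE /= ltn_eqF // ltnW.
  by rewrite (negbTE ix) (negbTE iy); move/forallP/(_ i')/implyP: (H i); apply; rewrite it i'E.
- have Lx' : (L <= h ga x)%N by rewrite hE (negbTE xy) eqxx leq_addr.
  have [hE' _] := key (h ga) (etrans (congr1 Posz ht) gc) Lx'.
  apply/ffunP => j; apply: ord_inj; rewrite hE' !hE !eqxx (negbTE xy).
  case: (eqVneq j y) => [->|jy]; first by rewrite ?eqxx ?addKn.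
  case: (eqVneq j x) => [->|jx] /=; last by rewrite ?(negbTE jy) ?(negbTE jx).
  by rewrite subnKC.
- rewrite -(alt_kost_tperm _ _ _ xy); congr alt_kost; apply/ffunP => j.
  have vE (f : col) i : (l - imul f) i = l i - (f i : nat)%:Z by rewrite !ffunE.
  rewrite vE [RHS]ffunE vE hE; case: tpermP => [->|->|/eqP/negbTE jx /eqP/negbTE jy].
  + by rewrite (negbTE xy) eqxx LE; lia.
  + by rewrite eqxx LE; lia.
  + by rewrite jx jy.
Qed.

Definition full_strip (l : ivec N) (ga : col) :=
  [forall i : 'I_N, forall i' : 'I_N, (i < i')%N ==> (l i' < l i - (ga i : nat)%:Z)].

(** The branching rule of semistandard tableaux: the cells of the last letter form a horizontal
    strip. In shifted coordinates, each diminished coordinate must stay above the next original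
    one. *)
Lemma alt_kost_strip K (l : ivec N) (c : nat -> int) :
  decreasing l -> c K <= m%:Z ->
  alt_kost K.+1 l c =
  \sum_(ga : col | ((itot ga)%:Z == c K) && full_strip l ga) alt_kost K (l - imul ga) c.
Proof.
move=> dec cK; rewrite alt_kost_recl.
have step t : (t <= N')%N ->
  \sum_(ga : col | ((itot ga)%:Z == c K) && strip 0 l ga) alt_kost K (l - imul ga) c =
  \sum_(ga : col | ((itot ga)%:Z == c K) && strip t l ga) alt_kost K (l - imul ga) c.
  by elim: t => // t IH tN; rewrite (IH (ltnW tN)); apply: strip_step.
rewrite (eq_bigl (fun ga : col => ((itot ga)%:Z == c K) && strip 0 l ga)) => [|ga]; last first.
  by rewrite (_ : strip 0 l ga) ?andbT //; apply/forallP => i; apply/forallP.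
rewrite (step N') //; apply: eq_bigl => ga; congr (_ && _).
apply/forallP/forallP => H i; apply/forallP => i'; apply/implyP.
  move=> ii'; have lt : (i.+1 < N)%N by apply: leq_ltn_trans (ltn_ord i').
  have {H}H : l (Ordinal lt) < l i - (ga i : nat)%:Z.
    by move/forallP/(_ (Ordinal lt))/implyP: (H i); apply; rewrite /= eqxx andbT.
  apply: le_lt_trans H; case: (eqVneq (Ordinal lt) i') => [->//|ne].
  by apply/ltW/dec; rewrite ltn_neqAle ii' andbT.
case/andP => _ /eqP i'E.
by move/forallP/(_ i')/implyP: (H i); apply; rewrite i'E.
Qed.

End Kostka.

Lemma perm_ge_eq1 N (s : 'S_N) : (forall i : 'I_N, (i <= s i)%N) -> s = 1%g.
Proof.
move=> H; have E : (\sum_i (s i - i) = 0)%N.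
  rewrite sumnB //; apply/eqP; rewrite subn_eq0.
  by rewrite [X in (_ <= X)%N](reindex_inj (@perm_inj _ s)).
apply/permP => i; rewrite perm1; apply: ord_inj; apply/eqP; rewrite eqn_leq H andbT -subn_eq0.
by rewrite -leqn0 -E (bigD1 i) //= leq_addr.
Qed.

Lemma perm_increasing N (s : 'S_N) : (forall i j : 'I_N, (i < j)%N -> (s i < s j)%N) -> s = 1%g.
Proof.
move=> H; apply: perm_ge_eq1 => -[i lt]; elim: i lt => // i IH lt.
by apply: leq_ltn_trans (IH (ltnW lt)) _; apply: H.
Qed.

Lemma perm_sum_le N (s : 'S_N) :
  (forall p, (p <= N)%N -> (\sum_(i : 'I_N | i < p) s i <= \sum_(i : 'I_N | i < p) i)%N) -> s = 1%g.
Proof.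
move=> H; have fixs : forall p (i : 'I_N), (i < p)%N -> s i = i.
  elim=> // p IH i; rewrite ltnS leq_eqVlt => /orP[/eqP ip|/IH //].
  have split_lt (f : 'I_N -> nat) : (\sum_(j : 'I_N | j < p.+1) f j = f i + \sum_(j : 'I_N | j < p) f j)%N.
    rewrite (bigD1 i) ?ip //=; congr (_ + _)%N; apply: eq_bigl => j.
    by rewrite -val_eqE /= ip; lia.
  have := H p.+1 _; rewrite -{1}ip ltn_ord !split_lt => /(_ isT).
  rewrite [X in (_ + X <= _)%N](eq_bigr (fun j : 'I_N => j : nat)) => [|j /IH -> //].
  rewrite leq_add2r => si; apply: ord_inj; apply/eqP; rewrite eqn_leq si leqNgt; apply/negP => lt.
  have /perm_inj E : s (s i) = s i by apply: IH; rewrite -ip.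
  by rewrite E ltnn in lt.
by apply/permP => i; rewrite perm1 (fixs N).
Qed.

(** Delta strictly dominates its other rearrangements, which is the source of unitriangularity. *)
Lemma perm_idelta_le N (s : 'S_N) :
  (forall p, (p <= N)%N -> \sum_(i : 'I_N | (i < p)%N) idelta N i <= \sum_(i : 'I_N | (i < p)%N) idelta N (s i)) ->
  s = 1%g.
Proof.
move=> H; apply: perm_sum_le => p pN; have := H p pN.
have E (f : 'I_N -> 'I_N) : \sum_(i : 'I_N | (i < p)%N) idelta N (f i) =
    \sum_(i : 'I_N | (i < p)%N) (N%:Z - 1) - (\sum_(i : 'I_N | (i < p)%N) f i)%N%:Z.
  rewrite -[X in _ - X]natz natr_sum -sumrB; apply: eq_bigr => i _; rewrite ffunE.
  by have := ltn_ord (f i); lia.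
by rewrite (E id) (E s) lerD2l lerN2 lez_nat.
Qed.

(** * Unitriangularity of Kostka numbers for the dominance order *)

Section KostkaDominance.
Variables (m N' : nat).
Local Notation N := N'.+1.
Local Notation col := {ffun 'I_N -> 'I_m.+1}.
Implicit Types (l : ivec N) (c : nat -> int).

Lemma idelta_decreasing n : decreasing (idelta n).
Proof. by move=> i i' ii'; rewrite !ffunE ltz_nat; have := ltn_ord i'; lia. Qed.

Lemma alt_kost0 l c : decreasing l -> alt_kost m 0 l c = (l == idelta N)%:R.
Proof.
move=> dec; rewrite /alt_kost (bigD1 1%g) //= odd_perm1 expr0 mul1r fperm1 kost0 subr_eq0.
rewrite big1 ?addr0 // => s s1; rewrite kost0 subr_eq0.
case: eqP => [/ffunP E|_]; last by rewrite mulr0.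
case/eqP: s1; apply: perm_increasing => i j ij.
have := idelta_decreasing ij; rewrite -!E !ffunE.
case: (ltngtP (s i) (s j)) => // [/dec lt|/ord_inj ->]; last by rewrite ltxx.
by move=> lt'; have := lt_trans lt lt'; rewrite ltxx.
Qed.

Lemma full_strip_decreasing l (ga : col) : full_strip l ga -> decreasing (l - imul ga).
Proof.
move=> /forallP H i i' ii'; move/forallP/(_ i')/implyP/(_ ii'): (H i).
by rewrite !ffunE => lt; apply: le_lt_trans lt; rewrite gerBl.
Qed.

(** The first [p] strips lie in the first [p] rows; hence the dominance inequalities and the
    emptiness of the rows from [K] on. *)
Lemma alt_kost_dominance K l c : decreasing l -> (forall j, c j <= m%:Z) -> alt_kost m K l c != 0 ->
  [/\ forall i, idelta N i <= l i,
      forall i : 'I_N, (K <= i)%N -> l i = idelta N i,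
      \sum_i (l i - idelta N i) = \sum_(j < K) c j &
      forall p, (p <= K)%N ->
        \sum_(j < p) c j <= \sum_(i : 'I_N | (i < p)%N) (l i - idelta N i)].
Proof.
move=> + cm; elim: K l => [|K IH] l dec.
  rewrite alt_kost0 //; case: (l =P idelta N) => [-> _|_]; last by rewrite eqxx.
  split => //.
    by rewrite big_ord0 big1 // => i _; rewrite subrr.
  by move=> p; rewrite leqn0 => /eqP ->; rewrite big_ord0 big_pred0.
rewrite alt_kost_strip // => nz.
have [ga /andP[/andP[/eqP gc gs] ganz]] : exists ga : col,
    ((itot ga)%:Z == c K) && full_strip l ga && (alt_kost m K (l - imul ga) c != 0).
  apply/existsP; apply: contraNT nz; rewrite negb_exists => /forallP H.
  by rewrite big1 // => ga gaP; apply/eqP; have := H ga; rewrite gaP /= negbK.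
have [H1 H2 H3 H4] := IH _ (full_strip_decreasing gs) ganz.
have vE i : (l - imul ga) i = l i - (ga i : nat)%:Z by rewrite !ffunE.
have ge i : idelta N i <= l i by have := H1 i; rewrite vE; lia.
have tail (i : 'I_N) : (K.+1 <= i)%N -> l i = idelta N i.
  move=> Ki; apply/eqP; rewrite eq_le ge andbT.
  have lt : (i.-1 < N)%N by have := ltn_ord i; lia.
  have pi : (i.-1 < i)%N by lia.
  move/forallP/(_ (Ordinal lt))/forallP/(_ i)/implyP/(_ pi): gs; rewrite -vE H2 /=; last by lia.
  by rewrite !ffunE /=; have := ltn_ord i; lia.
have tot : \sum_i (l i - idelta N i) = \sum_(j < K.+1) c j.
  rewrite [RHS]big_ord_recr /= -H3 -gc -[X in _ = _ + X]natz natr_sum -big_split /=.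
  by apply: eq_bigr => i _; rewrite vE natz; lia.
split=> // p; rewrite leq_eqVlt => /orP[/eqP ->|pK].
  rewrite -tot (bigID (fun i : 'I_N => (i < K.+1)%N)) /= [X in _ + X]big1 ?addr0 // => i.
  by rewrite -leqNgt => /tail ->; rewrite subrr.
apply: le_trans (H4 p pK) _; apply: ler_sum => i _; rewrite vE; lia.
Qed.

(** The last strip has to empty the last row, and its size allows nothing else, so one term survives
    at each stage. *)
Lemma alt_kost_shape K l c : decreasing l -> (forall j, c j <= m%:Z) -> (K <= N)%N ->
  (forall i, idelta N i <= l i) -> (forall i : 'I_N, (K <= i)%N -> l i = idelta N i) ->
  (forall i : 'I_N, (i < K)%N -> c i = l i - idelta N i) ->
  alt_kost m K l c = 1.
Proof.
move=> + cm; elim: K l => [|K IH] l dec KN ge tail head.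
  rewrite alt_kost0 // (_ : l = idelta N) ?eqxx //.
  by apply/ffunP => i; apply: tail.
rewrite alt_kost_strip //; pose x := Ordinal KN.
have cx : c K = l x - idelta N x by rewrite -head.
have ltK : (`|c K| < m.+1)%N by have := cm K; have := ge x; lia.
pose g0 : col := [ffun i => if i == x then Ordinal ltK else ord0].
have g0E i : g0 i = (if i == x then `|c K|%N else 0%N) :> nat by rewrite ffunE; case: ifP.
have cK0 : `|c K|%:Z = c K by have := ge x; lia.
have tot0 : itot g0 = `|c K|%N.
  by rewrite /itot (bigD1 x) //= big1 ?addn0 => [|i /negbTE ix]; rewrite g0E ?eqxx ?ix.
have vE (ga : col) i : (l - imul ga) i = l i - (ga i : nat)%:Z by rewrite !ffunE.
have s0 : full_strip l g0.
  apply/forallP => i; apply/forallP => i'; apply/implyP => ii'; rewrite g0E.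
  case: eqP => [E|_]; last by rewrite subr0 dec.
  rewrite tail ?cK0 ?cx; last by rewrite E in ii'.
  by rewrite E opprB addrC subrK; rewrite E in ii'; apply: idelta_decreasing.
have dec0 := full_strip_decreasing s0.
rewrite (bigD1 g0) /=; last by rewrite tot0 cK0 eqxx.
rewrite big1 ?addr0.
  apply: IH => //; first exact: ltnW.
  - move=> i; rewrite vE g0E; case: eqP => [->|_]; last by rewrite subr0.
    by rewrite cK0 cx; lia.
  - move=> i; rewrite vE g0E leq_eqVlt; case: (i =P x) => [->|ne].
      by rewrite cK0 cx; lia.
    by case/orP => [/eqP Ki|/tail ->]; [case: ne; apply: ord_inj|rewrite subr0].
  - move=> i iK; rewrite vE g0E (_ : (i == x) = false) ?subr0 ?head //; first by lia.
    by rewrite -val_eqE /= ltn_eqF.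
move=> ga /andP[/andP[/eqP gc gs] ne]; apply/eqP; apply: contraNT ne => nz.
have [_ /(_ x (leqnn _)) E _ _] := alt_kost_dominance (full_strip_decreasing gs) cm nz.
have gx : ga x = `|c K|%N :> nat by move: E; rewrite vE; lia.
apply/eqP/ffunP => i; apply: ord_inj; rewrite g0E; case: eqP => [->//|/eqP ix].
have tg : itot ga = `|c K|%N by lia.
by have := leq_itot2 ga ix; rewrite tg gx -[X in (_ <= X)%N]add0n leq_add2r leqn0 => /eqP.
Qed.

End KostkaDominance.

(** * Irreducible characters of the symmetric group *)

Section Irreducible.
Variables (m N' : nat).
Local Notation N := N'.+1.

(* The Jacobi-Trudi determinant, in shifted coordinates. *)
Definition jacobi_char (e : bool) (l : ivec N) : 'CF([set: 'S_m]) :=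
  \sum_(s : 'S_N) (-1) ^+ s *: word_char m e (l - fperm (idelta N) s).

Definition ext n (c : ivec n) (j : nat) : int := if insub j is Some i then c i else 0.

Lemma extE n (c : ivec n) (i : 'I_n) : ext c i = c i.
Proof. by rewrite /ext valK. Qed.

Lemma kostE (b c : ivec N) : kost m N b (ext c) = #|mats m b c|%:Z.
Proof.
rewrite /kost -sum1_card -natz natr_sum; apply: eq_bigl => A; rewrite inE.
by congr (_ && _); apply: eq_forallb => j; rewrite extE.
Qed.

Lemma kost_neg K (b : ivec N) (c : nat -> int) j : (j < K)%N -> c j < 0 -> kost m K b c = 0.
Proof.
move=> jK cj; rewrite /kost big_pred0 // => A; apply/negP => /andP[_ /forallP/(_ (Ordinal jK))] /=.
by move/eqP => E; rewrite -E in cj.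
Qed.

Variable l : ivec N.
Hypothesis ldec : decreasing l.
Hypothesis lge : forall i, idelta N i <= l i.
Hypothesis lsum : \sum_i (l i - idelta N i) = m%:Z.

Lemma jacobi_shift_sum (s : 'S_N) : \sum_i (l - fperm (idelta N) s) i = m%:Z.
Proof.
transitivity (\sum_i (l i - idelta N (s i))); first by apply: eq_bigr => i _; rewrite !ffunE.
by rewrite -lsum !sumrB; congr (_ - _); rewrite [RHS](reindex_inj (@perm_inj _ s)).
Qed.

Lemma ext_le (c : ivec N) : (forall i, 0 <= c i) -> \sum_i c i = m%:Z -> forall j, ext c j <= m%:Z.
Proof.
move=> c0 cm j; rewrite /ext; case: insub => // i.
by rewrite -cm (bigD1 i) //= lerDl sumr_ge0.
Qed.

Lemma cfdot_jacobi_char e (c : ivec N) :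
  '[jacobi_char e l, word_char m e c] = (alt_kost m N l (ext c))%:~R.
Proof.
rewrite /jacobi_char cfdot_suml alt_kostE rmorph_sum; apply: eq_bigr => s _.
rewrite cfdotZl cfdot_word_char ?jacobi_shift_sum // rmorphM rmorph_sign /= kostE eqxx /=.
by congr (_ * _%:R); apply: eq_card => A; rewrite !inE andbT.
Qed.

Lemma cfdot_jacobi_shape e : '[jacobi_char e l, word_char m e (l - idelta N)] = 1.
Proof.
have cE i : (l - idelta N) i = l i - idelta N i by rewrite !ffunE.
rewrite cfdot_jacobi_char alt_kost_shape ?rmorph1 //.
- by apply: ext_le => [i|]; [rewrite cE subr_ge0|rewrite -lsum; apply: eq_bigr].
- by move=> i; rewrite leqNgt ltn_ord.
- by move=> i _; rewrite extE cE.
Qed.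

(** A virtual character of norm 1 is irreducible up to sign; its inner product 1 with a genuine
    character excludes the minus sign. *)
Lemma jacobi_char_irr e : exists i, jacobi_char e l = 'chi_i.
Proof.
have vc : jacobi_char e l \in 'Z[irr [set: 'S_m]]%g.
  rewrite rpred_sum // => s _; rewrite rpredZsign.
  exact/char_vchar/word_char_char.
have n1 : '[jacobi_char e l] = 1.
  rewrite {2}/jacobi_char cfdot_sumr (bigD1 1%g) //= odd_perm1 expr0 scale1r.
  rewrite fperm1 cfdot_jacobi_shape big1 ?addr0 // => s s1.
  rewrite cfdotZr cfdot_jacobi_char; set c := l - _.
  suff -> : alt_kost m N l (ext c) = 0 by rewrite mulr0.
  case: (boolP [forall i, 0 <= c i]) => [/forallP c0|]; last first.
    rewrite negb_forall => /existsP[i ci]; rewrite /alt_kost big1 // => t _.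
    by rewrite (@kost_neg _ _ _ i) ?mulr0 // extE ltNge.
  (* A nonzero Kostka number means that the shape dominates the content, which for this content
     forces [s] to be 1. *)
  apply/eqP; apply: contraNT s1 => nz; apply/eqP.
  have [_ _ _ H] := alt_kost_dominance ldec (ext_le c0 (jacobi_shift_sum s)) nz.
  apply: perm_idelta_le => p pN; have := H p pN.
  have -> : \sum_(j < p) ext c j = \sum_(i : 'I_N | (i < p)%N) (l i - idelta N (s i)).
    rewrite (big_ord_widen N (fun j => ext c j) pN); apply: eq_bigr => i _.
    by rewrite extE !ffunE.
  by rewrite !sumrB lerD2l lerN2.
have [b [i E]] := vchar_norm1P vc n1.
exists i; case: b E => E; last by rewrite E scale1r.
have := cfdot_jacobi_shape e; rewrite E cfdotZl expr1 mulN1r => /eqP H.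
have : 0 <= '['chi_i, word_char m e (l - idelta N)].
  exact/natr_ge0/Cnat_cfdot_char/word_char_char/irr_char.
by rewrite -[X in 0 <= X]opprK (eqP H) oppr_ge0 ler10.
Qed.

End Irreducible.

(** * Conjugate partitions *)

Lemma sum_lt_ord N p : (p <= N)%N -> (\sum_(i < N) (i < p) = p)%N.
Proof.
move=> pN; rewrite -big_mkcond /= -(big_ord_widen N (fun _ => 1%N) pN).
by rewrite sum1_card card_ord.
Qed.

Definition nvec n (la : 'I_n -> nat) : ivec n := [ffun i => (la i)%:Z].

Section GaleRyser.
Variables (m N' M' : nat).
Local Notation N := N'.+1.
Local Notation M := M'.+1.
Variables (la : 'I_N -> nat) (la' : 'I_M -> nat).
Hypothesis laM : forall i, (la i <= M)%N.
Hypothesis laN : forall j, (la' j <= N)%N.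
Hypothesis dual : forall (i : 'I_N) (j : 'I_M), (j < la i)%N = (i < la' j)%N.
Hypothesis lasum : (\sum_i la i = m)%N.

Local Notation mat := {ffun 'I_M -> {ffun 'I_N -> 'I_m.+1}}.

Lemma dual_decreasing : decreasing (nvec la + idelta N).
Proof.
move=> i i' ii'; have : (la i' <= la i)%N.
  rewrite leqNgt; apply/negP => lt.
  have jM : (la i < M)%N by apply: leq_trans (laM i').
  have := dual i (Ordinal jM); rewrite /= ltnn => /esym/negbT/negP; apply.
  by apply: ltn_trans ii' _; rewrite -dual.
by rewrite !ffunE; have := ltn_ord i'; lia.
Qed.

Lemma zero_one_row (A : mat) p j : (forall j, itot (A j) = la' j :> nat) -> zero_one A ->
  (\sum_(i : 'I_N | i < p) A j i <= \sum_(i : 'I_N | i < p) (i < la' j))%N.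
Proof.
move=> Ac /forallP/(_ j)/forallP A1; case: (leqP p (la' j)) => pl.
  by apply: leq_sum => i ip; rewrite (leq_trans ip pl).
rewrite [X in (_ <= X)%N](_ : _ = la' j).
  by rewrite -Ac /itot [X in (_ <= X)%N](bigID (fun i : 'I_N => (i < p)%N)) leq_addr.
rewrite -[RHS](sum_lt_ord (laN j)) [RHS](bigID (fun i : 'I_N => (i < p)%N)) /= [X in (_ + X)%N]big1 ?addn0 // => i.
by rewrite -leqNgt => pi; rewrite ltnNge (leq_trans (ltnW pl) pi).
Qed.

Lemma sum_dual (i : 'I_N) : (\sum_(j < M) (i < la' j) = la i)%N.
Proof. by under eq_bigr => j _ do rewrite -dual; apply: sum_lt_ord. Qed.

Lemma mats_partial (A : mat) (b : ivec N) (c : ivec M) p : A \in mats m b c ->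
  \sum_(i : 'I_N | (i < p)%N) b i = (\sum_j \sum_(i : 'I_N | i < p) A j i)%N%:Z.
Proof.
rewrite inE => /andP[/eqP <- _]; rewrite exchange_big -natz natr_sum; apply: eq_bigr => i _.
by rewrite sum_ffunE natr_sum; apply: eq_bigr => j _; rewrite ffunE natz.
Qed.

Lemma mats_row (A : mat) b : A \in mats m b (nvec la') -> forall j, itot (A j) = la' j.
Proof. by rewrite inE => /andP[_ /forallP H] j; have := H j; rewrite ffunE => /eqP[]. Qed.

(** The easy half of the Gale-Ryser theorem: the first [p] columns contain at most [p], and at most
    [la' j], of the ones in row [j]. *)
Lemma zero_one_dominance (A : mat) b p : A \in mats m b (nvec la') -> zero_one A ->
  \sum_(i : 'I_N | (i < p)%N) b i <= \sum_(i : 'I_N | (i < p)%N) (la i)%:Z.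
Proof.
move=> Am A1; rewrite (mats_partial _ Am).
have -> : \sum_(i : 'I_N | (i < p)%N) (la i)%:Z = (\sum_j \sum_(i : 'I_N | i < p) (i < la' j))%N%:Z.
  rewrite exchange_big -[RHS]natz natr_sum; apply: eq_bigr => i _.
  by rewrite natz sum_dual.
by rewrite lez_nat leq_sum // => j _; apply: zero_one_row A1; apply: mats_row Am.
Qed.

(** The Ferrers diagram is the equality case of the dominance inequality. *)
Lemma card_zero_one : #|[set A in mats m (nvec la) (nvec la') | zero_one A]| = 1%N.
Proof.
pose A0 : mat := [ffun j => [ffun i : 'I_N => inord (i < la' j)]].
have A0E j (i : 'I_N) : A0 j i = (i < la' j)%N :> nat.
  rewrite !ffunE inordK // ltnS; case: ltnP => // H.
  rewrite -lasum (bigD1 i) //=; apply: leq_trans (leq_addr _ _).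
  by move: H; rewrite -dual => /(leq_ltn_trans (leq0n _)).
apply/eqP/cards1P; exists A0; apply/setP => A; rewrite !inE; apply/andP/eqP => [[Am A1]|->].
  have Ar := @mats_row A (nvec la); rewrite inE in Ar; have {}Ar := Ar Am.
  (* The bounds hold row by row and add up to an equality, so each of them is one. *)
  have E p j : (\sum_(i : 'I_N | i < p) A j i = \sum_(i : 'I_N | i < p) (i < la' j))%N.
    have le j' := zero_one_row p j' Ar A1.
    have tot : (\sum_j' \sum_(i : 'I_N | i < p) (i < la' j') <= \sum_j' \sum_(i : 'I_N | i < p) A j' i)%N.
      have Am' : A \in mats m (nvec la) (nvec la') by rewrite inE.
      rewrite -lez_nat -(mats_partial p Am') exchange_big -[X in X <= _]natz natr_sum.
      by apply: ler_sum => i _; rewrite ffunE natz sum_dual.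
    apply/eqP; rewrite eqn_leq le /= -subn_eq0 -leqn0.
    have S0 : (\sum_j' (\sum_(i : 'I_N | i < p) (i < la' j') - \sum_(i : 'I_N | i < p) A j' i) = 0)%N.
      by apply/eqP; rewrite sumnB ?subn_eq0 // => j' _; apply: le.
    by apply: leq_trans (eq_leq S0); rewrite [X in (_ <= X)%N](bigD1 j) //= leq_addr.
  apply/ffunP => j; apply/ffunP => i; apply: ord_inj; rewrite A0E.
  have split_lt (f : 'I_N -> nat) : (\sum_(j : 'I_N | j < i.+1) f j = f i + \sum_(j : 'I_N | j < i) f j)%N.
    rewrite (bigD1 i) //=; congr (_ + _)%N; apply: eq_bigl => k.
    by rewrite -val_eqE /=; lia.
  by have := E i.+1 j; rewrite !split_lt E => /addIn.
split; last by apply/forallP => j; apply/forallP => i; rewrite A0E; case: (i < _)%N.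
apply/andP; split.
  apply/eqP/ffunP => i; rewrite sum_ffunE !ffunE -sum_dual -[RHS]natz natr_sum.
  by apply: eq_bigr => j _; rewrite ffunE A0E natz.
apply/forallP => j; rewrite [nvec _ _]ffunE eqz_nat /itot; apply/eqP.
by under eq_bigr => i _ do rewrite A0E; apply: sum_lt_ord.
Qed.

Lemma cfdot_word_dual e : '[word_char m e (nvec la), word_char m (~~ e) (nvec la')] = 1.
Proof.
rewrite cfdot_word_char; last first.
  by rewrite -lasum -[RHS]natz natr_sum; apply: eq_bigr => i _; rewrite ffunE natz.
by rewrite (_ : (e == ~~ e) = false) ?card_zero_one //; case: e.
Qed.

Lemma shifted_sum : \sum_i ((nvec la + idelta N) i - idelta N i) = m%:Z.
Proof.
by rewrite -lasum -[RHS]natz natr_sum; apply: eq_bigr => i _; rewrite !ffunE natz; lia.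
Qed.

(** For [s] different from 1 the content is not dominated by [la], so no 0-1 matrix has these
    margins. *)
Lemma cfdot_jacobi_dual e :
  '[jacobi_char m e (nvec la + idelta N), word_char m (~~ e) (nvec la')] = 1.
Proof.
rewrite /jacobi_char cfdot_suml (bigD1 1%g) //= odd_perm1 expr0 scale1r.
rewrite fperm1 addrK cfdot_word_dual big1 ?addr0 // => s s1.
rewrite cfdotZl cfdot_word_char; last by apply: jacobi_shift_sum; apply: shifted_sum.
rewrite (_ : (e == ~~ e) = false) /=; last by case: e.
rewrite (_ : [set A in _ | _] = set0) ?cards0 ?mulr0 //; apply/setP => A; rewrite in_set0 inE.
apply: contraNF s1 => /andP[Am A1]; apply/eqP/perm_idelta_le => p _.
have := zero_one_dominance p Am A1.
have -> : \sum_(i : 'I_N | (i < p)%N) (nvec la + idelta N - fperm (idelta N) s) i =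
  \sum_(i : 'I_N | (i < p)%N) ((la i)%:Z + (idelta N i - idelta N (s i))).
  by apply: eq_bigr => i _; rewrite !ffunE; lia.
by rewrite big_split /= gerDl sumrB subr_le0.
Qed.

Lemma cfdot_jacobi_word e : '[jacobi_char m e (nvec la + idelta N), word_char m e (nvec la)] = 1.
Proof.
have := cfdot_jacobi_shape dual_decreasing _ shifted_sum e; rewrite addrK; apply.
by move=> i; rewrite !ffunE lerDr.
Qed.

Lemma jacobi_nvec_irr e : exists i, jacobi_char m e (nvec la + idelta N) = 'chi_i.
Proof.
apply: jacobi_char_irr; [exact: dual_decreasing| |exact: shifted_sum].
by move=> i; rewrite !ffunE lerDr.
Qed.

End GaleRyser.

(** * Coloured matchings *)

Definition fpf_involution m (s : 'S_m) := [forall p, (s (s p) == p) && (s p != p)].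

Section Involution.
Variables (m : nat) (s : 'S_m).
Hypothesis sP : fpf_involution s.

Lemma fpfK : involutive s.
Proof. by move=> p; have /forallP/(_ p)/andP[/eqP] := sP. Qed.

Lemma fpf_neq p : s p != p.
Proof. by have /forallP/(_ p)/andP[_] := sP. Qed.

Lemma fpf_lt p : (s p < s (s p))%N = ~~ (p < s p)%N.
Proof. by have := fpf_neq p; rewrite fpfK -val_eqE /=; lia. Qed.

(* Sums over pairs {p, s p} do not depend on the representatives. *)
Lemma transversal_sum (T : Type) (idx : T) (op : Monoid.com_law idx) (f : 'I_m -> T) (Q R R' : pred 'I_m) :
  (forall p, f (s p) = f p) -> (forall p, Q (s p) = Q p) ->
  (forall p, R (s p) = ~~ R p) -> (forall p, R' (s p) = ~~ R' p) ->
  \big[op/idx]_(p | R p && Q p) f p = \big[op/idx]_(p | R' p && Q p) f p.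
Proof.
move=> fs Qs Rs Rs'; rewrite [LHS](bigID R') [RHS](bigID R) /=; congr (op _ _).
  by apply: eq_bigl => p; rewrite andbAC [R p && _]andbC andbAC.
rewrite (reindex_inj (@perm_inj _ s)) /=; apply: eq_big => [p|p _]; last exact: fs.
by rewrite Rs Rs' Qs negbK; case: (R p) (R' p) (Q p) => [] [] [].
Qed.

Lemma card_half (Q R : pred 'I_m) : (forall p, Q (s p) = Q p) -> (forall p, R (s p) = ~~ R p) ->
  #|[pred p | Q p]| = #|[pred p | R p && Q p]|.*2.
Proof.
move=> Qs Rs; rewrite -addnn -!sum1_card (bigID R) /=; congr (_ + _)%N.
  by apply: eq_bigl => p; rewrite !inE andbC.
rewrite (reindex_inj (@perm_inj _ s)) /=; apply: eq_bigl => p.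
by rewrite !inE Rs Qs negbK andbC.
Qed.

(** [g] is the product of its restriction to the smaller letters of the pairs and of the conjugate
    of that restriction by [s]; the two have equal signs. *)
Lemma odd_perm_commute_mono (g : 'S_m) : (forall p, g (s p) = s (g p)) ->
  (forall p, (g p < s (g p))%N = (p < s p)%N) -> odd_perm g = false.
Proof.
move=> gs gR; pose f (p : 'I_m) := if (p < s p)%N then g p else p.
have fR p : (f p < s (f p))%N = (p < s p)%N.
  by rewrite /f; case: ifP => // H; rewrite gR.
have fi : injective f.
  move=> p q E; have := fR p; rewrite E fR => H; move: E; rewrite /f -H.
  by case: ifP => // _ /perm_inj.
pose h := perm fi.
have -> : g = (h * h ^ s)%g; last by rewrite odd_permM odd_permJ addbb.
have hE q : h q = f q by rewrite permE.
apply/permP => p; rewrite permM hE -[f p in RHS]fpfK permJ hE /f; case: (boolP (p < s p)%N) => H.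
  by rewrite fpf_lt gR H /= fpfK.
by rewrite fpf_lt H /= gs fpfK.
Qed.

(** Induction on the number of reversed pairs: composing with the transposition of one of them
    restores its order and changes the sign. *)
Lemma odd_perm_commute (g : 'S_m) : (forall p, g (s p) = s (g p)) ->
  odd_perm g = \big[addb/false]_(p : 'I_m | (p < s p)%N) ((p < s p)%N (+) (g p < g (s p))%N).
Proof.
have [n] := ubnP #|[pred p : 'I_m | (p < s p)%N && (g (s p) < g p)%N]|.
elim: n g => // n IH g; rewrite ltnS => le gs.
case: (pickP [pred p : 'I_m | (p < s p)%N && (g (s p) < g p)%N]) => [p /= /andP[ps gps]|no]; last first.
  have mono (p : 'I_m) : (p < s p)%N -> (g p < s (g p))%N.
    move=> ps; have := no p; rewrite /= ps -gs ltnNge => /negbFE.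
    rewrite leq_eqVlt => /orP[/eqP/ord_inj/perm_inj E|//].
    by have := fpf_neq p; rewrite -E eqxx.
  rewrite odd_perm_commute_mono // => [|p].
    by rewrite big1 // => p ps; rewrite ps gs mono.
  apply/idP/idP => [|/mono //]; apply: contraTT => H.
  have := mono (s p); rewrite fpf_lt H gs fpf_lt => /(_ isT).
  by [].
pose g' := (tperm p (s p) * g)%g.
have tps q : tperm p (s p) (s q) = s (tperm p (s p) q).
  case: (tpermP p (s p) q) => [->|->|/eqP n1 /eqP n2].
  - by rewrite tpermR fpfK.
  - by rewrite fpfK tpermL.
  - rewrite tpermD //; first by rewrite -(inj_eq (@perm_inj _ s)) fpfK eq_sym.
    by rewrite (inj_eq (@perm_inj _ s)) eq_sym.
have g's q : g' (s q) = s (g' q) by rewrite !permM tps gs.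
have g'D q : q != p -> q != s p -> g' q = g q by move=> n1 n2; rewrite permM tpermD // eq_sym.
have g'p : g' p = g (s p) by rewrite permM tpermL.
have g'sp : g' (s p) = g p by rewrite permM tpermR.
have other (q : 'I_m) : (q < s q)%N && (q != p) -> g' q = g q /\ g' (s q) = g (s q).
  case/andP => qs qp; have qsp : q != s p.
    by apply: contraTneq qs => ->; rewrite fpf_lt ps.
  split; first exact: g'D.
  by apply: g'D; rewrite ?(inj_eq (@perm_inj _ s)) // -(inj_eq (@perm_inj _ s)) fpfK.
have lt : (#|[pred q : 'I_m | (q < s q)%N && (g' (s q) < g' q)%N]| < n)%N.
  apply: leq_trans le; rewrite [X in (_ < X)%N](cardD1 p) !inE ps gps /= add1n ltnS.
  apply: subset_leq_card; apply/subsetP => q; rewrite !inE => /andP[qs].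
  case: (eqVneq q p) => [->|qp]; first by rewrite g'p g'sp ltnNge ltnW.
  by have [|-> ->] := other q; rewrite qs.
have := IH g' lt g's.
rewrite odd_permM odd_tperm eq_sym fpf_neq [in RHS](bigD1 p) //= [in X in _ -> _ = X](bigD1 p) //=.
rewrite g'p g'sp ps gps ltnNge ltnW //=.
rewrite (eq_bigr (fun q : 'I_m => (q < s q)%N (+) (g q < g (s q))%N)) => [E|q /other[-> ->] //].
by rewrite -E; case: (odd_perm g).
Qed.

End Involution.

Section Matchings.
Variables (m B : nat).

(* A perfect matching of the letters, as an involution, together with a colour
   on each pair; colour a has degree a + 1. *)
Local Notation matching := ('S_m * {ffun 'I_m -> 'I_B})%type.
Implicit Types (y : matching) (g h : 'S_m).

Definition match_act y g : matching := ((y.1 ^ g)%g, word_act y.2 g).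

(** Degrees are summed over letters, so each pair counts twice. *)
Definition match_dom (k : nat) : pred matching := fun y =>
  [&& fpf_involution y.1, [forall p, y.2 (y.1 p) == y.2 p] & (\sum_p (y.2 p).+1 == k.*2)%N].

Definition bad_colour (par : bool) (a : 'I_B) := odd a.+1 != par.

Definition flip y g (p : 'I_m) := (p < y.1 p)%N (+) (g p < g (y.1 p))%N.

Lemma flip_sym y g p : fpf_involution y.1 -> flip y g (y.1 p) = flip y g p.
Proof.
move=> sP; rewrite /flip (fpf_lt sP) (fpfK sP).
have ne : g p != g (y.1 p) :> nat by rewrite eq_sym (inj_eq val_inj) (inj_eq perm_inj) fpf_neq.
by rewrite [(g (y.1 p) < _)%N]ltnNge [(g p <= _)%N]leq_eqVlt (negbTE ne) /= addNb addbN negbK.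
Qed.

Definition match_sign (e par : bool) y g :=
  (e && odd_perm g) (+)
  \big[addb/false]_(p : 'I_m | (p < y.1 p)%N && bad_colour par (y.2 p)) flip y g p.

Lemma match_act1 y : match_act y 1%g = y.
Proof. by case: y => s c; rewrite /match_act conjg1 word_act1. Qed.

Lemma match_actM y g h : match_act y (g * h)%g = match_act (match_act y g) h.
Proof. by rewrite /match_act conjgM word_actM. Qed.

Lemma match_act_fst y g p : (match_act y g).1 (g p) = g (y.1 p).
Proof. by rewrite permJ. Qed.

Lemma match_act_snd y g p : (match_act y g).2 (g p) = y.2 p.
Proof. exact: word_actE. Qed.

Lemma match_domD k y g : match_dom k y -> match_dom k (match_act y g).
Proof.
case/and3P => /forallP s1 /forallP c1 k1; apply/and3P; split.
- apply/forallP => p; rewrite -[p](permKV g) !match_act_fst (inj_eq (@perm_inj _ g)).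
  by rewrite (inj_eq (@perm_inj _ g)).
- by apply/forallP => p; rewrite -[p](permKV g) match_act_fst !match_act_snd.
- rewrite -(eqP k1) (reindex_inj (@perm_inj _ g)) /=; apply/eqP.
  by apply: eq_bigr => p _; rewrite match_act_snd.
Qed.

Lemma match_signM e par k y g h : match_dom k y ->
  match_sign e par y (g * h)%g = match_sign e par y g (+) match_sign e par (match_act y g) h.
Proof.
move=> dy; have /and3P[sP /forallP cP _] := dy.
have /and3P[sP' /forallP cP' _] := match_domD g dy.
rewrite /match_sign odd_permM.
have flipM p : flip y (g * h)%g p = flip y g p (+) flip (match_act y g) h (g p).
  by rewrite /flip match_act_fst !permM; case: (_ < _)%N; case: (_ < _)%N; case: (_ < _)%N.
rewrite (eq_bigr _ (fun p _ => flipM p)) big_split /=.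
set s' := (match_act y g).1; set c' := (match_act y g).2.
have -> : \big[addb/false]_(p : 'I_m | (p < y.1 p)%N && bad_colour par (y.2 p)) flip (match_act y g) h (g p) =
  \big[addb/false]_(p : 'I_m | (p < s' p)%N && bad_colour par (c' p)) flip (match_act y g) h p.
  (* [R] selects the images of the chosen representatives, which need not be the smaller letters of
     their pairs. *)
  pose R (p : 'I_m) := ((g^-1)%g p < y.1 ((g^-1)%g p))%N.
  rewrite -(@transversal_sum _ s' _ _ _ _ (fun p => bad_colour par (c' p)) R (fun p => p < s' p)%N) /=.
  - rewrite [RHS](reindex_inj (@perm_inj _ g)) /=; apply: eq_bigl => p.
    by rewrite /R permK /c' match_act_snd.
  - by move=> p; apply: flip_sym.
  - by move=> p; rewrite (eqP (cP' p)).
  - move=> p; rewrite -{1}[p](permKV g) match_act_fst /R permK.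
    exact: fpf_lt.
  - by move=> p; apply: fpf_lt.
by case: e => //=; case: (odd_perm g); case: (odd_perm h); case: (bigop _ _ _); case: (bigop _ _ _).
Qed.

Definition match_char (e par : bool) k : 'CF([set: 'S_m]) :=
  signed_char match_act1 match_actM (@match_domD k) (@match_signM e par k).

Lemma match_char_char e par k : match_char e par k \is a character.
Proof. exact: signed_char_char. Qed.

(** A permutation fixing the matching commutes with its involution, so its sign is the parity of all
    reversed pairs; cancelling the pairs of one colour parity leaves those of the other. *)
Lemma match_char_dual par k : match_char true par k = match_char false (~~ par) k.
Proof.
apply/cfunP => g; rewrite !signed_charE; apply: eq_bigr => y /andP[/and3P[sP /forallP cP _] /eqP yg].
congr (_ ^+ _); congr nat_of_bool; rewrite /match_sign /=.
have gs p : g (y.1 p) = y.1 (g p) by rewrite -match_act_fst yg.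
rewrite (odd_perm_commute sP gs).
rewrite (bigID (fun p => bad_colour par (y.2 p))) /= -/(flip _ _ _) addbAC addbb.
apply: eq_bigl => p; congr (_ && _).
by rewrite /bad_colour; case: (odd _) par => [] [].
Qed.

End Matchings.

(** * Words decorated by a matching *)

Section MatchedWords.
Variables (m B N : nat).
Local Notation matching := ('S_m * {ffun 'I_m -> 'I_B})%type.
Local Notation word := {ffun 'I_m -> 'I_N}.
Implicit Types (x : word) (y : matching) (g h : 'S_m) (e : edge B N).

Definition pair_edge x y p : edge B N :=
  (y.2 p, if (x p <= x (y.1 p))%N then (x p, x (y.1 p)) else (x (y.1 p), x p)).

(** A choice of one end per pair that looks at the word first, so that outside loops it is preserved
    by every permutation fixing the word and the matching. *)
Definition first_end x y p :=
  (x p < x (y.1 p))%N || (x p == x (y.1 p)) && (p < y.1 p)%N.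

(** The complete invariant of a word with a matching. For a matching of degree [k < B] the counts
    are at most [k], so the default [e.1] is never taken. *)
Definition edge_count x y : {ffun edge B N -> 'I_B} :=
  [ffun e : edge B N => insubd e.1 #|[pred p : 'I_m | (p < y.1 p)%N && (pair_edge x y p == e)]|].

Lemma pair_edge_sym k x y p : match_dom k y -> pair_edge x y (y.1 p) = pair_edge x y p.
Proof.
case/and3P => sP /forallP cP _; rewrite /pair_edge (fpfK sP) (eqP (cP p)).
by case: ltngtP => // /ord_inj ->.
Qed.

Lemma first_end_sym k x y p : match_dom k y -> first_end x y (y.1 p) = ~~ first_end x y p.
Proof.
case/and3P => sP _ _; rewrite /first_end (fpfK sP) eq_sym.
have := fpf_lt sP p; rewrite (fpfK sP) => ->.
by rewrite -val_eqE /=; case: ltngtP.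
Qed.

Lemma pair_edge_act x y g p : pair_edge (word_act x g) (match_act y g) (g p) = pair_edge x y p.
Proof. by rewrite /pair_edge match_act_fst match_act_snd !word_actE. Qed.

Variable k : nat.
Hypothesis kB : (k < B)%N.

Lemma edge_countE x y e : match_dom k y ->
  (edge_count x y e).*2 = #|[pred p | pair_edge x y p == e]|.
Proof.
move=> dy; have /and3P[sP _ /eqP kE] := dy.
have C := card_half (Q := fun p => pair_edge x y p == e) (R := fun p => p < y.1 p)%N
  (fun p => congr1 (eq_op^~ e) (pair_edge_sym x p dy)) (fpf_lt sP).
have le : (#|[pred p | pair_edge x y p == e]| <= k.*2)%N.
  by rewrite -kE -sum1_card big_mkcond; apply: leq_sum => p _; case: ifP.
rewrite ffunE val_insubd ifT; first by rewrite [RHS]C.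
by apply: leq_ltn_trans kB; rewrite C leq_double in le.
Qed.

Lemma sum_edge_count (V : nmodType) (f : edge B N -> V) x y : match_dom k y ->
  \sum_e f e *+ (edge_count x y e).*2 = \sum_p f (pair_edge x y p).
Proof.
move=> dy; rewrite [RHS](partition_big (pair_edge x y) xpredT) //=; apply: eq_bigr => e _.
rewrite edge_countE // -sumr_const; apply: eq_bigr => p /eqP ->.
by [].
Qed.

Lemma edge_count_act x y x' y' : match_dom k y -> match_dom k y' ->
  edge_count x y = edge_count x' y' <-> exists g, x' = word_act x g /\ y' = match_act y g.
Proof.
move=> dy dy'; split=> [E|[g [-> y'E]]]; last first.
  apply/ffunP => e; apply: ord_inj; apply: double_inj; rewrite !edge_countE // y'E -!sum1_card.
  rewrite [RHS](reindex_inj (@perm_inj _ g)) /=; apply: eq_bigl => p.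
  by rewrite !inE pair_edge_act.
have /and3P[sP /forallP cP _] := dy; have /and3P[sP' /forallP cP' _] := dy'.
pose u p := (pair_edge x y p, first_end x y p).
pose u' p := (pair_edge x' y' p, first_end x' y' p).
have half z w e o : match_dom k w ->
   #|[pred p | (pair_edge z w p, first_end z w p) == (e, o)]| = edge_count z w e.
  move=> dw; apply: double_inj; rewrite edge_countE //.
  rewrite [RHS](card_half (s := w.1) (Q := fun p => pair_edge z w p == e) (R := fun p => first_end z w p == o)).
  - by congr _.*2; apply: eq_card => p; rewrite !inE andbC.
  - by move=> p; rewrite (pair_edge_sym _ _ dw).
  - by move=> p; rewrite (first_end_sym _ _ dw); case: o (first_end _ _ _) => [] [].
have [|g0 g0E] := @word_perm m _ u u'.
  by case=> e o; rewrite /u /u' !half ?E.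
have g0e p : pair_edge x' y' (g0 p) = pair_edge x y p := congr1 fst (g0E p).
have g0o p : first_end x' y' (g0 p) = first_end x y p := congr1 snd (g0E p).
(* [g0] need not respect the matchings; it is kept on the first ends and transported to the second
   ends along the pairs. *)
pose f p := if first_end x y p then g0 p else y'.1 (g0 (y.1 p)).
have fe p : first_end x' y' (f p) = first_end x y p.
  rewrite /f; case: ifP => o1; first by rewrite g0o.
  by rewrite (first_end_sym _ _ dy') g0o (first_end_sym _ _ dy) o1.
have pe p : pair_edge x' y' (f p) = pair_edge x y p.
  rewrite /f; case: ifP => o1; first exact: g0e.
  by rewrite (pair_edge_sym _ _ dy') g0e (pair_edge_sym _ _ dy).
have fi : injective f.
  move=> p q pq; have o1 := fe p; rewrite pq fe in o1.
  move: pq; rewrite /f o1; case: ifP => _ /perm_inj // /perm_inj /perm_inj //.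
have fs p : f (y.1 p) = y'.1 (f p).
  rewrite /f (first_end_sym _ _ dy); case: (first_end x y p) => /=.
    by rewrite (fpfK sP).
  by rewrite (fpfK sP').
exists (perm fi).
have endE (z : word) (w : matching) p : z p = if first_end z w p then (pair_edge z w p).2.1 else (pair_edge z w p).2.2.
  rewrite /first_end /pair_edge -val_eqE /=; case: (ltngtP (z p) (z (w.1 p))) => //= H.
  by case: ifP => // _; rewrite -(ord_inj H).
split; first by apply: word_act_eq => p; rewrite permE (endE x' y') fe pe -endE.
rewrite [y']surjective_pairing /match_act; congr (_, _).
  by apply/permP => q; rewrite -[q](permKV (perm fi)) permJ !permE fs.
by apply: word_act_eq => p; rewrite permE; have [] := pe p.
Qed.

Variable par : bool.

Definition allowed (t : {ffun edge B N -> 'I_B}) :=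
  [forall e, (e \in edges par B N) || (t e == 0%N :> nat)].

Lemma allowed_bad x y p : match_dom k y -> allowed (edge_count x y) ->
  bad_colour par (y.2 p) -> x p != x (y.1 p).
Proof.
move=> dy /forallP/(_ (pair_edge x y p)) + bad; apply: contraTneq => E.
rewrite mem_edges /edge_ok /pair_edge -E leqnn /= ltnn eqxx (negbTE bad) /= -double_eq0.
rewrite edge_countE // -lt0n; apply/card_gt0P; exists p.
by rewrite inE /pair_edge -E leqnn.
Qed.

Lemma allowed_first_end x y p : match_dom k y -> allowed (edge_count x y) ->
  first_end x y p && bad_colour par (y.2 p) = (x p < x (y.1 p))%N && bad_colour par (y.2 p).
Proof.
move=> dy al; case: (boolP (bad_colour _ _)) => [bad|]; rewrite ?andbF // !andbT.
by rewrite /first_end (negbTE (allowed_bad dy al bad)) orbF.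
Qed.

(** Badly coloured pairs join different letters of the word, so ordering their ends by these letters
    is an orientation preserved by [g]; relative to it no pair is reversed. *)
Lemma match_sign_fixed c x y g : match_dom k y -> allowed (edge_count x y) ->
  word_act x g = x -> match_act y g = y -> match_sign c par y g = c && odd_perm g.
Proof.
move=> dy al xg yg; have /and3P[sP /forallP cP _] := dy.
rewrite /match_sign.
rewrite -(@transversal_sum _ y.1 _ _ _ _ (fun p => bad_colour par (y.2 p)) (first_end x y) (fun p => p < y.1 p)%N) /=; first last.
- exact: fpf_lt.
- by move=> p; apply: first_end_sym dy.
- by move=> p; rewrite (eqP (cP p)).
- by move=> p; apply: flip_sym.
have xE p : x (g p) = x p by rewrite -{1}xg word_actE.
have sE p : y.1 (g p) = g (y.1 p) by rewrite -{1}yg match_act_fst.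
have cE p : y.2 (g p) = y.2 p by rewrite -{1}yg match_act_snd.
rewrite /flip big_split /= [X in _ (+) (X (+) _)](reindex_inj (@perm_inj _ g)) /=.
rewrite (eq_bigl (fun p => first_end x y p && bad_colour par (y.2 p))) => [|p]; last first.
  by rewrite !allowed_first_end // sE !xE cE.
by under eq_bigr => p _ do rewrite sE; rewrite addbb addbF.
Qed.

(** Transposing the two ends of a badly coloured loop fixes the word and the matching and reverses
    exactly that pair. *)
Lemma not_allowed_flip c x y : match_dom k y -> ~~ allowed (edge_count x y) ->
  exists g, [/\ word_act x g = x, match_act y g = y & c && odd_perm g != match_sign c par y g].
Proof.
move=> dy; have /and3P[sP /forallP cP _] := dy.
rewrite negb_forall => /existsP[e]; rewrite negb_or mem_edges => /andP[ne].
rewrite -double_eq0 edge_countE // -lt0n => /card_gt0P[p0]; rewrite inE => /eqP pe.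
have [p [pl xp bad]] : exists p : 'I_m, [/\ (p < y.1 p)%N, x p = x (y.1 p) & bad_colour par (y.2 p)].
  have [p pl pe'] : exists2 p : 'I_m, (p < y.1 p)%N & pair_edge x y p = e.
    case: (boolP (p0 < y.1 p0)%N) => H; first by exists p0.
    by exists (y.1 p0); rewrite ?fpf_lt ?H // (pair_edge_sym _ _ dy).
  exists p; move: ne; rewrite -pe' /edge_ok /pair_edge /= negb_or negb_and.
  case: (ltngtP (x p) (x (y.1 p))) => /= [H|H|/ord_inj E]; rewrite ?H //.
  by rewrite -E ltnn eqxx => bad; split.
have xg : word_act x (tperm p (y.1 p)) = x.
  apply/esym/word_act_eq => q; case: tpermP => [->|->|//]; by rewrite xp.
have sg q : tperm p (y.1 p) (y.1 q) = y.1 (tperm p (y.1 p) q).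
  case: (tpermP p (y.1 p) q) => [->|->|/eqP n1 /eqP n2].
  - by rewrite tpermR (fpfK sP).
  - by rewrite (fpfK sP) tpermL.
  - rewrite tpermD //; first by rewrite -(inj_eq (@perm_inj _ y.1)) (fpfK sP) eq_sym.
    by rewrite (inj_eq (@perm_inj _ y.1)) eq_sym.
exists (tperm p (y.1 p)); split => //.
  rewrite [y in RHS]surjective_pairing /match_act; congr (_, _).
    apply/permP => q; rewrite -[q](permKV (tperm p (y.1 p))) permJ.
    by rewrite sg.
  apply/esym/word_act_eq => q; case: tpermP => [->|->|//]; by rewrite (eqP (cP p)).
rewrite /match_sign (bigD1 p) /= ?pl // big1 => [|q /andP[/andP[qs _] qp]].
  by rewrite addbF /flip tpermL tpermR pl ltnNge (ltnW pl) addbT; case: (_ && _).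
rewrite /flip; have n1 : q != y.1 p by apply: contraTneq qs => ->; rewrite (fpf_lt sP) pl.
rewrite !tpermD ?addbb //; try by rewrite eq_sym.
  by rewrite -(inj_eq (@perm_inj _ y.1)) (fpfK sP) eq_sym.
by rewrite (inj_eq (@perm_inj _ y.1)) eq_sym.
Qed.

Implicit Types (t : {ffun edge B N -> 'I_B}) (b : ivec N).

Lemma content_edge_count x y i : match_dom k y ->
  (content x i)%:Z = (\sum_e edge_vec e *+ edge_count x y e) i.
Proof.
move=> dy; have /(congr1 (fun v : ivec N => v i)) := sum_edge_count (@edge_vec B N) x dy.
have -> : \sum_p edge_vec (pair_edge x y p) = (\sum_p iunit (x p)) *+ 2.
  rewrite mulr2n [X in _ = _ + X](reindex_inj (@perm_inj _ y.1)) -big_split /=; apply: eq_bigr => p _.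
  by rewrite /edge_vec /pair_edge /=; case: ifP => _ //=; rewrite addrC.
under eq_bigr => e _ do rewrite -muln2 mulrnA.
rewrite sumrMnl !ffunMnE -[LHS]mulr_natr -[RHS]mulr_natr => /mulIf -> //.
rewrite sum_ffunE /content -sum1_card -natz natr_sum big_mkcond /=.
by apply: eq_bigr => p _; rewrite ffunE inE eq_sym; case: eqP.
Qed.

Lemma degree_edge_count x y : match_dom k y -> (\sum_(e : edge B N) e.1.+1 * edge_count x y e = k)%N.
Proof.
move=> dy; have := sum_edge_count (fun e : edge B N => (e.1.+1)%:Z) x dy.
have /and3P[_ _ /eqP kE] := dy.
have -> : \sum_p (pair_edge x y p).1.+1%:Z = k.*2%:Z.
  by rewrite -kE -[RHS]natz natr_sum; apply: eq_bigr => p _; rewrite natz.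
under eq_bigr => e _ do rewrite -mulr_natr natz -PoszM -doubleMr -muln2.
move=> E; apply/double_inj/eqP; rewrite -eqz_nat -E -muln2 big_distrl -[X in X == _]natz natr_sum.
by apply/eqP/eq_bigr => e _; rewrite natz.
Qed.

Definition edge_fillings b : {set {ffun edge B N -> 'I_B}} :=
  [set t | allowed t && ((\sum_(e : edge B N) e.1.+1 * t e == k)%N && (\sum_e edge_vec e *+ t e == b))].

Lemma symFE b : symF par B k b = #|edge_fillings b|%:Z.
Proof.
rewrite /symF -[edgesL _ _ _]cats0 (cnt_block_weighted (fun e : edge B N => e.1.+1)) ?edges_uniq //.
rewrite -sum1_card -natz natr_sum /= [LHS]big_mkcond [RHS]big_mkcond; apply: eq_bigr => t _.
rewrite inE -/(allowed t) subr_eq0 [b == _]eq_sym; case: (allowed t) => //=.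
case: leqP => H; last by rewrite (gtn_eqF H).
by rewrite subn_eq0 [_ == k]eqn_leq H /=; case: (_ && _).
Qed.

Lemma fill_matching t b : t \in edge_fillings b -> \sum_i b i = m%:Z ->
  exists x, exists y, [&& word_dom b x, match_dom k y & edge_count x y == t].
Proof.
rewrite inE => /and3P[/forallP al /eqP tk /eqP tb] bm.
have iu (j : 'I_N) : \sum_i iunit j i = 1.
  by rewrite (bigD1 j) //= ffunE eqxx big1 ?addr0 // => i /negbTE ij; rewrite ffunE ij.
(* Each edge supplies [t e] positions for each of its two ends, which the boolean marks. *)
have size : (\sum_(z : edge B N * bool) t z.1 = m)%N.
  apply/eqP; rewrite -eqz_nat -bm -tb.
  rewrite -(pair_bigA _ (fun (e : edge B N) (o : bool) => t e : nat)) /=.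
  under [X in _ == X]eq_bigr => i _ do rewrite sum_ffunE.
  rewrite [X in _ == X]exchange_big /= -[X in X == _]natz natr_sum; apply/eqP/eq_bigr => e _.
  rewrite big_bool /= /edge_vec.
  under eq_bigr => i _ do rewrite ffunMnE ffunE.
  by rewrite sumrMnl big_split /= !iu mulrnDl natrD.
have [u uE] := word_exists size.
pose v p := ((u p).1, ~~ (u p).2).
have [|g gE] := @word_perm m _ u v.
  case=> e o; rewrite uE -(uE (e, ~~ o)); apply: eq_card => p.
  by rewrite !inE -!pair_eqE /= /v; case: o (u p).2 => [] [].
have ug p : u (g p) = ((u p).1, ~~ (u p).2).
  by rewrite -(gE p) /v /= negbK -surjective_pairing.
have ugV p : u ((g^-1)%g p) = ((u p).1, ~~ (u p).2).
  by rewrite -{2 3}[p](permKV g) ug /= negbK -surjective_pairing.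
(* [g] exchanges the two kinds of ends but need not be an involution; using its inverse on one kind
   makes it one. *)
pose f p := if (u p).2 then g p else (g^-1)%g p.
have uf p : u (f p) = ((u p).1, ~~ (u p).2) by rewrite /f; case: ifP => o; rewrite (ug, ugV) o.
have fK : cancel f f.
  by move=> p; rewrite {1}/f uf /= /f; case: ((u p).2); rewrite ?permK ?permKV.
pose x : word := [ffun p => if (u p).2 then (u p).1.2.1 else (u p).1.2.2].
pose y : matching := (perm (can_inj fK), [ffun p => (u p).1.1]).
have total (F : edge B N -> nat) : (\sum_p F (u p).1 = (\sum_e F e * t e).*2)%N.
  rewrite (partition_big u xpredT) //= -muln2 big_distrl /=.
  rewrite -(pair_bigA _ (fun e o => \sum_(p | u p == (e, o)) F (u p).1)%N) /=.
  apply: eq_bigr => e _; rewrite -mulnA muln2 -addnn mulnDr.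
  have half o : (\sum_(p | u p == (e, o)) F (u p).1 = F e * t e)%N.
    rewrite -(uE (e, o)) mulnC -sum_nat_const; apply: eq_big => [p|p /eqP -> //].
    by rewrite inE.
  by rewrite big_bool !half.
have dy : match_dom k y.
  apply/and3P; split.
  - apply/forallP => p; rewrite !permE fK eqxx; apply/eqP => /(congr1 u).
    by rewrite uf => /(congr1 snd); case: (u p).2.
  - by apply/forallP => p; rewrite /y /= !ffunE permE uf.
  - by rewrite -tk -(total (fun e => e.1.+1)); apply/eqP/eq_bigr => p _; rewrite ffunE.
have cE : edge_count x y = t.
  apply/ffunP => e; apply: ord_inj; apply: double_inj; rewrite edge_countE //.
  have <- : (\sum_(p | (u p).1 == e) 1 = (t e).*2)%N.
    rewrite big_mkcond (total (fun e' => if e' == e then 1 else 0)%N) (bigD1 e) //= eqxx mul1n.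
    by rewrite big1 ?addn0 // => e' /negbTE ->.
  rewrite -sum1_card; apply: eq_bigl => p; rewrite inE.
  suff -> : pair_edge x y p = (u p).1 by [].
  have : ((u p).1.2.1 <= (u p).1.2.2)%N.
    have := al (u p).1; rewrite mem_edges => /orP[/orP[/ltnW //|/andP[/eqP -> _] //]|].
    have : (0 < t (u p).1)%N.
      by rewrite -(uE (u p)); apply/card_gt0P; exists p; rewrite inE.
    by rewrite lt0n => /negbTE ->.
  have ufp := uf p; case up: (u p) ufp => [[a [i j]] o] /= ufp ij.
  rewrite /pair_edge /x /y /= !ffunE permE ufp up /=; case: o {up ufp} => /=; first by rewrite ij.
  by case: (leqP j i) => // ji; congr (_, (_, _)); apply: ord_inj; apply/eqP; rewrite eqn_leq ij ji.
exists x, y; rewrite dy cE eqxx !andbT; apply/forallP => i.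
by rewrite (content_edge_count _ _ dy) cE tb.
Qed.

(* Loops of the wrong parity can be flipped, so they do not contribute to the
   signed orbit count. *)
Lemma cfdot_word_match c b : \sum_i b i = m%:Z ->
  '[word_char m c b, match_char m B c par k] = (symF par B k b)%:~R.
Proof.
move=> bm; rewrite symFE /word_char /match_char.
rewrite (@cfdot_signed_char _ _ _ _ _ _ _ _ _ _ _ _ _ _ _ _ _ _ edge_count allowed).
- congr _%:R; apply: eq_card => t; rewrite !inE; case: (boolP (allowed t)) => //= al.
  apply/existsP/andP => [[x /existsP[y /and3P[/forallP bx dy /eqP <-]]]|[tk tb]].
    split; first by rewrite degree_edge_count.
    by apply/eqP/ffunP => i; rewrite -content_edge_count // (eqP (bx i)).
  have [|x [y xy]] := @fill_matching t b _ bm; first by rewrite inE al tk.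
  by exists x; apply/existsP; exists y.
- by move=> x y x' y' _ dy _ dy'; apply: edge_count_act dy dy'.
- by move=> x y _ dy al g xg yg; rewrite (match_sign_fixed c dy al xg yg).
- by move=> x y _ dy al; apply: (not_allowed_flip c dy al).
Qed.

End MatchedWords.

(** * Conclusion *)

Lemma cfdot_jacobi_match m B N' k e par (l : ivec N'.+1) : (k < B)%N ->
  \sum_i (l i - idelta N'.+1 i) = m%:Z ->
  '[jacobi_char m e l, match_char m B e par k] = (glK par B k l)%:~R.
Proof.
move=> kB lm; rewrite /jacobi_char cfdot_suml glK_alt rmorph_sum; apply: eq_bigr => s _.
rewrite cfdotZl cfdot_word_match ?(jacobi_shift_sum lm) //.
by rewrite -[RHS]/(((-1) ^+ s * symF par B k (l - fperm (idelta N'.+1) s))%:~R) intrM intr_sign.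
Qed.

Section Duality.
Variables (m B k N' M' : nat).
Local Notation N := N'.+1.
Local Notation M := M'.+1.
Variables (la : 'I_N -> nat) (la' : 'I_M -> nat).
Hypothesis laM : forall i, (la i <= M)%N.
Hypothesis laN : forall j, (la' j <= N)%N.
Hypothesis dual : forall (i : 'I_N) (j : 'I_M), (j < la i)%N = (i < la' j)%N.
Hypothesis kB : (k < B)%N.
Hypothesis lasum : (\sum_i la i = m)%N.

Lemma dual_sum : (\sum_j la' j = m)%N.
Proof.
rewrite -lasum -(eq_bigr _ (fun i _ => sum_dual laM dual i)) exchange_big /=.
by apply: eq_bigr => j _; rewrite sum_lt_ord.
Qed.

(* Two distinct irreducible characters cannot both occur in the two word
   characters, whose inner product is 1. *)
Lemma jacobi_char_dual e :
  jacobi_char m e (nvec la + idelta N) = jacobi_char m (~~ e) (nvec la' + idelta M).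
Proof.
have dual' (j : 'I_M) (i : 'I_N) : (i < la' j)%N = (j < la i)%N by rewrite dual.
have [i iE] := jacobi_nvec_irr laM dual lasum e.
have [j jE] := jacobi_nvec_irr laN dual' dual_sum (~~ e).
case: (eqVneq i j) => [ij|ij]; first by rewrite iE jE ij.
have h1 := cfdot_jacobi_word laM dual lasum e.
have h2 := cfdot_jacobi_dual laM laN dual lasum e.
have h3 := cfdot_jacobi_word laN dual' dual_sum (~~ e).
have h4 := cfdot_jacobi_dual laN laM dual' dual_sum (~~ e).
have h5 := cfdot_word_dual laM laN dual lasum e.
rewrite negbK in h4; rewrite iE in h1 h2; rewrite jE in h3 h4.
have vc e' n (b : ivec n) : word_char m e' b \is a character by apply: word_char_char.
have {}h1 : '[word_char m e (nvec la), 'chi_i] = 1 by rewrite cfdotC h1 rmorph1.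
have {}h2 : '[word_char m (~~ e) (nvec la'), 'chi_i] = 1 by rewrite cfdotC h2 rmorph1.
have {}h3 : '[word_char m (~~ e) (nvec la'), 'chi_j] = 1 by rewrite cfdotC h3 rmorph1.
have {}h4 : '[word_char m e (nvec la), 'chi_j] = 1 by rewrite cfdotC h4 rmorph1.
exfalso; move: h5; rewrite cfdot_sum_irr (bigD1 i) //= (bigD1 j) 1?eq_sym //=.
rewrite h1 h2 h3 h4 !rmorph1 !mulr1 => /eqP; rewrite addrA -subr_eq0 addrAC addrK => /eqP E.
have : 0 < 1 + \sum_(t | (t != i) && (t != j))
   '[word_char m e (nvec la), 'chi_t] * '[word_char m (~~ e) (nvec la'), 'chi_t]^* :> algC.
  rewrite ltr_wpDr ?ltr01 ?sumr_ge0 // => t _.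
  by rewrite mulr_ge0 ?conjC_ge0 // natr_ge0 // Cnat_cfdot_char_irr.
by rewrite E ltxx.
Qed.

Lemma glK_dual : glK false B k (nvec la + idelta N) = glK true B k (nvec la' + idelta M).
Proof.
apply: (@mulrIz algC 1); first by rewrite oner_eq0.
rewrite -(cfdot_jacobi_match false false kB (shifted_sum lasum)).
rewrite -(cfdot_jacobi_match true true kB (shifted_sum dual_sum)).
by rewrite jacobi_char_dual match_char_dual.
Qed.

Lemma glK_ge0 : 0 <= glK false B k (nvec la + idelta N).
Proof.
rewrite -(ler0z algC) -(cfdot_jacobi_match false false kB (shifted_sum lasum)).
have [i ->] := jacobi_nvec_irr laM dual lasum false.
exact/natr_ge0/Cnat_cfdot_char/match_char_char/irr_char.
Qed.

End Duality.

Lemma sum_idelta n : (\sum_i `|idelta n i| = 'C(n, 2))%N.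
Proof.
rewrite -bin2_sum big_mkord (reindex_inj rev_ord_inj) /=; apply: eq_bigr => i _.
by rewrite ffunE /=; have := ltn_ord i; lia.
Qed.

Lemma part_ivec_pad n la : (size la <= n)%N ->
  part_ivec n.+1 la + idelta n.+1 = pad (part_ivec n la + idelta n).
Proof.
move=> sn; apply/ffunP => i; rewrite !ffunE; case: (unliftP ord_max i) => [j ->|->].
  rewrite !ffunE lift_max subSS -addrA; congr (_ + _).
  by rewrite -[1]/(Posz 1) -PoszD subnS addn1 prednK // subn_gt0 -[n in (_ < n)%N]/(n.+1.-1) ltn_ord.
by rewrite /= nth_default // subnn.
Qed.

Lemma glK_stable par B k n d la : (0 < B)%N -> (size la <= n)%N ->
  glK par B k (part_ivec (n + d) la + idelta (n + d)) = glK par B k (part_ivec n la + idelta n).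
Proof.
move=> B0 sn; elim: d => [|d IH]; first by rewrite addn0.
by rewrite addnS part_ivec_pad ?glK_pad // (leq_trans sn) // leq_addr.
Qed.

(** One coordinate beyond the length keeps the index set nonempty for the empty partition; padding
    reduces every larger number of coordinates to this one. *)
Lemma lusztig_coef_stable g la k :
  stable_lim (fun n => lusztig_coef g n la [::] k)
    (glK (type_parity g) k.+1 k (part_ivec (size la).+1 la + idelta (size la).+1)).
Proof.
(* The excess over delta is at most the size [S] of the partition, and the first coordinate is at
   least the rank minus 1; the threshold makes it the large entry required by [lieK_eq_glK]. *)
pose S := sumn la; exists ((size la).+1 + (2 * S + 1 + S.+1 * k).+1)%N => n nn.
rewrite (lusztig_coefE _ _ _ (ltnSn k)).
rewrite -(glK_stable _ _ (n - (size la).+1) _ (leqnSn _)) // subnKC; last by lia.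
case: n nn => [|n] nn; first by lia.
have vE i : (part_ivec n.+1 la + idelta n.+1) i = (nth 0 la i + (n - i))%N%:Z.
  by rewrite !ffunE.
apply: (@lieK_eq_glK _ _ S) => // [i||].
- by rewrite vE.
- rewrite /isize; under eq_bigr => i _ do rewrite vE absz_nat.
  rewrite big_split /= leq_add //.
    rewrite /S sumnE (big_nth 0%N) big_mkord.
    rewrite [X in (X <= _)%N](bigID (fun i : 'I_n.+1 => (i < size la)%N)) /= [X in (_ + X)%N]big1 ?addn0 => [|i].
      by rewrite (big_ord_widen n.+1 (fun i => nth 0%N la i)) //; lia.
    by rewrite -leqNgt => /(nth_default 0%N).
  by rewrite -sum_idelta leq_sum // => i _; rewrite ffunE.
- by right; exists ord0; rewrite vE /=; lia.
Qed.

Lemma count_gt_sorted la i j : sorted geq la ->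
  (i < count (fun p => (j < p)%N) la)%N = (j < nth 0%N la i)%N.
Proof.
elim: la i => [|a s IH] i; first by rewrite nth_nil !ltn0.
move=> /= srt; have /allP amax : all (geq a) s.
  by apply: order_path_min srt => x y z /= xy yz; apply: leq_trans yz xy.
case: (ltnP j a) => ja /=.
  by case: i => [|i] //=; rewrite add1n ltnS IH // (path_sorted srt).
rewrite add0n (eq_in_count (a2 := pred0)) ?count_pred0 ?ltn0 => [|p ps].
  case: i => [|i] /=; first by rewrite ltnNge ja.
  case: (ltnP i (size s)) => il; last by rewrite nth_default.
  by rewrite ltnNge (leq_trans (amax _ (mem_nth 0%N il)) ja).
by rewrite /= ltnNge (leq_trans (amax _ ps) ja).
Qed.

Theorem proposition5p3p1 (la : seq nat) (hla : is_part la) :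
  exists Kso Ksp : nat -> nat,
    [/\ is_Kso la [::] Kso,
        is_Ksp (conj_part la) [::] Ksp
      & Kso =1 Ksp].
Proof.
have /andP[srt _] := hla; set la' := conj_part la.
have sz' : size la' = head 0%N la by rewrite size_mkseq.
have le_head i : (nth 0%N la i <= head 0%N la)%N.
  case: la srt {hla la' sz'} => [|a s] srt; first by rewrite nth_nil.
  case: (ltnP i (size (a :: s))) => [il|il]; last by rewrite nth_default.
  have := mem_nth 0%N il; rewrite inE => /orP[/eqP ->//|].
  by apply: (allP (order_path_min _ srt)) => x y z /= xy yz; apply: leq_trans yz xy.
have nth' j : nth 0%N la' j = count (fun p => (j < p)%N) la.
  case: (ltnP j (size la')) => js; first by rewrite nth_mkseq // -sz'.
  rewrite nth_default //; apply/esym/eqP; rewrite -leqn0 leqNgt count_gt_sorted //.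
  by rewrite -leqNgt (leq_trans (le_head 0%N)) // -sz'.
pose val g mu k := glK (type_parity g) k.+1 k (part_ivec (size mu).+1 mu + idelta (size mu).+1).
pose f (i : 'I_(size la).+1) := nth 0%N la i.
pose f' (j : 'I_(size la').+1) := nth 0%N la' j.
have fM i : (f i <= (size la').+1)%N by rewrite sz' ltnW // ltnS le_head.
have f'N j : (f' j <= (size la).+1)%N by rewrite /f' nth' ltnW // ltnS count_size.
have dual (i : 'I_(size la).+1) (j : 'I_(size la').+1) : (j < f i)%N = (i < f' j)%N.
  by rewrite /f' nth' count_gt_sorted.
have ge0 k : 0 <= val SOodd la k := glK_ge0 fM dual (ltnSn k) (erefl _).
exists (fun k => `|val SOodd la k|%N), (fun k => `|val SP la' k|%N); split.
- by move=> k; rewrite gez0_abs //; split; apply: lusztig_coef_stable.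
- move=> k; rewrite gez0_abs; first exact: lusztig_coef_stable.
  by rewrite /val /= -(glK_dual fM f'N dual (ltnSn k) (erefl _)); apply: ge0.
- by move=> k; congr absz; apply: (glK_dual fM f'N dual (ltnSn k) (erefl _)).
Qed.
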